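(* Provably in ZFC, the following three statements are equivalent: $\mathbf{Det}(\Sigma^1_1)$; $\mathbf{Det}(\mathbf{CFL}_\omega)$; $\mathbf{Det}(\mathbf{BCL}(1)_\omega)$. That is: every Gale–Stewart game with an effective analytic winning set is determined iff every Gale–Stewart game whose winning set is accepted by a Büchi pushdown automaton is determined iff every Gale–Stewart game whose winning set is accepted by a Büchi $1$-counter automaton is determined.
   Context: All alphabets are finite. Gale–Stewart game: for $A\subseteq X^\omega$, in $G(A)$ Players 1 and 2 alternately write letters of $X$ (Player 1 first), producing $x=a_1b_1a_2b_2\cdots$; Player 1 wins iff $x\in A$. $G(A)$ is determined if one player has a winning strategy. For a class $\mathcal C$ of $\omega$-languages, $\mathbf{Det}(\mathcal C)$ is the sentence ''every game $G(A)$ with $A\subseteq X^\omega$ in $\mathcal C$ is determined''. A Büchi $k$-counter automaton is $(K,\Sigma,\Delta,q_0,F)$ with $\Delta\subseteq K\times(\Sigma\cup\{\lambda\})\times\{0,1\}^k\times K\times\{0,1,-1\}^k$: counters hold naturals; a transition $(q,a,i_1,\dots,i_k,q',j_1,\dots,j_k)$ applies in configuration $(q,c_1,\dots,c_k)$ when $i_m=0$ iff $c_m=0$, reads $a$ (nothing if $a=\lambda$), and moves to $(q',c_1+j_1,\dots,c_k+j_k)$ (zero counters are not decremented); it accepts $\sigma\in\Sigma^\omega$ iff some run from $(q_0,0,\dots,0)$ reading $\sigma$ visits $F$ infinitely often. $\mathbf{BCL}(k)_\omega$ is the class of $\omega$-languages accepted by such automata; $\mathbf{CFL}_\omega$ is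 the class of $\omega$-languages accepted by Büchi pushdown automata. $\Sigma^1_1$ is the class of effective analytic sets: $L\subseteq X^\omega$ such that for some recursive $R\subseteq\mathbb N\times\{0,1\}^*\times X^*$, $L=\{\sigma:\exists\tau\in\{0,1\}^\omega\ \forall n\ \exists m\ (n,\tau[m],\sigma[m])\in R\}$, where $y[m]$ is the length-$m$ prefix. *)

(* Defs.v *)
From Stdlib Require List.
From mathcomp Require Import all_boot.

Set Implicit Arguments.
Unset Strict Implicit.
Unset Printing Implicit Defensive.

Definition prefix (T : Type) (y : nat -> T) (m : nat) : seq T := mkseq y m.

(** A strategy maps the finite history of the play to the next letter.
    Positions 0,2,4,... (i.e. a_1,a_2,...) are played by Player 1,
    positions 1,3,5,... (i.e. b_1,b_2,...) by Player 2. *)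
Definition strategy (X : Type) := seq X -> X.

Definition consistent1 (X : Type) (s : strategy X) (x : nat -> X) : Prop :=
  forall n, x n.*2 = s (prefix x n.*2).

Definition consistent2 (X : Type) (t : strategy X) (x : nat -> X) : Prop :=
  forall n, x n.*2.+1 = t (prefix x n.*2.+1).

Definition winning1 (X : Type) (A : (nat -> X) -> Prop) (s : strategy X) : Prop :=
  forall x, consistent1 s x -> A x.

Definition winning2 (X : Type) (A : (nat -> X) -> Prop) (t : strategy X) : Prop :=
  forall x, consistent2 t x -> ~ A x.

Definition determined (X : Type) (A : (nat -> X) -> Prop) : Prop :=
  (exists s, winning1 A s) \/ (exists t, winning2 A t).

Definition omega_class := forall X : finType, ((nat -> X) -> Prop) -> Prop.

Definition Det (C : omega_class) : Prop :=
  forall (X : finType) (A : (nat -> X) -> Prop), 0 < #|X| -> C X A -> determined A.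

Inductive recf : Type :=
| RZero : recf
| RSucc : recf
| RProj : nat -> recf
| RComp : recf -> list recf -> recf
| RPrim : recf -> recf -> recf
| RMu : recf -> recf.

Inductive reval : recf -> list nat -> nat -> Prop :=
| ev_zero v : reval RZero v 0
| ev_succ x v : reval RSucc (x :: v) x.+1
| ev_proj i v : i < size v -> reval (RProj i) v (nth 0 v i)
| ev_comp f gs v ys y :
    revals gs v ys -> reval f ys y -> reval (RComp f gs) v y
| ev_prim0 f g v y : reval f v y -> reval (RPrim f g) (0 :: v) y
| ev_primS f g n v r y :
    reval (RPrim f g) (n :: v) r -> reval g (n :: r :: v) y ->
    reval (RPrim f g) (n.+1 :: v) y
| ev_mu f v n :
    reval f (n :: v) 0 ->
    (forall m, m < n -> exists k, reval f (m :: v) k.+1) ->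
    reval (RMu f) v n
with revals : list recf -> list nat -> list nat -> Prop :=
| evs_nil v : revals nil v nil
| evs_cons g gs v y ys :
    reval g v y -> revals gs v ys -> revals (g :: gs) v (y :: ys).

Definition recursive (R : nat -> Prop) : Prop :=
  exists c : recf, forall k, (R k -> reval c [:: k] 1) /\ (~ R k -> reval c [:: k] 0).

Definition Sigma11 : omega_class := fun X L =>
  exists R : nat -> Prop, recursive R /\
    forall sigma : nat -> X,
      L sigma <-> exists tau : nat -> bool, forall n : nat, exists m : nat,
        R (pickle (n, prefix tau m, prefix sigma m)).

(** [lab i] is the input symbol read at step i (None = lambda).  The run
    reads sigma iff the labels, concatenated, give exactly sigma:
    pos i is the number of letters read before step i. *)
Definition reads (X : Type) (lab : nat -> option X) (sigma : nat -> X) : Prop :=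
  exists pos : nat -> nat,
    [/\ pos 0 = 0,
        forall i, pos i.+1 = pos i + (if lab i is Some _ then 1 else 0),
        forall i a, lab i = Some a -> sigma (pos i) = a
      & forall n, exists i, n <= pos i].

Inductive cmove : Type := CDec | CKeep | CInc.

Definition apply_cmove (c : nat) (j : cmove) : nat :=
  match j with CDec => c.-1 | CKeep => c | CInc => c.+1 end.

(** A transition (q, a, i_1..i_k, q', j_1..j_k); i_m = true means "counter m
    is nonzero" (i_m = 1). *)
Record ctrans (k : nat) (K X : Type) := CTrans {
  ct_src : K; ct_lab : option X; ct_test : 'I_k -> bool;
  ct_dst : K; ct_upd : 'I_k -> cmove }.

Record counter_aut (k : nat) (X : Type) := CounterAut {
  ca_K : finType;
  ca_delta : list (ctrans k ca_K X);
  ca_q0 : ca_K;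
  ca_F : {pred ca_K} }.

Definition ca_accepts (k : nat) (X : Type) (M : counter_aut k X)
    (sigma : nat -> X) : Prop :=
  exists (st : nat -> ca_K M) (cnt : nat -> 'I_k -> nat)
         (tr : nat -> ctrans k (ca_K M) X),
  [/\ st 0 = ca_q0 M,
      (forall m, cnt 0 m = 0),
      (forall i, [/\ List.In (tr i) (ca_delta M),
                     ct_src (tr i) = st i,
                     (forall m, ct_test (tr i) m = (cnt i m != 0)),
                     st i.+1 = ct_dst (tr i)
                   & forall m, cnt i.+1 m = apply_cmove (cnt i m) (ct_upd (tr i) m)]),
      reads (fun i => ct_lab (tr i)) sigma
    & forall N, exists i, N <= i /\ @ca_F _ _ M (st i)].

Definition BCL (k : nat) : omega_class := fun X L =>
  exists M : counter_aut k X, forall sigma, L sigma <-> ca_accepts M sigma.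

Record ptrans (K X G : Type) := PTrans {
  pt_src : K; pt_lab : option X; pt_top : G; pt_dst : K; pt_push : seq G }.

Record pda (X : Type) := PDA {
  pd_K : finType;
  pd_G : finType;
  pd_delta : list (ptrans pd_K X pd_G);
  pd_q0 : pd_K;
  pd_Z0 : pd_G;
  pd_F : {pred pd_K} }.

Definition pd_accepts (X : Type) (M : pda X) (sigma : nat -> X) : Prop :=
  exists (st : nat -> pd_K M) (stk : nat -> seq (pd_G M))
         (tr : nat -> ptrans (pd_K M) X (pd_G M)),
  [/\ st 0 = pd_q0 M,
      stk 0 = [:: pd_Z0 M],
      (forall i, [/\ List.In (tr i) (pd_delta M),
                     pt_src (tr i) = st i,
                     st i.+1 = pt_dst (tr i)
                   & exists rest, stk i = pt_top (tr i) :: rest /\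
                                  stk i.+1 = pt_push (tr i) ++ rest]),
      reads (fun i => pt_lab (tr i)) sigma
    & forall N, exists i, N <= i /\ @pd_F _ M (st i)].

Definition CFL : omega_class := fun X L =>
  exists M : pda X, forall sigma, L sigma <-> pd_accepts M sigma.

(* Main.v *)
(** Pushdown languages are effective analytic and one-counter automata are
    pushdown automata, so the point is to reduce a game [G(A)], [A] effective
    analytic, to a game [G(B)] with [B] a one-counter language. Every letter of
    [G(A)] is hidden in long padding, which is written by Player 2 alone:
    blocks of [k + 1] zeros for k = 0, 1, ..., each ended by a separator. A
    one-counter automaton recognizes ill-formed padding by comparing two
    consecutive blocks, and such plays belong to [B]; so Player 2 has to write
    the right padding. At each separator Player 1 either lets a pair of letters of
    [G(A)] be played or asks for one more block. On well-formed plays the automaton guesses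
    the witness [tau] and runs a register machine testing the recursive predicate
    that defines [A]; the registers are coded by a single number [c], and the
    block lengths serve as a second memory in which the counter can be
    multiplied or divided. The number of steps needed between two pairs of
    letters is bounded in terms of the pairs played so far, over all guesses, so Player 1 can wait
    long enough. Hence a winning strategy of either player in [G(B)] yields a winning
    strategy of the same player in [G(A)]. *)

From Stdlib Require Import ClassicalEpsilon FunctionalExtensionality.
From HB Require Import structures.
From mathcomp Require Import all_boot zify.
Require Import Defs.

Set Implicit Arguments.
Unset Strict Implicit.
Unset Printing Implicit Defensive.

(** * Marked transition systems *)

(** Player 1 writes no padding, so giving every ill-formed play to B cannot be abused by Player 1.
    Asking for blocks forever does not help either: acceptance of a well-formed play needs
    infinitely many pairs. The coding is not symmetric. An accepted well-formed play has its outcome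
    in A whatever the timing; this transfers strategies of Player 1. A play with outcome in A is
    accepted only if the machine had time between the pairs; this suffices for strategies of Player
    2, because there the transfer itself plays as Player 1 in G(B) and sets the pace. The guess of
    the witness may depend on the whole future of the play, while the pace must be fixed from its
    past; hence the bound over all guesses, of which there are finitely many since a phase guesses
    two bits. A counter loses its content when it is measured against a block. It is recovered
    because the next block is longer by exactly one: only the surplus of the first block is stored,
    and what the second block has beyond it is the product. The condition for all n, exists m
    becomes a Büchi condition through a search that advances n at each success. *)

Lemma choice_ex (A B : Type) (R : A -> B -> Prop) :
  (forall a, exists b, R a b) -> exists f, forall a, R a (f a).
Proof.
move=> H; exists (fun a => sval (constructive_indefinite_description _ (H a))) => a.
exact: proj2_sig.
Qed.

Lemma dependent_choice (T : Type) (R : T -> T -> Prop) (P : T -> Prop) (x : T) :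
  P x -> (forall a, P a -> exists b, R a b /\ P b) ->
  exists u : nat -> T, [/\ u 0 = x, forall i, R (u i) (u i.+1) & forall i, P (u i)].
Proof.
move=> Px H.
have H' (a : {a | P a}) : exists b : {a | P a}, R (sval a) (sval b).
  by case: a => a Pa; have [b [Rab Pb]] := H a Pa; exists (exist _ b Pb).
have [nxt Hn] := choice_ex H'.
pose v i := iter i nxt (exist _ x Px).
by exists (fun i => sval (v i)); split=> // i; exact: proj2_sig.
Qed.

Section MarkedTransitionSystem.

Variables (S : Type) (step : S -> bool -> S -> Prop).

Inductive path : S -> bool -> S -> Prop :=
| path_nil s : path s false s
| path_cons s m s' m' s'' : step s m s' -> path s' m' s'' -> path s (m || m') s''.

(** Infinitely many marks, phrased with finite segments that each contain one. Unlike an infinite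
    run, a chain of segments is carried over directly by simulations that answer a step with several
    steps or with none. *)
Definition live (s : S) : Prop :=
  exists u : nat -> S, u 0 = s /\ forall i, path (u i) true (u i.+1).

Definition infinite_run (r : nat -> S) (mk : nat -> bool) : Prop :=
  (forall i, step (r i) (mk i) (r i.+1)) /\ forall N, exists i, N <= i /\ mk i.

Lemma path1 s m s' : step s m s' -> path s m s'.
Proof. by move=> /path_cons /(_ (path_nil s')); rewrite orbF. Qed.

Lemma path_cat s m s' m' s'' : path s m s' -> path s' m' s'' -> path s (m || m') s''.
Proof.
move=> p; elim: p m' s'' => // {s m s'} s m s1 m1 s2 st _ IH m' s'' p2.
by rewrite -orbA; apply: path_cons st _; apply: IH.
Qed.

Lemma run_path r mk i n :
  (forall i, step (r i) (mk i) (r i.+1)) ->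
  exists2 m, path (r i) m (r (i + n)) & forall j, i <= j < i + n -> mk j -> m.
Proof.
move=> H; elim: n => [|n [m p Hm]].
  by exists false; rewrite ?addn0; [exact: path_nil|move=> j; lia].
exists (m || mk (i + n)).
  by rewrite addnS; apply: path_cat p _; apply: path1.
move=> j Hj mj; apply/orP.
have [E|] := eqVneq j (i + n); first by right; rewrite -E.
by move=> ne; left; apply: Hm mj; lia.
Qed.

Lemma run_live r mk : infinite_run r mk -> live (r 0).
Proof.
move=> [H1 H2].
have [u [u0 Hu _]] : exists u : nat -> nat, [/\ u 0 = 0,
    forall i, path (r (u i)) true (r (u i.+1)) & forall i : nat, True].
  apply: (@dependent_choice nat (fun i j => path (r i) true (r j)) (fun=> True)) => // i _.
  have [j [Hj mj]] := H2 i; have [m p Hm] := run_path i (j - i).+1 H1.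
  exists (i + (j - i).+1); split=> //.
  by have -> : true = m by apply/esym/(Hm j) => //; lia.
by exists (fun i => r (u i)); rewrite u0.
Qed.

Inductive npath : nat -> S -> bool -> S -> Prop :=
| npath_nil s : npath 0 s false s
| npath_cons n s m s' m' s'' :
    step s m s' -> npath n s' m' s'' -> npath n.+1 s (m || m') s''.

Lemma path_npath s m s' : path s m s' -> exists n, npath n s m s'.
Proof.
elim=> {s m s'} [s|s m s1 m1 s2 st _ [n p]]; first by exists 0; exact: npath_nil.
by exists n.+1; apply: npath_cons p.
Qed.

(* A state of the run remembers how many steps separate it from the next
   [u i], and whether a marked step is still to come before. *)
Lemma live_run s : live s -> exists r mk, r 0 = s /\ infinite_run r mk.
Proof.
move=> [u [u0 Hu]].
pose Inv (x : S * nat * bool) := exists i, npath x.1.2.+1 x.1.1 x.2 (u i).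
(* An unmarked step either lowers the countdown and keeps the flag, or opens a new segment and turns
   the flag from false to true. Once the flag is true only the former is possible, so a mark must
   come. *)
pose W (x y : S * nat * bool) m := step x.1.1 m y.1.1 /\
  (m \/ (if y.1.2 < x.1.2 then y.2 = x.2 else x.2 < y.2)).
have start i : exists n, npath n.+1 (u i) true (u i.+1).
  have [n p] := path_npath (Hu i); case: n p => [|n] p; last by exists n.
  by inversion p.
have [n0 p0] := start 0.
have [||v [v0 Hv _]] := @dependent_choice _ (fun x y => exists m, W x y m) Inv (s, n0, true).
- by exists 1; rewrite -u0.
- case=> [[a n] b] [/= i p]; inversion p as [|n1 a1 m s' m' s'' st p']; subst.
  case: n p p' => [|n] p p'; inversion p'; subst.
    have [n pn] := start i; exists (u i, n, true); split; last by exists i.+1.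
    by exists m; split=> //=; case: (m); [left|right].
  exists (s', n, m0 || m'0); split; last by exists i.
  by exists m; split=> //=; case: (m); [left|right; rewrite ltnSn].
have [mk Hmk] := choice_ex Hv.
exists (fun i => (v i).1.1), mk; rewrite v0; split=> //.
split=> [i|N]; first by case: (Hmk i).
have tt n N' : (v N').1.2 < n -> (v N').2 -> exists i, N' <= i /\ mk i.
  elim: n N' => // n IH N' ltn E; have [_ [mN|]] := Hmk N'; first by exists N'.
  case: ifP => [lt Eb|_]; last by rewrite E; case: (v N'.+1).2.
  by case: (IH N'.+1); rewrite ?Eb //; [lia|move=> i [lei mi]; exists i; split; [lia|]].
have ff n N' : (v N').1.2 < n -> exists i, N' <= i /\ mk i.
  elim: n N' => // n IH N' ltn; case E: (v N').2; first by apply: tt E.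
  have [_ [mN|]] := Hmk N'; first by exists N'.
  case: ifP => [lt Eb|_].
    by case: (IH N'.+1) => [|i [lei mi]]; [lia|exists i; split; [lia|]].
  rewrite E; case E': (v N'.+1).2 => // _; case: (tt _ _ (ltnSn _) E') => i [lei mi].
  by exists i; split; [lia|].
exact: ff (ltnSn _).
Qed.

End MarkedTransitionSystem.

(** An unmarked step may be answered by the empty path, so the second system can stand still while
    the first one works. A whole segment carries a mark, hence so does its answer, and dependent
    choice glues the answers. *)
Lemma live_simulation (S1 S2 : Type) (step1 : S1 -> bool -> S1 -> Prop)
    (step2 : S2 -> bool -> S2 -> Prop) (R : S1 -> S2 -> Prop) s1 s2 :
  (forall a x m b, R a x -> step1 a m b ->
     exists y m', [/\ path step2 x m' y, m -> m' & R b y]) ->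
  R s1 s2 -> live step1 s1 -> live step2 s2.
Proof.
move=> H Rs [u [u0 Hu]].
have Hp a m b : path step1 a m b -> forall x, R a x ->
    exists y m', [/\ path step2 x m' y, m -> m' & R b y].
  elim=> {a m b} [a|a m b m1 c st _ IH] x Rax; first by exists x, false; split=> //; exact: path_nil.
  have [y [m2 [p2 mm2 Ry]]] := H _ _ _ _ Rax st; have [z [m3 [p3 mm3 Rz]]] := IH _ Ry.
  exists z, (m2 || m3); split=> //; first exact: path_cat p3.
  by case/orP=> [/mm2->|/mm3->]; rewrite ?orbT.
have [||v [v0 Hv _]] := @dependent_choice (nat * S2)
    (fun x y => path step2 x.2 true y.2) (fun x => R (u x.1) x.2) (0, s2).
- by rewrite /= u0.
- move=> [i x] /= Rx; have [y [m [p]]] := Hp _ _ _ (Hu i) _ Rx.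
  by move=> /(_ isT) mt Ry; exists (i.+1, y); split=> //=; rewrite -{1}mt.
by exists (fun i => (v i).2); rewrite v0.
Qed.

(** * One-counter automata are pushdown automata *)

(** The counter value n is the stack of n symbols [true] above a bottom marker [false], so the top
    symbol is the outcome of the zero test. A decrement at zero leaves the marker in place. *)
Definition pda_of_test (b : bool) (u : cmove) : seq bool :=
  match u with
  | CDec => if b then [::] else [:: false]
  | CKeep => [:: b]
  | CInc => [:: true; b]
  end.

Definition pda_of_ctrans (K X : Type) (t : ctrans 1 K X) : ptrans K X bool :=
  PTrans (ct_src t) (ct_lab t) (ct_test t ord0) (ct_dst t)
    (pda_of_test (ct_test t ord0) (ct_upd t ord0)).

Definition pda_of_ca (X : Type) (M : counter_aut 1 X) : pda X :=
  PDA (List.map (@pda_of_ctrans _ _) (ca_delta M)) (ca_q0 M) false (@ca_F _ _ M).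

Lemma pda_of_ca_accepts (X : Type) (M : counter_aut 1 X) sigma :
  ca_accepts M sigma <-> pd_accepts (pda_of_ca M) sigma.
Proof.
split=> [[st [cnt [tr [s0 c0 H rd F]]]]|[st [stk [tr [s0 k0 H rd F]]]]].
  exists st, (fun i => rcons (nseq (cnt i ord0) true) false), (fun i => pda_of_ctrans (tr i)).
  split=> //; rewrite ?c0 // => i; have [H1 H2 H3 H4 H5] := H i.
  split=> //; first exact: (List.in_map (@pda_of_ctrans _ _) _ _ H1).
  rewrite /= H5 H3; case E: (cnt i ord0) => [|n].
    by exists [::]; case: (ct_upd _ _).
  by exists (rcons (nseq n true) false); case: (ct_upd _ _).
have Htr i : exists t, pda_of_ctrans t = tr i /\ List.In t (ca_delta M).
  by have [/List.in_map_iff] := H i.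
have {Htr} [tr' Htr] := choice_ex Htr.
have Hk i : exists n, stk i = rcons (nseq n true) false.
  elim: i => [|i [n E]]; first by exists 0.
  have [_ _ _ [rest []]] := H i; have [<- _] := Htr i; rewrite E /=.
  case: n E => [|n] E [<- <-] ->; case: (ct_upd _ _) => /=.
  - by exists 0. - by exists 0. - by exists 1.
  - by exists n. - by exists n.+1. - by exists n.+2.
have [cnt Hc] := choice_ex Hk.
exists st, (fun i _ => cnt i), tr'; split=> //.
- by move=> _; move: (Hc 0); rewrite k0; case: (cnt 0) => // -[].
- move=> i; have [H1 H2 H3 [rest []]] := H i; have [E H4] := Htr i.
  rewrite -E in H2 H3 *; rewrite !Hc /= => E1 E2.
  have Et : ct_test (tr' i) ord0 = (cnt i != 0) by case: (cnt i) E1 => [|n] [].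
  split=> // m; rewrite (ord1 m) // {H2 H3}.
  move: (f_equal size E2); rewrite size_cat size_rcons size_nseq.
  move: (f_equal size E1); rewrite /= size_rcons size_nseq => - [Es].
  by rewrite Et -Es; case: (ct_upd _ _) => /=; case: (cnt i) Es => [|n] /=; lia.
- have [pos [p0 ps pl pn]] := rd; exists pos; split=> // i; have [E _] := Htr i.
    by rewrite ps -E.
  by move=> a Ha; apply: pl; rewrite -E.
Qed.

Lemma BCL1_CFL (X : finType) (L : (nat -> X) -> Prop) : BCL 1 L -> CFL L.
Proof.
by move=> [M HM]; exists (pda_of_ca M) => sigma; rewrite HM; exact: pda_of_ca_accepts.
Qed.

(** * Total recursive functions *)

Definition total_rec (n : nat) (F : seq nat -> nat) : Prop :=
  exists c, forall v, size v = n -> reval c v (F v).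

Lemma total_rec_ext n F G :
  (forall v, size v = n -> F v = G v) -> total_rec n F -> total_rec n G.
Proof. by move=> E [c Hc]; exists c => v sv; rewrite -E //; apply: Hc. Qed.

Lemma total_rec_nth n i : i < n -> total_rec n (fun v => nth 0 v i).
Proof. by move=> lt; exists (RProj i) => v sv; apply: ev_proj; rewrite sv. Qed.

Lemma total_rec_comp n F (Gs : seq (seq nat -> nat)) :
  total_rec (size Gs) F -> (forall i, i < size Gs -> total_rec n (nth (fun=> 0) Gs i)) ->
  total_rec n (fun v => F [seq G v | G <- Gs]).
Proof.
move=> [c Hc] H.
have [cs Hcs] : exists cs, forall v, size v = n -> revals cs v [seq G v | G <- Gs].
  elim: Gs H {Hc} => [|G Gs IH] H; first by exists nil => v _; exact: evs_nil.
  have [c1 H1] := H 0 isT.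
  have [cs Hcs] := IH (fun i => H i.+1).
  exists (List.cons c1 cs) => v sv.
  by apply: evs_cons; [exact: H1|exact: Hcs].
exists (RComp c cs) => v sv; apply: ev_comp (Hcs v sv) _.
by apply: Hc; rewrite size_map.
Qed.

Lemma total_rec_app1 n f A :
  total_rec 1 (fun v => f (nth 0 v 0)) -> total_rec n A -> total_rec n (fun v => f (A v)).
Proof. by move=> Hf HA; apply: (total_rec_comp (Gs := [:: A]) Hf) => -[]. Qed.

Lemma total_rec_app2 n f A B :
  total_rec 2 (fun v => f (nth 0 v 0) (nth 0 v 1)) ->
  total_rec n A -> total_rec n B -> total_rec n (fun v => f (A v) (B v)).
Proof. by move=> Hf HA HB; apply: (total_rec_comp (Gs := [:: A; B]) Hf) => -[|[]]. Qed.

(** Recursion and minimization put their own arguments in front of the parameters; this moves a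
    function of the parameters past them. *)
Lemma total_rec_drop n k F : total_rec n F -> total_rec (k + n) (fun v => F (drop k v)).
Proof.
move=> HF.
apply: (@total_rec_ext _ (fun v => F [seq G v | G <- [seq (fun v => nth 0 v i) | i <- iota k n]])).
  move=> v sv; congr F; rewrite -map_comp.
  apply: (@eq_from_nth _ 0); rewrite size_map size_iota ?size_drop ?sv; first lia.
  by move=> i lt; rewrite (nth_map 0) ?size_iota //= nth_iota // nth_drop.
apply: total_rec_comp; rewrite size_map size_iota // => i lt.
rewrite (nth_map 0) ?size_iota // nth_iota //; apply: total_rec_nth; lia.
Qed.

Lemma total_rec_S n A : total_rec n A -> total_rec n (fun v => (A v).+1).
Proof. by apply: total_rec_app1; exists RSucc => -[|x []] // _; exact: ev_succ. Qed.

Lemma total_rec_const n k : total_rec n (fun=> k).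
Proof.
by elim: k => [|k]; [exists RZero => v _; exact: ev_zero|exact: total_rec_S].
Qed.

Lemma total_rec_iteri n (N A : seq nat -> nat) (G : nat -> nat -> seq nat -> nat) :
  total_rec n N -> total_rec n A ->
  total_rec n.+2 (fun w => G (nth 0 w 0) (nth 0 w 1) (drop 2 w)) ->
  total_rec n (fun v => iteri (N v) (fun i r => G i r v) (A v)).
Proof.
move=> HN [cA HA] [cG HG].
pose F w := iteri (nth 0 w 0) (fun i r => G i r (drop 1 w)) (A (drop 1 w)).
have HF : total_rec n.+1 F.
  exists (RPrim cA cG) => -[//|k v] [sv]; rewrite /F /= drop0.
  elim: k => [|k IH]; first by apply: ev_prim0; exact: HA.
  apply: ev_primS IH _; set r := iteri _ _ _.
  by have := HG (k :: r :: v); rewrite /= drop0 sv; apply.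
apply: (@total_rec_ext _ (fun v => F [seq H v | H <- N :: [seq (fun v => nth 0 v i) | i <- iota 0 n]])).
  move=> v sv; rewrite /F /= drop0 -map_comp.
  suff -> : [seq ((@^~ v) \o (fun i v0 => nth 0 v0 i)) i | i <- iota 0 n] = v by [].
  by rewrite -[RHS](mkseq_nth 0) sv.
apply: total_rec_comp; rewrite /= size_map size_iota // => -[//|i] lt /=.
rewrite (nth_map 0) ?size_iota // nth_iota //; exact: total_rec_nth.
Qed.

Lemma total_rec_mu n (G : nat -> seq nat -> nat) F :
  total_rec n.+1 (fun w => G (nth 0 w 0) (drop 1 w)) ->
  (forall v, size v = n -> G (F v) v = 0 /\ forall m, m < F v -> 0 < G m v) ->
  total_rec n F.
Proof.
move=> [c Hc] HF; exists (RMu c) => v sv; have [H0 H1] := HF v sv.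
have Hc' m : reval c (m :: v) (G m v).
  by have := Hc (m :: v); rewrite /= drop0 sv; apply.
apply: ev_mu; first by rewrite -H0.
by move=> m /H1; case E: (G m v) => [|k] // _; exists k; rewrite -E.
Qed.

(** Iteration of a constant body: zero passes leave [B], any positive number of passes leaves
    [A]. *)
Lemma total_rec_if n C A B : total_rec n C -> total_rec n A -> total_rec n B ->
  total_rec n (fun v => if C v != 0 then A v else B v).
Proof.
move=> HC HA HB.
apply: (@total_rec_ext _ (fun v => iteri (C v) (fun _ _ => A v) (B v))).
  by move=> v _; case: (C v).
by apply: total_rec_iteri => //; apply: (@total_rec_drop n 2).
Qed.

Lemma total_rec_pred n A : total_rec n A -> total_rec n (fun v => (A v).-1).
Proof.
apply: total_rec_app1.
apply: (@total_rec_ext _ (fun v => iteri (nth 0 v 0) (fun i r => i) 0)).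
  by move=> v _; case: (nth 0 v 0).
by apply: total_rec_iteri; [exact: total_rec_nth|exact: total_rec_const|exact: total_rec_nth].
Qed.

Lemma total_rec_sub n A B :
  total_rec n A -> total_rec n B -> total_rec n (fun v => A v - B v).
Proof.
apply: total_rec_app2.
apply: (@total_rec_ext _ (fun v => iteri (nth 0 v 1) (fun i r => r.-1) (nth 0 v 0))).
  by move=> v _; elim: (nth 0 v 1) => [|k /= ->] /=; lia.
by apply: total_rec_iteri; [exact: total_rec_nth|exact: total_rec_nth|
  apply/total_rec_pred/total_rec_nth].
Qed.

Lemma total_rec_add n A B :
  total_rec n A -> total_rec n B -> total_rec n (fun v => A v + B v).
Proof.
apply: total_rec_app2.
apply: (@total_rec_ext _ (fun v => iteri (nth 0 v 1) (fun i r => r.+1) (nth 0 v 0))).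
  by move=> v _; elim: (nth 0 v 1) => [|k /= ->] /=; lia.
by apply: total_rec_iteri; [exact: total_rec_nth|exact: total_rec_nth|
  apply/total_rec_S/total_rec_nth].
Qed.

Lemma total_rec_eq n A B :
  total_rec n A -> total_rec n B -> total_rec n (fun v => nat_of_bool (A v == B v)).
Proof.
move=> HA HB.
apply: (@total_rec_ext _ (fun v => 1 - ((A v - B v) + (B v - A v)))).
  by move=> v _ /=; case: eqVneq => [->|] /=; lia.
by do ![apply: total_rec_sub | apply: total_rec_add | apply: total_rec_const | assumption].
Qed.

Lemma total_rec_odd n A : total_rec n A -> total_rec n (fun v => nat_of_bool (odd (A v))).
Proof.
apply: (@total_rec_app1 _ (fun a => nat_of_bool (odd a))).
apply: (@total_rec_ext _ (fun v => iteri (nth 0 v 0) (fun i r => 1 - r) 0)).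
  by move=> v _; elim: (nth 0 v 0) => [|k /= ->] //; case: (odd k).
by apply: total_rec_iteri; [exact: total_rec_nth|exact: total_rec_const|
  apply: total_rec_sub; [exact: total_rec_const|exact: total_rec_nth]].
Qed.

Lemma total_rec_half n A : total_rec n A -> total_rec n (fun v => (A v)./2).
Proof.
apply: total_rec_app1.
apply: (@total_rec_ext _ (fun v => iteri (nth 0 v 0) (fun i r => r + odd i) 0)).
  by move=> v _; elim: (nth 0 v 0) => [|k /= ->] //; rewrite uphalf_half addnC.
by apply: total_rec_iteri; [exact: total_rec_nth|exact: total_rec_const|
  apply: total_rec_add; [exact: total_rec_nth|apply/total_rec_odd/total_rec_nth]].
Qed.

Lemma iteri_iter (T : Type) k (f : T -> T) x : iteri k (fun=> f) x = iter k f x.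
Proof. by elim: k => //= k ->. Qed.

(** The step of [CodeSeq.code], hence of [pickle] on lists and on pairs, which are coded as lists
    with two entries. The value is positive, so 0 is left for the empty list, and the head is the
    2-adic valuation. *)
Definition cons_code (x s : nat) : nat := 2 ^ x * s.*2.+1.
Definition head_code (z : nat) : nat := logn 2 z.
Definition behead_code (z : nat) : nat := (iter (logn 2 z) half z)./2.

Lemma iter_half_expn k x : iter k half (2 ^ k * x) = x.
Proof. by elim: k => [|k IH]; rewrite ?mul1n // iterSr expnS -mulnA mul2n doubleK IH. Qed.

Lemma cons_codeK x s : head_code (cons_code x s) = x /\ behead_code (cons_code x s) = s.
Proof.
have E : logn 2 (2 ^ x * s.*2.+1) = x.
  by rewrite lognM ?expn_gt0 // pfactorK // lognE dvdn2 /= odd_double addn0.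
rewrite /behead_code /head_code /cons_code E iter_half_expn; split=> //; lia.
Qed.

Lemma total_rec_cons_code n A B :
  total_rec n A -> total_rec n B -> total_rec n (fun v => cons_code (A v) (B v)).
Proof.
move=> HA HB.
apply: (@total_rec_ext _ (fun v => iteri (A v) (fun i r => r + r) (B v + B v).+1)).
  move=> v _; rewrite /cons_code -addnn; elim: (A v) => [|k /= ->] /=; first lia.
  by rewrite expnS; lia.
apply: total_rec_iteri => //; first by apply: total_rec_S; apply: total_rec_add.
by apply: total_rec_add; apply: total_rec_nth.
Qed.

Lemma total_rec_iter_half n A B :
  total_rec n A -> total_rec n B -> total_rec n (fun v => iter (A v) half (B v)).
Proof.
move=> HA HB.
apply: (@total_rec_ext _ (fun v => iteri (A v) (fun i r => r./2) (B v))).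
  by move=> v _; rewrite iteri_iter.
by apply: total_rec_iteri => //; apply/total_rec_half/total_rec_nth.
Qed.

Lemma total_rec_head_code n A : total_rec n A -> total_rec n (fun v => head_code (A v)).
Proof.
apply: total_rec_app1.
(* The valuation is the least number of halvings that leads to an odd number. None exists for 0,
   where the test is set to succeed at once, in agreement with [logn 2 0 = 0]. *)
apply: (@total_rec_mu _ (fun x v => if nth 0 v 0 != 0 then 1 - odd (iter x half (nth 0 v 0)) else 0)).
  apply: total_rec_if; [|apply: total_rec_sub|]; try apply: total_rec_const.
    by apply: (@total_rec_drop 1 1 (fun v => nth 0 v 0)); apply: total_rec_nth.
  apply: total_rec_odd; apply: total_rec_iter_half; first exact: total_rec_nth.
  by apply: (@total_rec_drop 1 1 (fun v => nth 0 v 0)); apply: total_rec_nth.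
move=> v _; move: (nth 0 v 0) => z; rewrite /head_code.
case: (posnP z) => [-> //|z0]; rewrite /=.
have [q] := pfactor_coprime (isT : prime 2) z0; rewrite coprime2n.
move: (logn 2 z) => k odd_q ->; rewrite mulnC; split.
  by rewrite iter_half_expn odd_q.
move=> m lt.
have -> : 2 ^ k * q = 2 ^ m * (2 * (2 ^ (k - m.+1) * q)).
  by rewrite !mulnA -expnSr -expnD; congr (2 ^ _ * _); lia.
by rewrite iter_half_expn oddM.
Qed.

Lemma total_rec_behead_code n A : total_rec n A -> total_rec n (fun v => behead_code (A v)).
Proof.
by move=> HA; apply/total_rec_half/total_rec_iter_half => //; exact: total_rec_head_code.
Qed.

(** * Computable functions between countable types *)

(** [g] is unconstrained at numbers that are not codes, so a realizer never has to recognize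
    them. *)
Definition computable (A B : countType) (f : A -> B) : Prop :=
  exists g : nat -> nat, total_rec 1 (fun v => g (nth 0 v 0)) /\
    forall a, g (pickle a) = pickle (f a).

Lemma pickle_pair (A B : countType) (a : A) (b : B) :
  pickle (a, b) = cons_code (pickle a) (cons_code (pickle b) 0).
Proof. by []. Qed.

Lemma pickle_cons (A : countType) (a : A) s :
  pickle (a :: s) = cons_code (pickle a) (pickle s).
Proof. by []. Qed.

Lemma cons_code_neq0 x s : cons_code x s != 0.
Proof. by rewrite muln_eq0 expn_eq0. Qed.

Section Computable.

Variable A : countType.
Implicit Types (B C : countType).

Lemma computable_ext B (f g : A -> B) : f =1 g -> computable f -> computable g.
Proof. by move=> E [h [rh H]]; exists h; split=> // a; rewrite H E. Qed.

Lemma computable_id : computable (fun a : A => a).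
Proof. by exists id; split=> //; exact: total_rec_nth. Qed.

Lemma computable_const B (b : B) : computable (fun _ : A => b).
Proof. by exists (fun=> pickle b); split=> //; exact: total_rec_const. Qed.

Lemma computable_comp B C (g : B -> C) (f : A -> B) :
  computable g -> computable f -> computable (fun a => g (f a)).
Proof.
move=> [h [rh H]] [k [rk K]]; exists (fun x => h (k x)).
by split=> [|a]; [exact: total_rec_app1|rewrite K H].
Qed.

Lemma computable_pair B C (f : A -> B) (g : A -> C) :
  computable f -> computable g -> computable (fun a => (f a, g a)).
Proof.
move=> [h [rh H]] [k [rk K]].
exists (fun x => cons_code (h x) (cons_code (k x) 0)).
split=> [|a]; last by rewrite pickle_pair H K.
by do 2!apply: total_rec_cons_code => //; exact: total_rec_const.
Qed.

Lemma computable_fst B C (f : A -> B * C) :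
  computable f -> computable (fun a => (f a).1).
Proof.
move=> [h [rh H]]; exists (fun x => head_code (h x)); split=> [|a].
  exact: total_rec_head_code.
by rewrite H; case: (f a) => b c; rewrite pickle_pair (cons_codeK _ _).1.
Qed.

Lemma computable_snd B C (f : A -> B * C) :
  computable f -> computable (fun a => (f a).2).
Proof.
move=> [h [rh H]]; exists (fun x => head_code (behead_code (h x))); split=> [|a].
  by apply: total_rec_head_code; apply: total_rec_behead_code.
by rewrite H; case: (f a) => b c; rewrite pickle_pair (cons_codeK _ _).2 (cons_codeK _ _).1.
Qed.

Lemma computable_cons B (f : A -> B) (s : A -> seq B) :
  computable f -> computable s -> computable (fun a => f a :: s a).
Proof.
move=> [h [rh H]] [k [rk K]]; exists (fun x => cons_code (h x) (k x)).
by split=> [|a]; [exact: total_rec_cons_code|rewrite pickle_cons H K].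
Qed.

Lemma computable_succ (f : A -> nat) : computable f -> computable (fun a => (f a).+1).
Proof.
move=> [h [rh H]]; exists (fun x => (h x).+1).
by split=> [|a]; [exact: total_rec_S|rewrite H].
Qed.

Lemma computable_natcase B (f : A -> nat) (b : A -> B) (g : A * nat -> B) :
  computable f -> computable b -> computable g ->
  computable (fun a => if f a is n.+1 then g (a, n) else b a).
Proof.
move=> [h [rh H]] [k [rk K]] [l [rl L]].
exists (fun x => if h x != 0 then l (cons_code x (cons_code (h x).-1 0)) else k x).
split=> [|a].
  apply: total_rec_if => //; apply: (@total_rec_app1 _ l) => //.
  do 2?apply: total_rec_cons_code; [exact: total_rec_nth| |exact: total_rec_const].
  exact: total_rec_pred.
rewrite H; case: (f a) => [|n] //=.
by rewrite -[n]/(pickle n) -pickle_pair L.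
Qed.

Lemma computable_leq (f g : A -> nat) :
  computable f -> computable g -> computable (fun a => f a <= g a).
Proof.
move=> [h [rh H]] [k [rk K]]; exists (fun x => nat_of_bool (h x - k x == 0)).
split=> [|a]; last by rewrite H K; case E: (f a <= g a); move: E; rewrite /leq => /= ->.
by apply: total_rec_eq; [exact: total_rec_sub|exact: total_rec_const].
Qed.

(** The realizers of the branches are unrelated; a chain of comparisons with the codes of [enum F]
    selects the one to be applied. *)
Lemma computable_fcase (F : finType) B (h : A -> F) (f : F -> A -> B) :
  computable h -> (forall x, computable (f x)) -> computable (fun a => f (h a) a).
Proof.
move=> [h' [rh H]] Hf.
have [g Hg] := choice_ex Hf.
suff [k [rk K]] : exists k : nat -> nat, total_rec 1 (fun v => k (nth 0 v 0)) /\
    forall a, h a \in enum F -> k (pickle a) = pickle (f (h a) a).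
  by exists k; split=> // a; rewrite K ?mem_enum.
elim: (enum F) => [|x s [k [rk K]]].
  by exists (fun=> 0); split=> //; exact: total_rec_const.
exists (fun y => if nat_of_bool (h' y == pickle x) != 0 then g x y else k y); split=> [|a].
  apply: total_rec_if => //; last by have [] := Hg x.
  by apply: total_rec_eq => //; exact: total_rec_const.
rewrite inE H (inj_eq (pcan_inj pickleK)); case: eqVneq => [-> _|_] /=.
  by have [_ ->] := Hg x.
exact: K.
Qed.

Lemma computable_if B (c : A -> bool) (f g : A -> B) :
  computable c -> computable f -> computable g ->
  computable (fun a => if c a then f a else g a).
Proof.
by move=> Hc Hf Hg; apply: (@computable_fcase _ _ c (fun b a => if b then f a else g a)) => // -[].
Qed.

Lemma computable_seqcase (F : finType) B (s : A -> seq F) (b : A -> B)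
    (f : F -> A * seq F -> B) :
  computable s -> computable b -> (forall x, computable (f x)) ->
  computable (fun a => if s a is x :: s' then f x (a, s') else b a).
Proof.
move=> [h [rh H]] [k [rk K]] Hf.
have [g Hg] := choice_ex Hf.
suff [l [rl L]] : exists l : nat -> nat, total_rec 1 (fun v => l (nth 0 v 0)) /\
    forall a x s', x \in enum F -> s a = x :: s' -> l (pickle a) = pickle (f x (a, s')).
  exists (fun y => if h y != 0 then l y else k y).
  split=> [|a]; first exact: total_rec_if.
  rewrite H; case E: (s a) => [|x s']; first exact: K.
  by rewrite pickle_cons cons_code_neq0; apply: L E; rewrite mem_enum.
elim: (enum F) => [|x e [l [rl L]]].
  by exists (fun=> 0); split=> //; exact: total_rec_const.
exists (fun y => if nat_of_bool (head_code (h y) == pickle x) != 0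
  then g x (cons_code y (cons_code (behead_code (h y)) 0)) else l y); split=> [|a z s' ze E].
  apply: total_rec_if => //.
    by apply: total_rec_eq; [exact: total_rec_head_code|exact: total_rec_const].
  apply: (@total_rec_app1 _ (g x)); first by have [] := Hg x.
  do 2?apply: total_rec_cons_code; [exact: total_rec_nth| |exact: total_rec_const].
  exact: total_rec_behead_code.
rewrite H E pickle_cons (cons_codeK _ _).1 (cons_codeK _ _).2.
rewrite (inj_eq (pcan_inj pickleK)); move: ze; rewrite inE; case: eqVneq => [-> _|_ ze] /=.
  by rewrite -pickle_pair; have [_ ->] := Hg x.
exact: L E.
Qed.

Lemma leq_size_code (s : seq nat) : size s <= CodeSeq.code s.
Proof.
elim: s => //= x s IH.
have : 0 < 2 ^ x by rewrite expn_gt0.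
by move: (2 ^ x) (CodeSeq.code s) IH => a b; nia.
Qed.

(** The length of the list is never computed: its code bounds it and serves as the number of
    iterations, and the iterated map [nx] is the identity once the list is exhausted. *)
Lemma computable_foldl B C (s : A -> seq C) (b : A -> B) (st : B -> C -> B) :
  computable s -> computable b -> computable (fun p : B * C => st p.1 p.2) ->
  computable (fun a => foldl st (b a) (s a)).
Proof.
move=> [h [rh H]] [k [rk K]] [g [rg G]].
pose nx r := if head_code r != 0 then cons_code (behead_code (head_code r))
  (g (cons_code (behead_code r) (cons_code (head_code (head_code r)) 0))) else r.
exists (fun y => behead_code (iteri (h y) (fun=> nx) (cons_code (h y) (k y)))).
split=> [|a].
  apply: total_rec_behead_code; apply: (@total_rec_iteri _ _ _ (fun _ r _ => nx r)) => //.
    exact: total_rec_cons_code.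
  have Hr : total_rec 3 (fun w => nth 0 w 1) by exact: total_rec_nth.
  apply: total_rec_if => //; first exact: total_rec_head_code.
  apply: total_rec_cons_code; first by apply/total_rec_behead_code/total_rec_head_code.
  apply: (@total_rec_app1 _ g) => //.
  do 2?apply: total_rec_cons_code; last exact: total_rec_const.
    exact: total_rec_behead_code.
  by apply/total_rec_head_code/total_rec_head_code.
rewrite iteri_iter H K.
suff fold n b0 (s0 : seq C) : size s0 <= n ->
    iter n nx (cons_code (pickle s0) (pickle b0)) = cons_code 0 (pickle (foldl st b0 s0)).
  rewrite fold ?(cons_codeK _ _).2 //.
  by apply: leq_trans (leq_size_code _); rewrite size_map.
have nx0 y : nx (cons_code 0 y) = cons_code 0 y by rewrite /nx (cons_codeK _ _).1.
have nxS x t y : nx (cons_code (pickle (x :: t)) (pickle y))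
    = cons_code (pickle t) (pickle (st y x)).
  rewrite /nx pickle_cons !(cons_codeK _ _).1 cons_code_neq0.
  by rewrite !(cons_codeK _ _).2 -pickle_pair G.
elim: n b0 s0 => [|n IH] b0 [|x s0] // sz; rewrite iterSr.
  by rewrite (_ : nx _ = cons_code (pickle ([::] : seq C)) (pickle b0)) ?IH ?nx0.
by rewrite nxS IH.
Qed.

End Computable.

Lemma recursive_computable (A : countType) (f : A -> bool) : computable f ->
  exists R : nat -> Prop, recursive R /\ forall a, R (pickle a) <-> f a.
Proof.
move=> [g [rg G]]; exists (fun k => g k = 1); split; last first.
  by move=> a; rewrite G; case: (f a).
have [c Hc] : total_rec 1 (fun v => nat_of_bool (g (nth 0 v 0) == 1)).
  by apply: total_rec_eq => //; exact: total_rec_const.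
exists c => k; have := Hc [:: k] erefl; rewrite /=.
by case: eqVneq => [->|/eqP ne] H; split.
Qed.

Lemma computable_recursive (R : nat -> Prop) : recursive R ->
  exists r : nat -> bool, computable r /\ forall k, r k <-> R k.
Proof.
move=> [c Hc].
have Hr k : exists b : bool, b <-> R k.
  by case: (Classical_Prop.classic (R k)) => H; [exists true|exists false].
have [r Er] := choice_ex Hr; exists r; split=> //.
exists (fun k => nat_of_bool (r k)); split; last by move=> k; case: (r k).
exists c => -[//|k []] // _ /=; have [H1 H0] := Hc k.
by case E: (r k); [apply/H1/Er|apply: H0 => /Er; rewrite E].
Qed.

Lemma computable_rev (A B : countType) (s : A -> seq B) :
  computable s -> computable (fun a => rev (s a)).
Proof.
move=> Hs; apply: (@computable_ext _ _ (fun a => foldl (fun r x => x :: r) [::] (s a))).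
  by move=> a; rewrite /rev; elim: (s a) [::] => //= x t IH r; rewrite IH.
apply: computable_foldl => //; first exact: computable_const.
by apply: computable_cons; [apply: computable_snd|apply: computable_fst]; exact: computable_id.
Qed.

Lemma computable_rcons (A B : countType) (s : A -> seq B) (f : A -> B) :
  computable s -> computable f -> computable (fun a => rcons (s a) (f a)).
Proof.
move=> Hs Hf; apply: (@computable_ext _ _ (fun a => rev (f a :: rev (s a)))).
  by move=> a; rewrite rev_cons revK.
by apply: computable_rev; apply: computable_cons => //; exact: computable_rev.
Qed.

Lemma computable_take (A B : countType) (s : A -> seq B) (m : A -> nat) :
  computable s -> computable m -> computable (fun a => take (m a) (s a)).
Proof.
move=> Hs Hm.
pose st (p : nat * seq B) x := if p.1 is k.+1 then (k, x :: p.2) else p.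
apply: (@computable_ext _ _ (fun a => rev (foldl st (m a, [::]) (s a)).2)).
  move=> a; move: (m a) (s a) => k t.
  suff -> : (foldl st (k, [::]) t).2 = rev (take k t) by rewrite revK.
  rewrite -[RHS]cats0; elim: t k [::] => [|x t IH] [|k] r //=.
    have -> : foldl st (0, r) t = (0, r) by elim: t {IH}.
    by [].
  by rewrite IH rev_cons cat_rcons.
apply: computable_rev; apply: computable_snd; apply: computable_foldl => //.
  by apply: computable_pair => //; exact: computable_const.
pose A' := [the countType of ((nat * seq B) * B)%type].
have H1 : computable (fun p : A' => p.1) by apply: computable_fst; exact: computable_id.
apply: (@computable_natcase A' _ (fun p => p.1.1) (fun p => p.1)
  (fun q => (q.2, q.1.2 :: q.1.1.2))) => //; first exact: computable_fst.
have H2 : computable (fun q : A' * nat => q.1) by apply: computable_fst; exact: computable_id.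
apply: computable_pair; first by apply: computable_snd; exact: computable_id.
apply: computable_cons; first exact: computable_snd.
by apply: computable_snd; exact: computable_fst.
Qed.

(** * Pushdown languages are effective analytic *)

Lemma prefixS (T : Type) (y : nat -> T) m : prefix y m.+1 = rcons (prefix y m) (y m).
Proof. exact: mkseqS. Qed.

Lemma increasing_enumeration (b : nat -> bool) :
  (forall N, exists i, N <= i /\ b i) ->
  exists phi : nat -> nat, [/\ forall i, b (phi i), forall j, j < phi 0 -> ~~ b j,
    forall i, phi i < phi i.+1 & forall i j, phi i < j < phi i.+1 -> ~~ b j].
Proof.
move=> H.
have H' N : exists i, (N <= i) && b i by have [i [le bi]] := H N; exists i; rewrite le.
pose nxt N := ex_minn (H' N).
have nxtP N : [/\ N <= nxt N, b (nxt N) & forall j, N <= j -> j < nxt N -> ~~ b j].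
  rewrite /nxt; case: ex_minnP => i /andP[le bi] min; split=> // j Nj ji.
  by apply/negP => bj; move: (min j); rewrite Nj bj => /(_ isT); lia.
pose phi := fix phi i := if i is i'.+1 then nxt (phi i').+1 else nxt 0.
exists phi; split=> [[|i]|j|i|i j /andP[lt1 lt2]] /=; try by have [] := nxtP 0.
- by have [] := nxtP (phi i).+1.
- by have [_ _] := nxtP 0; apply.
- by have [] := nxtP (phi i).+1.
- by have [_ _] := nxtP (phi i).+1; apply.
Qed.

(** Exchanges a condition of the form infinitely often for the unboundedness of a counter, which has
    the shape for all n, exists m of the definition of [Sigma11]. *)
Lemma unbounded_increments (u : nat -> nat) (b : nat -> bool) :
  (forall i, u i.+1 = u i + b i) ->
  (forall n, exists i, n <= u i) <-> (forall N, exists i, N <= i /\ b i).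
Proof.
move=> Hu.
have mono i k : u i <= u (i + k).
  by elim: k => [|k IH]; rewrite ?addn0 // addnS Hu; lia.
split=> H => [N|n].
  apply: Classical_Prop.NNPP => no.
  have le i : u i <= u N.
    case: (leqP i N) => [le|/ltnW /subnKC <-]; first by rewrite -(subnKC le); exact: mono.
    elim: (i - N) => [|k IH]; rewrite ?addn0 // addnS Hu.
    case E: (b (N + k)); last by rewrite addn0.
    by case: no; exists (N + k); rewrite leq_addr.
  by have [i] := H (u N).+1; have := le i; lia.
elim: n => [|n [i le]]; first by exists 0.
have [j [ij bj]] := H i; exists j.+1; rewrite Hu bj addn1 ltnS.
by apply: leq_trans le _; rewrite -(subnKC ij); exact: mono.
Qed.

Section PushdownSimulation.

Variables (X : finType) (M : pda X).

Local Notation K := (pd_K M).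
Local Notation G := (pd_G M).
Local Notation D := (size (pd_delta M)).
Local Notation control := (bool * 'I_D.+1 * K)%type.
Local Notation memory := (seq G * seq X * nat * nat)%type.

(* Reading bit number [i] of the guessed sequence, the simulation fires the
   transition of index [i %% D.+1] if the bit is set. The memory holds the stack,
   the unread input, and the numbers of final states and of letters seen. *)
Definition fire (q : K) (t : ptrans K X G) (m : memory) : option memory :=
  let: (stk, inp, nf, nr) := m in
  if pt_src t != q then None else
  if stk is g :: stk' then
    if g != pt_top t then None else
    let nf' := if q \in @pd_F _ M then nf.+1 else nf in
    if pt_lab t is Some a then
      if inp is x :: inp' then
        if x != a then None else Some (pt_push t ++ stk', inp', nf', nr.+1)
      else None
    else Some (pt_push t ++ stk', inp, nf', nr)
  else None.

(** The index has [D.+1] values, so that its type is inhabited even without transitions; the last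
    value names no transition, and setting its bit is a failure. A failure is recorded in [ok] for
    good. *)
Definition sim_step (c : control * memory) (b : bool) : control * memory :=
  let: (ok, p, q, m) := c in
  if ~~ ok then c else
  if ~~ b then (ok, ordS p, q, m) else
  if List.nth_error (pd_delta M) p is Some t then
    if fire q t m is Some m' then (true, ordS p, pt_dst t, m')
    else (false, p, q, m)
  else (false, p, q, m).

Definition sim (t : seq bool) (s : seq X) : control * memory :=
  foldl sim_step (true, ord0, pd_q0 M, ([:: pd_Z0 M], s, 0, 0)) t.

Definition sim_check (a : nat * seq bool * seq X) : bool :=
  let: (n, t, s) := a in
  let: (ok, p, q, (stk, inp, nf, nr)) := sim t s in
  [&& ok, n <= nf & n <= nr].

Lemma computable_cat (A B : countType) (w : seq B) (f : A -> seq B) :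
  computable f -> computable (fun a => w ++ f a).
Proof.
move=> Hf; elim: w => //= x w IH.
by apply: computable_cons => //; exact: computable_const.
Qed.

(** The finite part of the argument, control and bit, is isolated and settled by cases. The
    transition is then a constant, and only case distinctions on the stack and the input remain. *)
Lemma computable_sim_step :
  computable (fun p : (control * memory) * bool => sim_step p.1 p.2).
Proof.
pose P : countType := ((control * memory) * bool)%type.
have cP : computable (fun p : P => p) by exact: computable_id.
have cm : computable (fun p : P => p.1.2) by apply/computable_snd/computable_fst.
apply: (@computable_ext P _ (fun p => sim_step ((p.1.1, p.2).1, p.1.2) (p.1.1, p.2).2)).
  by case=> -[].
apply: (@computable_fcase P (control * bool)%type _ (fun p => (p.1.1, p.2))
         (fun x p => sim_step (x.1, p.1.2) x.2)) => [|[[[ok p] q] b]].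
  by apply: computable_pair; [apply/computable_fst/computable_fst|apply: computable_snd].
have cc ctl : computable (fun p : P => (ctl, p.1.2) : control * memory).
  by apply: computable_pair => //; exact: computable_const.
rewrite /sim_step; case: ok => //=; case: b => //=.
case: (List.nth_error _ _) => [t|] //.
pose good (r : (P * seq G) * seq X) k : control * memory := let: (x, stk, inp) := r in
  (true, ordS p, pt_dst t, (pt_push t ++ stk, inp,
     if q \in @pd_F _ M then x.1.2.1.2.+1 else x.1.2.1.2, k + x.1.2.2)).
have cgood (A : countType) (r : A -> (P * seq G) * seq X) k : computable r ->
    computable (fun a => good (r a) k).
  move=> cr; apply: (@computable_ext _ _ (fun a => (true, ordS p, pt_dst t,
   (pt_push t ++ (r a).1.2, (r a).2,
     (if q \in @pd_F _ M then fun n => n.+1 else fun n => n) (r a).1.1.1.2.1.2,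
     iter k (fun n => n.+1) (r a).1.1.1.2.2)))).
    move=> a; rewrite /good; case: (r a) => -[x stk] inp /=.
    have -> n : iter k succn n = k + n by elim: k => //= k ->.
    by case: ifP.
  have c1 : computable (fun a => (r a).1.1.1.2).
    by do 2!apply: computable_snd || apply: computable_fst;
      do 2!apply: computable_fst.
  apply: computable_pair; first exact: computable_const.
  do 3?apply: computable_pair.
  - by apply/computable_cat/computable_snd/computable_fst.
  - exact: computable_snd.
  - case: ifP => _; last by apply/computable_snd/computable_fst.
    by apply/computable_succ/computable_snd/computable_fst.
  - by elim: k => [|k IH] /=; [exact: computable_snd|exact: computable_succ].
pose bad (x : P) : control * memory := (false, p, q, x.1.2).
pose on_letter (a b : X) (z : P * seq G * seq X) := if b != a then bad z.1.1 else good z 1.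
pose on_top (g : G) (y : P * seq G) := if g != pt_top t then bad y.1 else
  if pt_lab t is Some a then
    if y.1.1.2.1.1.2 is b :: inp then on_letter a b (y, inp) else bad y.1
  else good (y, y.1.1.2.1.1.2) 0.
apply: (@computable_ext _ _ (fun x => if pt_src t != q then bad x else
  if x.1.2.1.1.1 is g :: stk then on_top g (x, stk) else bad x)).
  case=> [[ctl [[[stk inp] nf] nr]] b] /=; rewrite /fire /on_top /on_letter /=.
  case: (_ != q) => //; case: stk => //= g stk; case: (g != _) => //.
  case: (pt_lab t) => [a|] //; case: inp => //= c inp; case: (c != a) => //.
case: (pt_src t != q); first exact: cc.
apply: (@computable_seqcase P G _ _ bad on_top); [by do 3!apply: computable_fst|exact: cc|] => g.
have c1 : computable (fun y : P * seq G => y.1) by apply/computable_fst/computable_id.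
have cbad (A : countType) (f : A -> P) : computable f -> computable (fun a => bad (f a)).
  by apply: (computable_comp (g := bad)); exact: cc.
rewrite /on_top; case: (g != _); first exact: cbad.
case: (pt_lab t) => [a|].
  apply: (@computable_seqcase (P * seq G)%type X _ _ (fun y => bad y.1) (on_letter a)) => [||b].
  - by apply/computable_snd/computable_fst/computable_fst/computable_snd/computable_fst.
  - exact: cbad.
  rewrite /on_letter; case: (b != a); last by apply: cgood; exact: computable_id.
  by apply/cbad/computable_fst/computable_fst/computable_id.
apply: cgood; apply: computable_pair; first exact: computable_id.
by apply/computable_snd/computable_fst/computable_fst/computable_snd/computable_fst.
Qed.

Lemma computable_sim_check : computable sim_check.
Proof.
pose A : countType := (nat * seq bool * seq X)%type.
have c0 : computable (fun a : A => a) by exact: computable_id.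
have cn : computable (fun a : A => a.1.1) by apply/computable_fst/computable_fst.
have cs : computable (fun a : A => sim a.1.2 a.2).
  apply: computable_foldl; first by apply/computable_snd/computable_fst.
    apply: computable_pair; first exact: computable_const.
    do 3?apply: computable_pair; try exact: computable_const.
    exact: computable_snd.
  exact: computable_sim_step.
apply: (@computable_ext A _ (fun a => if (sim a.1.2 a.2).1.1.1 then
   if a.1.1 <= (sim a.1.2 a.2).2.1.2 then a.1.1 <= (sim a.1.2 a.2).2.2 else false else false)).
  by case=> [[n t] s]; rewrite /sim_check /=; case: (sim t s) => -[[[] ?] ?] [[[? ?] ?] ?].
apply: computable_if; [by do 3!apply: computable_fst| |exact: computable_const].
apply: computable_if; [|apply: computable_leq => //|exact: computable_const].
  by apply: computable_leq => //; apply/computable_snd/computable_fst/computable_snd.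
by apply/computable_snd/computable_snd.
Qed.

(** The same simulation on the infinite input: the unread suffix is replaced by the position [nr],
    and [fire] is shown only the next letter. *)
Definition input_step (sigma : nat -> X) (c : control * (seq G * nat * nat)) (b : bool) :
    control * (seq G * nat * nat) :=
  let: (ok, p, q, (stk, nf, nr)) := c in
  if ~~ ok then c else
  if ~~ b then (ok, ordS p, q, (stk, nf, nr)) else
  if List.nth_error (pd_delta M) p is Some t then
    if fire q t (stk, [:: sigma nr], nf, nr) is Some (stk', _, nf', nr') then
      (true, ordS p, pt_dst t, (stk', nf', nr'))
    else (false, p, q, (stk, nf, nr))
  else (false, p, q, (stk, nf, nr)).

Fixpoint input_sim (sigma : nat -> X) (tau : nat -> bool) (j : nat) :=
  if j is i.+1 then input_step sigma (input_sim sigma tau i) (tau i)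
  else (true, ord0, pd_q0 M, ([:: pd_Z0 M], 0, 0)).

(** At most one letter is read per bit, so a prefix of length m never runs out within m bits. *)
Lemma sim_input_sim sigma tau m j : j <= m ->
  let: (ctl, (stk, nf, nr)) := input_sim sigma tau j in
  sim (prefix tau j) (prefix sigma m) = (ctl, (stk, drop nr (prefix sigma m), nf, nr)) /\ nr <= j.
Proof.
elim: j => [|j IH] lt /=; first by rewrite drop0.
have := IH (ltnW lt).
case: (input_sim sigma tau j) => -[[ok p] q] [[stk nf] nr] [E le].
rewrite prefixS /sim foldl_rcons -/(sim _ _) E /=.
case: ok {E} => /=; last by split=> //; lia.
case: (tau j) => /=; last by split=> //; lia.
case: (List.nth_error _ _) => [t|] /=; last by split=> //; lia.
case: (_ != q) => /=; first by split=> //; lia.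
case: stk => [|g stk] /=; first by split=> //; lia.
case: (g != _) => /=; first by split=> //; lia.
case: (pt_lab t) => [a|] /=; last by split=> //; lia.
have Ed : drop nr (prefix sigma m) = sigma nr :: drop nr.+1 (prefix sigma m).
  by rewrite (drop_nth (sigma 0)) ?size_mkseq ?nth_mkseq //; lia.
rewrite Ed; case: (_ != a) => /=; last by split=> //; lia.
by rewrite Ed; split=> //; lia.
Qed.

Lemma sim_check_input_sim sigma tau n m :
  sim_check (n, prefix tau m, prefix sigma m) =
  let: (ok, p, q, (stk, nf, nr)) := input_sim sigma tau m in [&& ok, n <= nf & n <= nr].
Proof.
have := sim_input_sim sigma tau (leqnn m); rewrite /sim_check.
by case: (input_sim sigma tau m) => -[[ok p] q] [[stk nf] nr] [-> _].
Qed.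

Arguments fire : simpl never.

Lemma input_sim_fire sigma (t : ptrans K X G) q stk rest nf nr :
  pt_src t = q -> stk = pt_top t :: rest ->
  (forall a, pt_lab t = Some a -> sigma nr = a) ->
  fire q t (stk, [:: sigma nr], nf, nr) =
  Some (pt_push t ++ rest, if pt_lab t is Some _ then [::] else [:: sigma nr],
        nf + (q \in @pd_F _ M), nr + (if pt_lab t is Some _ then 1 else 0)).
Proof.
move=> <- -> Hl; rewrite /fire !eqxx /=.
case: (pt_lab t) Hl => [a|] Hl; last by rewrite addn0; case: (_ \in _); rewrite ?addn0 ?addn1.
by rewrite (Hl a erefl) eqxx; case: (_ \in _); rewrite ?addn0 ?addn1.
Qed.

Lemma fireP sigma (t : ptrans K X G) q stk nf nr stk' inp' nf' nr' :
  fire q t (stk, [:: sigma nr], nf, nr) = Some (stk', inp', nf', nr') ->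
  [/\ pt_src t = q,
      exists rest, stk = pt_top t :: rest /\ stk' = pt_push t ++ rest,
      nf' = nf + (q \in @pd_F _ M),
      nr' = nr + (if pt_lab t is Some _ then 1 else 0)
    & forall a, pt_lab t = Some a -> sigma nr = a].
Proof.
rewrite /fire; case: eqP => //= <-.
case: stk => // g stk; case: eqP => //= ->.
case: (pt_lab t) => [a|].
  case: eqP => //= -> [<- _ <- <-]; split=> //; [by exists stk|by case: (_ \in _); lia|by lia|].
  by move=> b [].
by move=> [<- _ <- <-]; split=> //; [exists stk|case: (_ \in _); lia|lia].
Qed.

Lemma pd_accepts_guess sigma : pd_accepts M sigma ->
  exists tau, forall n, exists m, sim_check (n, prefix tau m, prefix sigma m).
Proof.
move=> [st [stk [tr [s0 k0 H [pos [p0 pS pl pn]] F]]]].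
have Hidx i : exists k, k < D /\ List.nth_error (pd_delta M) k = Some (tr i).
  have [/(List.In_nth_error _ _)[k Ek] _ _ _] := H i; exists k; split=> //.
  by apply/ltP/List.nth_error_Some; rewrite Ek.
have [idx Hi] := choice_ex Hidx.
pose nf := fix nf i := if i is i'.+1 then nf i' + (st i' \in @pd_F _ M) else 0.
(* The i-th group of [D.+1] bits has a single bit set, at the index of the i-th transition of the
   run. *)
pose tau j := j %% D.+1 == idx (j %/ D.+1).
have step i k : k <= D.+1 -> input_sim sigma tau (i * D.+1) =
      (true, ord0, st i, (stk i, nf i, pos i)) ->
    input_sim sigma tau (i * D.+1 + k) =
      let i' := if k <= idx i then i else i.+1 in
      (true, inord (k %% D.+1), st i', (stk i', nf i', pos i')).
  move=> lek E; elim: k lek => [_|k IH lek].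
    by rewrite addn0 E /= mod0n; congr (_, _, _, _); apply: val_inj; rewrite /= inordK.
  have ltkD : k < D.+1 by [].
  rewrite addnS /= IH ?(ltnW lek) //= /tau.
  rewrite modnMDl divnMDl // (divn_small ltkD) addn0 (modn_small ltkD).
  have Ep : ordS (inord k : 'I_D.+1) = inord (k.+1 %% D.+1).
    by apply: val_inj; rewrite /= !inordK // ltn_mod.
  case: (ltngtP k (idx i)) => [lt|gt|Ek] /=; rewrite ?Ep //.
  rewrite inordK // Ek; have [_ ->] := Hi i.
  have [_ H2 H3 [rest [H4 H5]]] := H i.
  by rewrite (input_sim_fire (nf i) H2 H4 (pl i)) H3 H5 pS.
have run i : input_sim sigma tau (i * D.+1) = (true, ord0, st i, (stk i, nf i, pos i)).
  elim: i => [|i IH]; first by rewrite /= s0 k0 p0.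
  have := step i _ (leqnn _) IH; rewrite mulSn addnC => ->.
  have [lt _] := Hi i; rewrite modnn leqNgt ltnS (ltnW lt) /=.
  by congr (_, _, _, _); apply: val_inj; rewrite /= inordK.
have mono u (b : nat -> nat) i i' : (forall i, u i.+1 = u i + b i) -> i <= i' -> u i <= u i'.
  by move=> Hu /subnKC <-; elim: (i' - i) => [|k]; rewrite ?addn0 // addnS Hu; lia.
exists tau => n.
have [i1 le1] : exists i, n <= nf i.
  by move: n; apply/(unbounded_increments (b := fun i => st i \in @pd_F _ M)).
have [i2 le2] := pn n.
exists (maxn i1 i2 * D.+1); rewrite sim_check_input_sim run /=; apply/andP; split.
  by apply: leq_trans le1 _; apply: (mono nf _ _ _ (fun=> erefl)); exact: leq_maxl.
by apply: leq_trans le2 _; apply: (mono pos _ _ _ pS); exact: leq_maxr.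
Qed.

(** The run consists of the moments at which a bit is set, the configuration being constant in
    between. There are infinitely many of them because the number of letters read is unbounded. *)
Lemma guess_pd_accepts sigma tau :
  (forall n, exists m, sim_check (n, prefix tau m, prefix sigma m)) -> pd_accepts M sigma.
Proof.
pose c := input_sim sigma tau; pose ok j := (c j).1.1.1.
pose st j := (c j).1.2; pose stk j := (c j).2.1.1.
pose nf j := (c j).2.1.2; pose nr j := (c j).2.2.
move=> H.
have Hm n : exists m, [&& ok m, n <= nf m & n <= nr m].
  have [m] := H n; rewrite sim_check_input_sim /ok /nf /nr /c => p; exists m; move: p.
  by case: (input_sim _ _ _) => -[[? ?] ?] [[? ?] ?].
have nr_le j : nr j <= j.
  have := sim_input_sim sigma tau (leqnn j); rewrite /nr /c.
  by case: (input_sim _ _ _) => -[[? ?] ?] [[? ?] ?] [].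
have okS j : ok j.+1 -> ok j.
  rewrite /ok /c /=; case: (input_sim _ _ _) => -[[[] ?] ?] [[? ?] ?] //=.
(* The check for n = j succeeds at some m with [j <= nr m <= m], and [ok] is never regained once
   lost. *)
have okall j : ok j.
  have [m /and3P[om _ lem]] := Hm j.
  have {lem} lejm : j <= m by apply: leq_trans lem (nr_le m).
  move: om; rewrite -(subnKC lejm); elim: (m - j) => [|k IH]; first by rewrite addn0.
  by rewrite addnS => /okS.
have idle j : ~~ tau j -> [/\ st j.+1 = st j, stk j.+1 = stk j, nf j.+1 = nf j & nr j.+1 = nr j].
  move=> /negbTE tj; move: (okall j); rewrite /ok /st /stk /nf /nr /c /= tj.
  by case: (input_sim _ _ _) => -[[[] ?] ?] [[? ?] ?].
have move_ j : tau j -> exists t,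
    [/\ List.In t (pd_delta M), pt_src t = st j, st j.+1 = pt_dst t,
        exists rest, stk j = pt_top t :: rest /\ stk j.+1 = pt_push t ++ rest
      & [/\ nf j.+1 = nf j + (st j \in @pd_F _ M),
            nr j.+1 = nr j + (if pt_lab t is Some _ then 1 else 0)
          & forall a, pt_lab t = Some a -> sigma (nr j) = a]].
  move=> tj; move: (okall j.+1); rewrite /ok /st /stk /nf /nr /c /= tj.
  case: (input_sim _ _ _) => -[[[] p] q] [[s f] r] //=.
  case E : (List.nth_error _ _) => [t|] //=.
  case Ef : (fire _ _ _) => [[[[s' i'] f'] r']|] //= _.
  have [H1 H2 H3 H4 H5] := fireP Ef.
  by exists t; split=> //; exact: List.nth_error_In E.
have tau_inf : forall N, exists i, N <= i /\ tau i.
  have Hb j : nr j.+1 = nr j + (nr j.+1 != nr j).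
    case tj : (tau j); last by have [_ _ _ ->] := idle j (negbT tj); rewrite eqxx addn0.
    have [t [_ _ _ _ [_ -> _]]] := move_ j tj.
    by case: (pt_lab t) => [_|]; rewrite ?addn0 ?eqxx ?addn0 // addn1 (gtn_eqF (ltnSn _)) addn1.
  have /(unbounded_increments Hb) Hu : forall n, exists i, n <= nr i.
    by move=> n; have [m /and3P[_ _ ?]] := Hm n; exists m.
  move=> N; have [i [le bi]] := Hu N; exists i; split=> //.
  by case tj : (tau i) => //; have [_ _ _ E] := idle i (negbT tj); rewrite E eqxx in bi.
have [phi [p1 p2 p3 p4]] := increasing_enumeration tau_inf.
have const j k : (forall i, j <= i < j + k -> ~~ tau i) ->
    [/\ st (j + k) = st j, stk (j + k) = stk j, nf (j + k) = nf j & nr (j + k) = nr j].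
  elim: k => [|k IH] Hk; first by rewrite addn0.
  have [<- <- <- <-] : [/\ st (j + k) = st j, stk (j + k) = stk j,
      nf (j + k) = nf j & nr (j + k) = nr j].
    by apply: IH => i ij; apply: Hk; lia.
  by rewrite addnS; apply: idle; apply: Hk; lia.
have nextE i : [/\ st (phi i.+1) = st (phi i).+1, stk (phi i.+1) = stk (phi i).+1,
    nf (phi i.+1) = nf (phi i).+1 & nr (phi i.+1) = nr (phi i).+1].
  rewrite -(subnKC (p3 i)); apply: const => j; rewrite subnKC // => Hj; apply: (p4 i); lia.
have zeroE : [/\ st (phi 0) = st 0, stk (phi 0) = stk 0, nf (phi 0) = nf 0 & nr (phi 0) = nr 0].
  by rewrite -[phi 0]add0n; apply: const => j Hj; apply: p2; lia.
have [tr Htr] := choice_ex (fun i => move_ _ (p1 i)).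
have le_phi i : i <= phi i by elim: i => // i IH; apply: leq_trans (p3 i).
have mono u j j' : (forall i, u i <= u i.+1) -> j <= j' -> u j <= u j'.
  by move=> Hu /subnKC <-; elim: (j' - j) => [|k IH]; rewrite ?addn0 // addnS (leq_trans IH).
have sub u : (forall i, u i <= u i.+1) -> (forall n, exists m, n <= u m) ->
    forall n, exists i, n <= u (phi i).
  by move=> Hu Hn n; have [m le] := Hn n; exists m; apply: leq_trans le _; apply: mono.
exists (fun i => st (phi i)), (fun i => stk (phi i)), tr; split.
- by have [-> _ _ _] := zeroE.
- by have [_ -> _ _] := zeroE.
- move=> i; have [H1 H2 H3 H4 _] := Htr i; have [-> -> _ _] := nextE i.
  by split.
- exists (fun i => nr (phi i)); split.
  + by have [_ _ _ ->] := zeroE.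
  + by move=> i; have [_ _ _ _ [_ E _]] := Htr i; have [_ _ _ ->] := nextE i.
  + by move=> i; have [_ _ _ _ [_ _ E]] := Htr i.
  + apply: sub => [j|n]; last by have [m /and3P[_ _ ?]] := Hm n; exists m.
    case tj : (tau j); last by have [_ _ _ ->] := idle j (negbT tj).
    by have [t [_ _ _ _ [_ -> _]]] := move_ j tj; exact: leq_addr.
- apply/(unbounded_increments (u := fun i => nf (phi i))).
    by move=> i; have [_ _ _ _ [E _ _]] := Htr i; have [_ _ -> _] := nextE i.
  apply: sub => [j|n]; last by have [m /and3P[_ ? _]] := Hm n; exists m.
  case tj : (tau j); last by have [_ _ -> _] := idle j (negbT tj).
  by have [t [_ _ _ _ [-> _ _]]] := move_ j tj; exact: leq_addr.
Qed.

End PushdownSimulation.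

Lemma CFL_Sigma11 (X : finType) (L : (nat -> X) -> Prop) : CFL L -> Sigma11 L.
Proof.
move=> [M HM]; have [R [rR HR]] := recursive_computable (computable_sim_check M).
exists R; split=> // sigma; rewrite HM; split.
  move=> /pd_accepts_guess[tau H]; exists tau => n; have [m Hm] := H n.
  by exists m; apply/HR.
move=> [tau H]; apply: (@guess_pd_accepts _ _ sigma tau) => n; have [m Hm] := H n.
by exists m; apply/HR.
Qed.

(** * A normal form for effective analytic sets *)

(** A phase consumes one letter of each player together with two guessed bits, so that the known
    prefixes of the play and of the witness keep the same length. *)
Definition phase_event (X : Type) := ((X * X) * (bool * bool))%type.

Definition phase_step (X : Type) (f : phase_event X -> nat -> nat) (g : nat -> bool)
    (ab : nat -> X * X) (c : nat * nat) (m : bool) (c' : nat * nat) : Prop :=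
  [/\ c'.1 = c.1.+1, m = g c.2 & exists e, c'.2 = f (ab c.1, e) c.2].

Definition letter_pairs (X : Type) (sigma : nat -> X) (i : nat) := (sigma i.*2, sigma i.*2.+1).

Section NormalForm.

Variables (X : finType) (r : nat -> bool).

Local Notation memory := (nat * nat * seq bool * seq X)%type.

Definition search_test (z : memory) : bool :=
  let: (n, m, t, s) := z in r (pickle (n, take m t, take m s)).

(* The witnesses [m] for the current [n] are tried one after the other. *)
Definition search_step (x : phase_event X) (z : memory) : memory :=
  let: (n, m, t, s) := z in let: ((a, b), (u, v)) := x in
  (if search_test z then (n.+1, 0) else (n, m.+1),
   rcons (rcons t u) v, rcons (rcons s a) b).

Lemma computable_search_test : computable r -> computable search_test.
Proof.
move=> cr; pose Z : countType := memory.
have c0 : computable (fun z : Z => z) by exact: computable_id.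
have cm : computable (fun z : Z => z.1.1.2).
  by apply/computable_snd/computable_fst/computable_fst.
pose T : countType := (nat * seq bool * seq X)%type.
have [h [rh H]] : computable (fun z : Z => (z.1.1.1, take z.1.1.2 z.1.2, take z.1.1.2 z.2) : T).
  apply: computable_pair; last by apply: computable_take => //; exact: computable_snd.
  apply: computable_pair; first by do 3!apply: computable_fst.
  by apply: computable_take => //; apply/computable_snd/computable_fst.
have [k [rk K]] := cr; exists (fun x => k (h x)); split; first exact: total_rec_app1.
by case=> [[[n m] t] s]; rewrite H K.
Qed.

Lemma computable_search_step x : computable r -> computable (search_step x).
Proof.
move=> cr; pose Z : countType := memory.
have c0 : computable (fun z : Z => z) by exact: computable_id.
case: x => -[a b] [u v].
apply: (@computable_ext Z _ (fun z => (if search_test z then (z.1.1.1.+1, 0)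
   else (z.1.1.1, z.1.1.2.+1), rcons (rcons z.1.2 u) v, rcons (rcons z.2 a) b))).
  by case=> [[[n m] t] s].
apply: computable_pair; first apply: computable_pair.
- apply: computable_if; first exact: computable_search_test.
    apply: computable_pair; last exact: computable_const.
    by apply/computable_succ/computable_fst/computable_fst/computable_fst.
  apply: computable_pair; first by do 3!apply: computable_fst.
  by apply/computable_succ/computable_snd/computable_fst/computable_fst.
- do 2!(apply: computable_rcons; last exact: computable_const).
  by apply/computable_snd/computable_fst.
- do 2!(apply: computable_rcons; last exact: computable_const).
  exact: computable_snd.
Qed.

Section Search.

Variables (tau : nat -> bool) (sigma : nat -> X).

Definition witness (n m : nat) : bool := r (pickle (n, prefix tau m, prefix sigma m)).

Fixpoint pointer (i : nat) : nat * nat :=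
  if i is j.+1 then
    let: (n, m) := pointer j in if witness n m then (n.+1, 0) else (n, m.+1)
  else (0, 0).

Definition found (i : nat) : bool := witness (pointer i).1 (pointer i).2.

Lemma pointerS i : pointer i.+1 =
  if found i then ((pointer i).1.+1, 0) else ((pointer i).1, (pointer i).2.+1).
Proof. by rewrite /found /=; case: (pointer i). Qed.

(** The bound guarantees that a test looks only at letters and bits already received; the second
    part says that the search skips no candidate. *)
Lemma pointer_inv i : (pointer i).2 <= i /\
  forall m, m < (pointer i).2 -> ~~ witness (pointer i).1 m.
Proof.
elim: i => [//|i [le H]]; rewrite pointerS.
case E: (found i) => //=; split; first by rewrite ltnS.
by move=> m; rewrite ltnS leq_eqVlt => /orP[/eqP->|/H //]; rewrite -/(found i) E.
Qed.

(** The search leaves n exactly when a witness for n is found. It stays at n forever only if all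
    candidates fail, that is, if n has no witness. *)
Lemma found_infinitely_often :
  (forall N, exists i, N <= i /\ found i) <-> (forall n, exists m, witness n m).
Proof.
have incr i : (pointer i.+1).1 = (pointer i).1 + found i.
  by rewrite pointerS; case: (found i); rewrite /= ?addn0 ?addn1.
split=> [/(unbounded_increments incr) H n|H N].
  have [i lti] := H n.+1.
  have ex : exists i, n < (pointer i).1 by exists i.
  case: (ex_minnP ex) => -[//|j] lt min; exists (pointer j).2.
  have : (pointer j).1 <= n by rewrite leqNgt; apply/negP => /min; rewrite ltnn.
  move: lt; rewrite incr; case E: (found j); last by rewrite addn0 => lt /(leq_trans lt); rewrite ltnn.
  by rewrite addn1 ltnS => le ge; rewrite (anti_leq (introT andP (conj le ge))).
apply: Classical_Prop.NNPP => no.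
have stay k : pointer (N + k) = ((pointer N).1, (pointer N).2 + k).
  elim: k => [|k IH]; first by rewrite !addn0; case: (pointer N).
  rewrite addnS pointerS; case E: (found (N + k)); last by rewrite IH /= addnS.
  by case: no; exists (N + k); rewrite leq_addr.
have [m wm] := H (pointer N).1.
have [_ Hm] := pointer_inv N.
have le : (pointer N).2 <= m by rewrite leqNgt; apply/negP => /Hm; rewrite wm.
case: no; exists (N + (m - (pointer N).2)); split; first exact: leq_addr.
by rewrite /found stay /= subnKC.
Qed.

End Search.

End NormalForm.

Theorem Sigma11_normal_form (X : finType) (A : (nat -> X) -> Prop) : Sigma11 A ->
  exists (f : phase_event X -> nat -> nat) (g : nat -> bool),
    [/\ forall x, total_rec 1 (fun v => f x (nth 0 v 0)),
        total_rec 1 (fun v => nat_of_bool (g (nth 0 v 0)))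
      & forall sigma, A sigma <-> live (phase_step f g (letter_pairs sigma)) (0, 0)].
Proof.
move=> [R [/computable_recursive[r [cr Hr]] HA]].
have [f' Hf'] := choice_ex (fun x => @computable_search_step X r x cr).
have [g' [rg' Hg']] := @computable_search_test X r cr.
pose z0 : nat * nat * seq bool * seq X := (0, 0, [::], [::]).
(* The phases have to start from the number 0. No memory has code 0, so 0 is free to stand for the
   initial memory [z0]. *)
pose init k := if k != 0 then k else pickle z0.
have cinit : total_rec 1 (fun v => init (nth 0 v 0)).
  by apply: total_rec_if; [exact: total_rec_nth|exact: total_rec_nth|exact: total_rec_const].
pose f x k := f' x (init k); pose g k := g' (init k) == 1.
exists f, g; split=> [x||sigma].
- by apply: (@total_rec_app1 _ (f' x)) => //; have [] := Hf' x.
- by apply: total_rec_eq; [exact: (@total_rec_app1 _ g')|exact: total_rec_const].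
pose zs tau i : nat * nat * seq bool * seq X :=
  (pointer r tau sigma i, prefix tau i.*2, prefix sigma i.*2).
have takeE (T : Type) (y : nat -> T) m i : m <= i -> take m (prefix y i) = prefix y m.
  by move=> le; rewrite /prefix /mkseq -map_take take_iota (minn_idPl le).
have testE tau i : search_test r (zs tau i) = found r tau sigma i.
  have [le _] := pointer_inv r tau sigma i.
  rewrite /search_test /zs /found /witness; case: (pointer _ _ _ i) le => n m /= le.
  by rewrite !takeE //; lia.
have stepE tau i : search_step r (letter_pairs sigma i, (tau i.*2, tau i.*2.+1)) (zs tau i)
    = zs tau i.+1.
  have tE := testE tau i; move: tE; rewrite /zs pointerS doubleS !prefixS.
  by case: (pointer _ _ _ i) => n m; rewrite /search_step /letter_pairs => ->.
have gE tau i k : init k = pickle (zs tau i) -> g k = found r tau sigma i.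
  by move=> E; rewrite /g E Hg' testE; case: (found _ _ _ _).
have fE tau i k : init k = pickle (zs tau i) ->
    f (letter_pairs sigma i, (tau i.*2, tau i.*2.+1)) k = pickle (zs tau i.+1).
  by move=> E; rewrite /f E (Hf' _).2 stepE.
rewrite HA; split=> [[tau H]|H]; last have {H} [u [mk [u0 [Hs Hm]]]] := live_run H.
  have /found_infinitely_often Hinf : forall n, exists m, witness r tau sigma n m.
    by move=> n; have [m /Hr] := H n; exists m.
  pose k i := if i is 0 then 0 else pickle (zs tau i).
  have Hk i : init (k i) = pickle (zs tau i).
    by case: i => [//|i]; rewrite /init /k pickle_pair cons_code_neq0.
  have := @run_live _ (phase_step f g (letter_pairs sigma)) (fun i => (i, k i))
    (found r tau sigma); apply; split=> // i; split=> //=; first by rewrite (gE tau i).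
  by exists (tau i.*2, tau i.*2.+1); rewrite (fE tau i).
have u1 i : (u i).1 = i by elim: i => [|i IH]; [rewrite u0|have [-> _ _] := Hs i; rewrite IH].
have He i : exists e, (u i.+1).2 = f (letter_pairs sigma i, e) (u i).2.
  by have [_ _ [e E]] := Hs i; exists e; rewrite E u1.
have [e Ee] := choice_ex He.
pose tau j := if odd j then (e j./2).2 else (e j./2).1.
have etau i : e i = (tau i.*2, tau i.*2.+1).
  by rewrite /tau /= odd_double /= uphalf_double doubleK; case: (e i).
have Hk i : init (u i).2 = pickle (zs tau i).
  elim: i => [|i IH]; first by rewrite u0.
  by rewrite Ee etau (fE tau i) // /init pickle_pair cons_code_neq0.
exists tau => n.
suff [m Hw] : exists m, witness r tau sigma n m by exists m; apply/Hr.
move: n; apply/found_infinitely_often => N; have [i [le mi]] := Hm N.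
exists i; split=> //; rewrite -(gE tau i (u i).2) //.
by have [_ <- _] := Hs i.
Qed.

(** * Compiling recursive functions to register programs *)

(** The only test is that of the loop, which decrements its register before each pass. Thus
    increment and test-and-decrement suffice, which become multiplication and division by a prime on
    a packed number. *)
Inductive cmd : Type :=
| CSkip
| CIncr of nat
| CSeq of cmd & cmd
| CLoop of nat & cmd.

Definition upd (rho : nat -> nat) (r x : nat) : nat -> nat :=
  fun i => if i == r then x else rho i.

Inductive cexec : cmd -> (nat -> nat) -> (nat -> nat) -> Prop :=
| ex_skip rho : cexec CSkip rho rho
| ex_incr r rho : cexec (CIncr r) rho (upd rho r (rho r).+1)
| ex_seq c d rho rho' rho'' :
    cexec c rho rho' -> cexec d rho' rho'' -> cexec (CSeq c d) rho rho''
| ex_loop0 r c rho : rho r = 0 -> cexec (CLoop r c) rho rho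
| ex_loopS r c rho rho' rho'' : 0 < rho r ->
    cexec c (upd rho r (rho r).-1) rho' -> cexec (CLoop r c) rho' rho'' ->
    cexec (CLoop r c) rho rho''.

Ltac upd_eq := apply: functional_extensionality => ?; rewrite /upd;
  repeat case: eqP => ? //=; subst; try lia; try congruence.

Lemma cexec_eq c rho rho1 rho2 : cexec c rho rho1 -> rho1 = rho2 -> cexec c rho rho2.
Proof. by move=> H <-. Qed.

Lemma cexec_loop r c n (S : nat -> nat -> nat) :
  (forall i, i <= n -> S i r = n - i) ->
  (forall i, i < n -> cexec c (upd (S i) r (n - i).-1) (S i.+1)) ->
  cexec (CLoop r c) (S 0) (S n).
Proof.
move=> Hr Hs.
have H k : k <= n -> cexec (CLoop r c) (S (n - k)) (S n).
  elim: k => [|k IH] le; first by rewrite subn0; apply: ex_loop0; rewrite Hr // subnn.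
  have Er : S (n - k.+1) r = k.+1 by rewrite Hr ?leq_subr // subKn.
  apply: (ex_loopS (rho' := S (n - k))); rewrite ?Er //; last by apply: IH; lia.
  have lt : n - k.+1 < n by lia.
  by move: (Hs _ lt); rewrite subKn // -subSn // subSS.
by have := H n (leqnn n); rewrite subnn.
Qed.

Lemma cexec_clear r rho : cexec (CLoop r CSkip) rho (upd rho r 0).
Proof.
have -> : rho = upd rho r (rho r - 0) by upd_eq.
have -> : upd (upd rho r (rho r - 0)) r 0 = upd rho r (rho r - rho r) by upd_eq.
apply: (@cexec_loop r _ (rho r) (fun i => upd rho r (rho r - i))) => [i _|i lt].
  by rewrite /upd eqxx.
by apply: cexec_eq (ex_skip _) _; upd_eq.
Qed.

Lemma cexec_move a b rho : a != b ->
  cexec (CLoop a (CIncr b)) rho (upd (upd rho b (rho b + rho a)) a 0).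
Proof.
move=> /eqP ab; pose S i := upd (upd rho b (rho b + i)) a (rho a - i).
have -> : upd (upd rho b (rho b + rho a)) a 0 = S (rho a) by rewrite /S; upd_eq.
rewrite [X in cexec _ X](_ : rho = S 0); last by rewrite /S; upd_eq.
apply: cexec_loop => [i _|i lt]; first by rewrite /S /upd eqxx.
by apply: cexec_eq (ex_incr _ _) _; rewrite /S; upd_eq.
Qed.

Lemma cexec_copy a b t rho : a != b -> a != t -> b != t -> rho t = 0 ->
  cexec (CSeq (CLoop a (CSeq (CIncr b) (CIncr t))) (CLoop t (CIncr a))) rho
    (upd rho b (rho b + rho a)).
Proof.
move=> ab at_ bt t0.
pose S i := upd (upd (upd rho b (rho b + i)) t i) a (rho a - i).
apply: (ex_seq (rho' := S (rho a))).
  rewrite [X in cexec _ X](_ : rho = S 0); last by rewrite /S; upd_eq.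
  apply: cexec_loop => [i _|i lt]; first by rewrite /S /upd eqxx.
  apply: ex_seq (ex_incr _ _) _; apply: cexec_eq (ex_incr _ _) _.
  by move: ab at_ bt => /eqP ab /eqP at_ /eqP bt; rewrite /S; upd_eq.
have ta : t != a by rewrite eq_sym.
apply: cexec_eq (cexec_move _ ta) _.
by move: ab at_ bt => /eqP ab /eqP at_ /eqP bt; rewrite /S; upd_eq.
Qed.

(** The list inside [RComp] calls for an inner recursion that supplies the induction hypothesis for
    each of its members. *)
Fixpoint recf_nested_ind (P : recf -> Prop) (H0 : P RZero) (HS : P RSucc)
    (Hp : forall i, P (RProj i))
    (Hc : forall f gs, P f -> (forall g, List.In g gs -> P g) -> P (RComp f gs))
    (Hr : forall f g, P f -> P g -> P (RPrim f g))
    (Hm : forall f, P f -> P (RMu f)) (c : recf) : P c :=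
  let rec := recf_nested_ind H0 HS Hp Hc Hr Hm in
  match c with
  | RZero => H0
  | RSucc => HS
  | RProj i => Hp i
  | RComp f gs => Hc f gs (rec f)
      ((fix all (l : list recf) : forall g, List.In g l -> P g :=
          match l with
          | nil => fun g (H : List.In g nil) => match H with end
          | List.cons h l' => fun g (H : List.In g (List.cons h l')) =>
              match H with
              | or_introl e => eq_ind h P (rec h) g e
              | or_intror H' => all l' g H'
              end
          end) gs)
  | RPrim f g => Hr f g (rec f) (rec g)
  | RMu f => Hm f (rec f)
  end.

(** The final state differs from the initial one at [out] only: arguments survive and the scratch
    registers from [base] on are empty again, so a subprogram can be repeated inside a loop. *)
Definition evaluates (p : cmd) (c : recf) (xs : seq nat) (out base : nat) : Prop :=
  forall y rho, reval c (map rho xs) y -> rho out = 0 ->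
    (forall r, base <= r -> rho r = 0) -> cexec p rho (upd rho out y).

Definition compilable (c : recf) : Prop :=
  forall xs out base, (forall x, x \in xs -> x < base) -> out < base -> out \notin xs ->
    exists p, evaluates p c xs out base.

Lemma map_upd rho r x xs : r \notin xs -> map (upd rho r x) xs = map rho xs.
Proof.
move=> Hr; apply/eq_in_map => i ixs; rewrite /upd.
by case: eqP => // E; rewrite -E ixs in Hr.
Qed.

Lemma reval_primS f g n v y : reval (RPrim f g) (n.+1 :: v) y ->
  exists r, reval (RPrim f g) (n :: v) r /\ reval g (n :: r :: v) y.
Proof. by move=> H; inversion H; subst; eexists; split; eassumption. Qed.

Lemma reval_prim f g n v y : reval (RPrim f g) (n :: v) y ->
  exists r : nat -> nat, [/\ reval f v (r 0),
    forall j, j < n -> reval g (j :: r j :: v) (r j.+1) & r n = y].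
Proof.
elim: n y => [|n IH] y H; first by inversion H; subst; exists (fun=> y).
have [w [/IH[r [r0 rS rn]] Hw]] := reval_primS H; subst w.
exists (fun k => if k == n.+1 then y else r k); rewrite eqxx; split=> // j lt.
have -> : (j == n.+1) = false by lia.
rewrite eqSS; case: eqP => [-> //|ne]; apply: rS; lia.
Qed.

(** Register [base] counts the passes still to be made, [base.+1] those made, [base.+2] holds the
    current value and [base.+3] receives the next one. The recursion argument [xn] is copied to
    [base], because it has to survive. *)
Lemma compilable_prim f g : compilable f -> compilable g -> compilable (RPrim f g).
Proof.
move=> cf cg xs out base xs_lt out_lt out_xs.
case: xs xs_lt out_xs => [|xn xs] xs_lt out_xs.
  by exists CSkip => y rho H; inversion H.
have xn_lt := xs_lt xn (mem_head _ _).
have xs_lt' x : x \in xs -> x < base by move=> xxs; apply: xs_lt; rewrite inE xxs orbT.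
have fresh r : base <= r -> r \notin xs.
  by move=> le; apply/negP => /xs_lt'; lia.
have [|||pf Hf] := cf xs base.+2 base.+4.
- by move=> x /xs_lt'; lia.
- by [].
- by apply: fresh; lia.
have [|||pg Hg] := cg [:: base.+1, base.+2 & xs] base.+3 base.+4.
- by move=> x; rewrite !inE => /or3P[/eqP->|/eqP->|/xs_lt']; lia.
- by lia.
- by rewrite !inE !negb_or !fresh //; lia.
pose body := CSeq pg (CSeq (CLoop base.+2 CSkip)
  (CSeq (CLoop base.+3 (CIncr base.+2)) (CIncr base.+1))).
exists (CSeq (CSeq (CLoop xn (CSeq (CIncr base) (CIncr base.+3))) (CLoop base.+3 (CIncr xn)))
  (CSeq pf (CSeq (CLoop base body) (CSeq (CLoop base.+1 CSkip) (CLoop base.+2 (CIncr out)))))).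
move=> y rho H out0 free.
have [r [r0 rS rn]] := reval_prim H.
set n := rho xn in rS rn.
pose S j := upd (upd (upd rho base (n - j)) base.+1 j) base.+2 (r j).
have b0 := free base (leqnn _).
have b1 : rho base.+1 = 0 by apply: free; lia.
have b2 : rho base.+2 = 0 by apply: free; lia.
have b3 : rho base.+3 = 0 by apply: free; lia.
apply: (ex_seq (rho' := upd rho base n)).
  by apply: cexec_eq (cexec_copy _ _ _ _) _ => //; rewrite ?b0 //; lia.
apply: (ex_seq (rho' := S 0)).
  apply: cexec_eq.
    apply: Hf; rewrite ?map_upd ?fresh //; first exact: r0.
      by rewrite /upd b2; case: eqP => //; lia.
    by move=> q le; rewrite /upd; case: eqP => [|_]; [lia|apply: free; lia].
  by rewrite /S; upd_eq.
apply: (ex_seq (rho' := S n)).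
  apply: cexec_loop => [i le|i lt].
    by rewrite /S /upd; do 2!(case: eqP => [|_]; first lia); rewrite eqxx.
  apply: (ex_seq (rho' := upd (upd (S i) base (n - i).-1) base.+3 (r i.+1))).
    apply: Hg.
    - have -> : [seq upd (S i) base (n - i).-1 q | q <- [:: base.+1, base.+2 & xs]]
          = i :: r i :: map rho xs.
        rewrite /= /S !map_upd ?fresh //; try lia.
        by congr [:: _, _ & _]; rewrite /upd; repeat case: eqP => //=; lia.
      exact: rS.
    - by rewrite /S /upd; repeat case: eqP => //=; lia.
    - by move=> q le; rewrite /S /upd; repeat (case: eqP => [|_]; first lia); apply: free; lia.
  apply: ex_seq (cexec_clear _ _) _; apply: (ex_seq (cexec_move _ _)); first lia.
  by apply: cexec_eq (ex_incr _ _) _; rewrite /S; upd_eq.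
apply: ex_seq (cexec_clear _ _) _.
apply: cexec_eq (cexec_move _ _) _; first lia.
have outb : out != base by lia.
by rewrite /S subnn; upd_eq.
Qed.

(** The candidate is kept in [base] and the value of [f] there in [base.+1], which controls the
    loop. A pass clears the value, moves to the next candidate and evaluates again; below [y] the
    values exist and are positive. *)
Lemma compilable_mu f : compilable f -> compilable (RMu f).
Proof.
move=> cf xs out base xs_lt out_lt out_xs.
have fresh r : base <= r -> r \notin xs.
  by move=> le; apply/negP => /xs_lt; lia.
have [|||pf Hf] := cf (base :: xs) base.+1 base.+2.
- by move=> x; rewrite inE => /orP[/eqP->|/xs_lt]; lia.
- by [].
- by rewrite inE negb_or fresh //; lia.
exists (CSeq pf (CSeq (CLoop base.+1 (CSeq (CLoop base.+1 CSkip) (CSeq (CIncr base) pf)))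
  (CLoop base (CIncr out)))).
move=> y rho H out0 free.
have [w [wy w0 wpos]] : exists w, [/\ forall m, m <= y -> reval f (m :: map rho xs) (w m),
    w y = 0 & forall m, m < y -> 0 < w m].
  inversion H as [| | | | | |? ? ? H0 Hpos]; subst.
  have Hw m : exists k, m < y -> reval f (m :: map rho xs) k.+1.
    by case: (ltnP m y) => [/Hpos[k Hk]|_]; [exists k|exists 0].
  have [w Hw'] := choice_ex Hw.
  exists (fun m => if m < y then (w m).+1 else 0); split=> [m le| |m ->] //; last by rewrite ltnn.
  by case: ltnP => [/Hw'//|ge]; have -> : m = y by lia.
have b0 := free base (leqnn _).
have b1 : rho base.+1 = 0 by apply: free; lia.
pose S m := upd (upd rho base m) base.+1 (w m).
have step m : m <= y -> cexec pf (upd rho base m) (S m).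
  move=> le; apply: cexec_eq.
    apply: Hf; first by rewrite /= map_upd ?fresh // {1}/upd eqxx; exact: wy.
      by rewrite /upd; case: eqP => //; lia.
    by move=> q leq; rewrite /upd; case: eqP => [|_]; [lia|apply: free; lia].
  by [].
apply: (ex_seq (rho' := S 0)).
  by apply: cexec_eq; [move: (step 0 isT); rewrite (_ : upd rho base 0 = rho); [exact|upd_eq]|].
apply: (ex_seq (rho' := S y)).
  have loop k : k <= y -> cexec (CLoop base.+1 (CSeq (CLoop base.+1 CSkip)
      (CSeq (CIncr base) pf))) (S (y - k)) (S y).
    elim: k => [|k IH] le.
      by rewrite subn0; apply: ex_loop0; rewrite /S /upd eqxx.
    have ltk : y - k.+1 < y by lia.
    have Sk : (y - k.+1).+1 = y - k by lia.
    apply: (ex_loopS (rho' := S (y - k))); last by apply: IH; lia.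
      by rewrite /S /upd eqxx; exact: wpos.
    apply: ex_seq (cexec_clear _ _) _; apply: ex_seq (ex_incr _ _) _.
    apply: cexec_eq.
      rewrite [X in cexec _ X](_ : _ = upd rho base (y - k)); first by apply: step; lia.
      by rewrite /S -Sk; upd_eq.
    by [].
  by have := loop y (leqnn y); rewrite subnn.
apply: cexec_eq (cexec_move _ _) _; first lia.
by rewrite /S w0; upd_eq.
Qed.

Definition updl (rho : nat -> nat) (j : nat) (ys : seq nat) : nat -> nat :=
  fun r => if j <= r < j + size ys then nth 0 ys (r - j) else rho r.

Lemma updl_cons rho j y ys : updl rho j (y :: ys) = updl (upd rho j y) j.+1 ys.
Proof.
apply: functional_extensionality => r; rewrite /updl /upd /= addSnnS.
case: (ltngtP j r) => [lt|//|->] /=; last by rewrite subnn addnS ltnS leq_addr.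
by have -> : r - j = (r - j.+1).+1 by lia.
Qed.

Lemma compilable_list gs xs j : (forall g, List.In g gs -> compilable g) ->
  (forall x, x \in xs -> x < j) ->
  exists p, forall ys rho, revals gs (map rho xs) ys -> (forall r, j <= r -> rho r = 0) ->
    cexec p rho (updl rho j ys).
Proof.
elim: gs j => [|g gs IH] j Hg xs_lt.
  exists CSkip => ys rho H free; inversion H; subst; apply: cexec_eq (ex_skip _) _.
  by apply: functional_extensionality => r; rewrite /updl /= addn0; case: ltngtP.
have jxs : j \notin xs by apply/negP => /xs_lt; rewrite ltnn.
have [|||p Hp] := Hg g (or_introl erefl) xs j j.+1 => //.
  by move=> x /xs_lt; lia.
have [|| q Hq] := IH j.+1.
- by move=> h Hh; apply: Hg; right.
- by move=> x /xs_lt; lia.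
exists (CSeq p q) => ys rho H free; inversion H; subst; rewrite updl_cons.
apply: (ex_seq (rho' := upd rho j y)); first by apply: Hp => // [|r le]; apply: free; lia.
apply: Hq => [|r lt]; first by rewrite map_upd.
by rewrite /upd; case: eqP => [|_]; [lia|apply: free; lia].
Qed.

Lemma clear_range j k : exists p, forall rho,
  cexec p rho (fun r => if j <= r < j + k then 0 else rho r).
Proof.
elim: k => [|k [p Hp]].
  exists CSkip => rho; apply: cexec_eq (ex_skip _) _.
  by apply: functional_extensionality => r; rewrite addn0; case: ltngtP.
exists (CSeq p (CLoop (j + k) CSkip)) => rho; apply: ex_seq (Hp _) _.
apply: cexec_eq (cexec_clear _ _) _.
apply: functional_extensionality => r; rewrite /upd addnS ltnS.
by case: (ltngtP r (j + k)) => // ->; rewrite leq_addr.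
Qed.

Lemma size_revals gs v ys : revals gs v ys -> size ys = size gs.
Proof. by elim: gs ys => [|g gs IH] ys H; inversion H; subst => //=; rewrite IH. Qed.

Lemma compilable_comp f gs : compilable f -> (forall g, List.In g gs -> compilable g) ->
  compilable (RComp f gs).
Proof.
move=> cf cgs xs out base xs_lt out_lt out_xs.
have [p Hp] := compilable_list cgs xs_lt.
have [|||q Hq] := cf (iota base (size gs)) out (base + size gs).
- by move=> x; rewrite mem_iota; lia.
- by lia.
- by rewrite mem_iota; lia.
have [s Hs] := clear_range base (size gs).
exists (CSeq p (CSeq q s)) => y rho H out0 free.
inversion H as [| | |? ? ? ys ? Hgs Hf| | |]; subst.
have sz := size_revals Hgs.
apply: (ex_seq (rho' := updl rho base ys)); first exact: Hp.
apply: ex_seq.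
  apply: Hq; [|by rewrite /updl; case: ifP => //; lia|].
  - suff -> : [seq updl rho base ys i | i <- iota base (size gs)] = ys by exact: Hf.
    apply: (@eq_from_nth _ 0); rewrite size_map size_iota // => i lt.
    rewrite (nth_map 0) ?size_iota // nth_iota // /updl sz.
    by rewrite leq_addr ltn_add2l lt addKn.
  - by move=> r le; rewrite /updl sz; case: ifP => [|_]; [lia|apply: free; lia].
apply: cexec_eq (Hs _) _; apply: functional_extensionality => r.
rewrite /upd /updl sz; case: eqP => [->|ne]; first by case: ifP => //; lia.
by case E: (_ && _) => //; rewrite free //; lia.
Qed.

Theorem compile_recf c : compilable c.
Proof.
elim/recf_nested_ind: c.
- move=> xs out base _ _ _; exists CSkip => y rho H out0 _.
  by inversion H; subst; apply: cexec_eq (ex_skip _) _; upd_eq.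
- move=> [|x xs] out base xs_lt out_lt out_xs; first by exists CSkip => y rho H; inversion H.
  have xb := xs_lt x (mem_head _ _); rewrite inE negb_or in out_xs.
  have /andP[ne _] := out_xs.
  exists (CSeq (CSeq (CLoop x (CSeq (CIncr out) (CIncr base))) (CLoop base (CIncr x))) (CIncr out)).
  move=> y rho H out0 free; inversion H; subst.
  apply: ex_seq; first by apply: cexec_copy; [rewrite eq_sym|lia|lia|exact: free].
  by apply: cexec_eq (ex_incr _ _) _; upd_eq.
- move=> i xs out base xs_lt out_lt out_xs.
  case: (ltnP i (size xs)) => lt; last first.
    exists CSkip => y rho H; inversion H as [| |? ? lt'| | | |].
    by move: lt'; rewrite size_map ltnNge lt.
  set x := nth 0 xs i.
  have xin : x \in xs by exact: mem_nth.
  have xb := xs_lt x xin.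
  have ne : x != out by apply: contra out_xs => /eqP <-.
  exists (CSeq (CLoop x (CSeq (CIncr out) (CIncr base))) (CLoop base (CIncr x))).
  move=> y rho H out0 free; inversion H; subst.
  apply: cexec_eq; first by apply: cexec_copy; [|lia|lia|exact: free].
  by rewrite (nth_map 0) // out0.
- exact: compilable_comp.
- exact: compilable_prim.
- exact: compilable_mu.
Qed.

(** All registers other than 0 and 1 come back empty; once the flag in register 1 is consumed, the
    state is a start state for the next phase. *)
Lemma compile_phase (f : nat -> nat) (g : nat -> bool) :
  total_rec 1 (fun v => f (nth 0 v 0)) -> total_rec 1 (fun v => nat_of_bool (g (nth 0 v 0))) ->
  exists p, forall z, cexec p (upd (fun=> 0) 0 z) (upd (upd (fun=> 0) 0 (f z)) 1 (g z)).
Proof.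
move=> [cf Hf] [cg Hg].
have [|||p Hp] := @compile_recf cf [:: 0] 2 3 => //; first by case.
have [|||q Hq] := @compile_recf cg [:: 0] 1 3 => //; first by case.
exists (CSeq p (CSeq q (CSeq (CLoop 0 CSkip) (CLoop 2 (CIncr 0))))) => z.
apply: ex_seq; first by apply: Hp; [apply: (Hf [:: z])| |case].
apply: ex_seq; first by apply: Hq; [apply: (Hg [:: z])| |case=> [|[|[|r]]]].
apply: ex_seq (cexec_clear _ _) _.
by apply: cexec_eq (cexec_move _ _) _ => //; upd_eq.
Qed.

(** * Register programs acting on a single number *)

Inductive star (S : Type) (R : S -> S -> Prop) : S -> S -> Prop :=
| star_refl s : star R s s
| star_step s s' s'' : R s s' -> star R s' s'' -> star R s s''.

Lemma star_trans S (R : S -> S -> Prop) a b c : star R a b -> star R b c -> star R a c.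
Proof. by elim=> {a b} // a b d Hab _ IH /IH; exact: star_step. Qed.

Lemma star_stuck S (R : S -> S -> Prop) a b : star R a b -> (forall c, ~ R a c) -> b = a.
Proof. by case=> [//|s s' s'' H _ /(_ _ H)]. Qed.

(* A register machine whose registers are packed into one number: incrementing
   a register is a multiplication by its prime, decrementing it an exact
   division, and testing it for zero a test of non-divisibility. *)
Record machine (E : Type) := Machine {
  m_state : finType; m_trans : finType; m_ok : pred m_trans;
  m_src : m_trans -> m_state; m_dst : m_trans -> m_state;
  m_mul : m_trans -> nat; m_div : m_trans -> nat; m_exact : pred m_trans;
  m_start : E -> m_state; m_exit : m_state -> option bool }.

Section MachineSteps.

Variables (E : Type) (M : machine E).

Definition fires (t : m_trans M) (c c' : nat) : Prop :=
  if m_exact t then m_mul t * c = m_div t * c'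
  else c' = m_mul t * c /\ ~~ (m_div t %| m_mul t * c).

Definition mstep (s s' : m_state M * nat) : Prop :=
  exists t, [/\ m_ok t, m_src t = s.1, m_dst t = s'.1 & fires t s.2 s'.2].

(** The one-counter automaton will guess the transitions that it fires. As steps are deterministic
    and exits are stuck, whatever it completes follows the computation of the last clause. *)
Definition realizes (enc : nat -> nat) (f : E -> nat -> nat) (g : nat -> bool) : Prop :=
  [/\ forall t : m_trans M, m_ok t -> 0 < m_mul t /\ 0 < m_div t,
      forall s s1 s2, mstep s s1 -> mstep s s2 -> s1 = s2,
      forall q c s b, m_exit q = Some b -> ~ mstep (q, c) s
    & forall x z, exists q, m_exit q = Some (g z) /\
        star mstep (m_start M x, enc z) (q, enc (f x z))].

End MachineSteps.

Fixpoint nth_prime (r : nat) : nat :=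
  if r is r'.+1 then s2val (prime_above (nth_prime r')) else 2.

Lemma prime_nth_prime r : prime (nth_prime r).
Proof. by case: r => [//|r] /=; case: (prime_above _). Qed.

Lemma nth_prime_inj : injective nth_prime.
Proof.
have mono r k : nth_prime r < nth_prime (r + k.+1).
  have monoS q : nth_prime q < nth_prime q.+1 by rewrite /=; case: (prime_above _).
  by elim: k => [|k IH]; rewrite addnS ?addn0 //; apply: ltn_trans IH _.
have {}mono r s : r < s -> nth_prime r < nth_prime s.
  by move=> lt; have := mono r (s - r).-1; rewrite prednK ?subn_gt0 // subnKC // ltnW.
by move=> r s; case: (ltngtP r s) => // /mono; lia.
Qed.

Definition goedel (R : nat) (rho : nat -> nat) : nat :=
  \prod_(r < R) nth_prime r ^ rho r.

Lemma goedel_incr R rho r : r < R ->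
  goedel R (upd rho r (rho r).+1) = nth_prime r * goedel R rho.
Proof.
move=> lt; rewrite /goedel (bigD1 (Ordinal lt)) //= [in RHS](bigD1 (Ordinal lt)) //=.
rewrite {1}/upd eqxx expnS mulnA; congr (_ * _); apply: eq_bigr => i ne.
by rewrite /upd ifN.
Qed.

Lemma dvdn_goedel R rho r : r < R -> (nth_prime r %| goedel R rho) = (0 < rho r).
Proof.
move=> lt; rewrite /goedel; case: (posnP (rho r)) => [r0|pos]; last first.
  by rewrite (bigD1 (Ordinal lt)) //= dvdn_mulr // dvdn_exp.
rewrite Euclid_dvd_prod ?prime_nth_prime // big_orE.
apply/negbTE/existsP => -[i] /=.
rewrite Euclid_dvdX ?prime_nth_prime // dvdn_prime2 ?prime_nth_prime //.
by move=> /andP[/eqP E]; rewrite -(nth_prime_inj E) r0.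
Qed.

Lemma goedel_decr R rho r : r < R -> 0 < rho r ->
  goedel R rho = nth_prime r * goedel R (upd rho r (rho r).-1).
Proof.
move=> lt pos; rewrite -goedel_incr //; congr goedel.
by upd_eq.
Qed.

Inductive instr : Type := IHalt | IIncr of nat | IDecr of nat & nat | IJump of nat.

Fixpoint clen (c : cmd) : nat :=
  match c with
  | CSkip => 0
  | CIncr _ => 1
  | CSeq c d => clen c + clen d
  | CLoop _ c => (clen c).+2
  end.

Fixpoint assemble (c : cmd) (a : nat) : seq instr :=
  match c with
  | CSkip => [::]
  | CIncr r => [:: IIncr r]
  | CSeq c d => assemble c a ++ assemble d (a + clen c)
  | CLoop r c => IDecr r (a + (clen c).+2) :: rcons (assemble c a.+1) (IJump a)
  end.

Lemma size_assemble c a : size (assemble c a) = clen c.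
Proof.
elim: c a => //= [c IHc d IHd|r c IH] a; first by rewrite size_cat IHc IHd.
by rewrite size_rcons IH.
Qed.

Definition istep (P : seq instr) (s s' : nat * (nat -> nat)) : Prop :=
  let: (a, rho) := s in
  match nth IHalt P a with
  | IHalt => False
  | IIncr r => s' = (a.+1, upd rho r (rho r).+1)
  | IDecr r b => s' = if 0 < rho r then (a.+1, upd rho r (rho r).-1) else (b, rho)
  | IJump b => s' = (b, rho)
  end.

Lemma assemble_correct c rho rho' : cexec c rho rho' -> forall P a,
  (forall i, i < clen c -> nth IHalt P (a + i) = nth IHalt (assemble c a) i) ->
  star (istep P) (a, rho) (a + clen c, rho').
Proof.
elim=> {c rho rho'} [rho|r rho|c d rho rho' rho'' _ IHc _ IHd|r c rho r0
  |r c rho rho' rho'' pos _ IHc _ IHl] P a HP.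
- by rewrite addn0; exact: star_refl.
- apply: star_step (star_refl _ _); rewrite /istep.
  by have := HP 0 isT; rewrite addn0 => -> /=; rewrite addn1.
- apply: (star_trans (IHc P a _)) => [i lt|].
    by rewrite HP /= ?nth_cat ?size_assemble ?lt //; lia.
  rewrite [clen _]/= addnA; apply: IHd => i lt.
  rewrite -addnA HP /= ?ltn_add2l // nth_cat size_assemble.
  by rewrite ltnNge leq_addr /= addKn.
- apply: star_step (star_refl _ _); rewrite /istep.
  by have := HP 0 isT; rewrite addn0 => -> /=; rewrite r0.
- apply: (star_step (s' := (a.+1, upd rho r (rho r).-1))).
    rewrite /istep.
    by have := HP 0 isT; rewrite addn0 => -> /=; rewrite pos.
  apply: (star_trans (IHc P a.+1 _)) => [i lt|].
    by rewrite addSnnS HP /= ?nth_rcons ?size_assemble ?lt //; lia.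
  apply: (star_step (s' := (a, rho'))); last exact: IHl.
  rewrite /istep addSnnS HP //= nth_rcons size_assemble ltnn eqxx.
  by [].
Qed.

Fixpoint max_reg (c : cmd) : nat :=
  match c with
  | CSkip => 0
  | CIncr r => r
  | CSeq c d => maxn (max_reg c) (max_reg d)
  | CLoop r c => maxn r (max_reg c)
  end.

Definition instr_bounded (R N : nat) (i : instr) : bool :=
  match i with
  | IHalt => true
  | IIncr r => r < R
  | IDecr r b => (r < R) && (b < N)
  | IJump b => b < N
  end.

Lemma assemble_bounded c a R N : max_reg c < R -> a + clen c < N ->
  all (instr_bounded R N) (assemble c a).
Proof.
elim: c a => //= [r|c IHc d IHd|r c IH] a.
- by rewrite andbT.
- rewrite gtn_max => /andP[ltc ltd] le; rewrite all_cat IHc ?IHd //; lia.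
- rewrite gtn_max => /andP[ltc ltd] le.
  by rewrite ltc le all_rcons /= IH //; lia.
Qed.

(** * The register machine obtained from a finite family of programs *)

Section MachineOfPrograms.

Variables (E : finType) (code : E -> cmd) (f : E -> nat -> nat) (g : nat -> bool).
Hypothesis code_spec : forall x z,
  cexec (code x) (upd (fun=> 0) 0 z) (upd (upd (fun=> 0) 0 (f x z)) 1 (g z)).

(** The appended decrement moves the flag from register 1 into the control: there is one halting
    address for each outcome, and register 1 is empty at both. *)
Definition phase_prog (x : E) : seq instr :=
  assemble (code x) 0 ++ [:: IDecr 1 (clen (code x)).+2; IHalt; IHalt].

(** The offsets of this bound and the next make room for register 1, tested at the end, and for the
    three appended instructions. *)
Definition reg_bound : nat := (\max_(x : E) max_reg (code x)).+2.
Definition pc_bound : nat := (\max_(x : E) clen (code x)).+3.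

(** The boolean of a transition is the guessed outcome of a decrement: exact division or failed
    divisibility. For other instructions both values act alike, which is compatible with
    determinism, a property of steps and not of transitions. *)
Definition machine_of_programs : machine E := {|
  m_state := (E * 'I_pc_bound)%type;
  m_trans := (E * 'I_pc_bound * bool)%type;
  m_ok := fun t => if nth IHalt (phase_prog t.1.1) t.1.2 is IHalt then false else true;
  m_src := fun t => t.1;
  m_dst := fun t => (t.1.1, inord match nth IHalt (phase_prog t.1.1) t.1.2 with
    | IDecr _ b => if t.2 then t.1.2.+1 else b
    | IJump b => b
    | _ => t.1.2.+1
    end);
  m_mul := fun t => if nth IHalt (phase_prog t.1.1) t.1.2 is IIncr r then nth_prime r else 1;
  m_div := fun t => if nth IHalt (phase_prog t.1.1) t.1.2 is IDecr r _ then nth_prime r else 1;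
  m_exact := fun t => if nth IHalt (phase_prog t.1.1) t.1.2 is IDecr _ _ then t.2 else true;
  m_start := fun x => (x, inord 0);
  m_exit := fun q => if q.2 == (clen (code q.1)).+1 :> nat then Some true else
    if q.2 == (clen (code q.1)).+2 :> nat then Some false else None |}.

Lemma phase_prog_bounded x : all (instr_bounded reg_bound pc_bound) (phase_prog x).
Proof.
have le : clen (code x) <= \max_(x : E) clen (code x) by exact: leq_bigmax.
rewrite all_cat assemble_bounded //= /pc_bound ?add0n; try lia.
by rewrite /reg_bound ltnS leqW // (leq_bigmax (F := fun x => max_reg (code x))).
Qed.

Lemma istep_mstep x a rho a' rho' : a < pc_bound -> istep (phase_prog x) (a, rho) (a', rho') ->
  a' < pc_bound /\ mstep (M := machine_of_programs) ((x, inord a), goedel reg_bound rho)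
    ((x, inord a'), goedel reg_bound rho').
Proof.
move=> lta; rewrite /istep.
have lta' : a < size (phase_prog x) -> nth IHalt (phase_prog x) a <> IHalt -> a.+1 < pc_bound.
  have le : clen (code x) <= \max_(x : E) clen (code x) by exact: leq_bigmax.
  rewrite /phase_prog size_cat size_assemble /= nth_cat size_assemble /pc_bound.
  move: (\max_(_ : E) _) le => B le.
  case: (ltnP a (clen (code x))) => [lt _ _|ge]; first lia.
  case Ea : (a - clen (code x)) => [|[|[|k]]] /= lt ne; lia || by case: ne.
have bnd := all_nthP IHalt (phase_prog_bounded x).
case Ei : (nth IHalt (phase_prog x) a) => [|r|r b|b] //.
all: have lt : a < size (phase_prog x)
       by rewrite ltnNge; apply/negP => /(nth_default IHalt); rewrite Ei.
all: have {}lta' : a.+1 < pc_bound by apply: lta' => //; rewrite Ei.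
all: have := bnd _ lt; rewrite Ei /=.
- move=> ltr [-> ->]; split=> //; exists (x, inord a, true).
  by rewrite /fires /= inordK // Ei /= mul1n goedel_incr.
- move=> /andP[ltr ltb]; case: (posnP (rho r)) => [r0|pos] [-> ->]; split=> //.
    exists (x, inord a, false); rewrite /fires /= inordK // Ei /= !mul1n.
    by rewrite dvdn_goedel // r0.
  exists (x, inord a, true); rewrite /fires /= inordK // Ei /= mul1n.
  by rewrite -goedel_decr.
- move=> ltb [-> ->]; split=> //; exists (x, inord a, true).
  by rewrite /fires /= inordK // Ei /= !mul1n.
Qed.

Lemma istar_mstar x s s' : star (istep (phase_prog x)) s s' -> s.1 < pc_bound ->
  s'.1 < pc_bound /\ star (@mstep _ machine_of_programs) ((x, inord s.1), goedel reg_bound s.2)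
    ((x, inord s'.1), goedel reg_bound s'.2).
Proof.
elim=> {s s'} [s lt|[a rho] [b rho'] s'' st _ IH lt]; first by split=> //; exact: star_refl.
have [lt' st'] := istep_mstep lt st; have [lt'' H] := IH lt'.
by split=> //; apply: star_step H.
Qed.

Lemma machine_realizes :
  realizes machine_of_programs (fun z => goedel reg_bound (upd (fun=> 0) 0 z)) f g.
Proof.
have gt0 r : 0 < nth_prime r by apply/prime_gt0/prime_nth_prime.
split.
- by move=> [[x a] b] /=; case: (nth IHalt _ _).
- move=> [[x a] c] [q1 c1] [q2 c2] [[[x1 a1] b1] [ok1 s1 d1 F1]] [[[x2 a2] b2] [ok2 s2 d2 F2]].
  move: s1 s2 ok1 d1 F1 ok2 d2 F2 => /= [-> ->] [-> ->]; rewrite /fires /=.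
  case: (nth IHalt _ _) => [|r|r b|b] // _ <- F1 _ <- F2.
  + by rewrite !mul1n in F1 F2; rewrite -F1 -F2.
  + case: b1 b2 F1 F2 => -[] /=; rewrite !mul1n.
    * by move=> -> /eqP; rewrite eqn_pmul2l // => /eqP ->.
    * by move=> -> []; rewrite dvdn_mulr.
    * by move=> [_ nd] E0; rewrite E0 dvdn_mulr in nd.
    * by move=> [-> _] [-> _].
  + by rewrite !mul1n in F1 F2; rewrite -F1 -F2.
- move=> [x a] c s b /= H [[[x1 a1] b1] [/= ok1 [e1 e2] _ _]].
  move: ok1; rewrite e1 e2 /phase_prog nth_cat size_assemble.
  move: H; case: eqP => [-> _|_].
    by rewrite ltnNge leqnSn /= subSnn.
  case: eqP => [-> _|//].
  by rewrite ltnNge (leqW (leqnSn _)) /= -addn2 addKn.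
- move=> x z; set n := clen (code x).
  have le : n <= \max_(x : E) clen (code x) by exact: leq_bigmax.
  have nb : n.+2 < pc_bound by rewrite /pc_bound; lia.
  have Hnth i : n <= i -> nth IHalt (phase_prog x) i =
      nth IHalt [:: IDecr 1 n.+2; IHalt; IHalt] (i - n).
    by move=> lei; rewrite /phase_prog nth_cat size_assemble ltnNge lei.
  have H1 : star (istep (phase_prog x)) (0, upd (fun=> 0) 0 z)
      (n, upd (upd (fun=> 0) 0 (f x z)) 1 (g z)).
    have := assemble_correct (code_spec x z) (P := phase_prog x) (a := 0); apply=> i lt.
    by rewrite add0n /phase_prog nth_cat size_assemble lt.
  have H2 : istep (phase_prog x) (n, upd (upd (fun=> 0) 0 (f x z)) 1 (g z))
      (if g z then n.+1 else n.+2, upd (fun=> 0) 0 (f x z)).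
    rewrite /istep Hnth // subnn /=; case: (g z) => /=; congr (_, _); upd_eq.
  have [_ H3] := istar_mstar (star_trans H1 (star_step H2 (star_refl _ _))) isT.
  exists (x, inord (if g z then n.+1 else n.+2)); split; last exact: H3.
  rewrite /= -/n; case: (g z); rewrite inordK ?eqxx //; first exact: ltnW nb.
  by rewrite (gtn_eqF (ltnSn n.+1)).
Qed.

End MachineOfPrograms.

Theorem machine_exists (E : finType) (f : E -> nat -> nat) (g : nat -> bool) :
  (forall x, total_rec 1 (fun v => f x (nth 0 v 0))) ->
  total_rec 1 (fun v => nat_of_bool (g (nth 0 v 0))) ->
  exists (M : machine E) (enc : nat -> nat), enc 0 = 1 /\ realizes M enc f g.
Proof.
move=> Hf Hg; have [code Hcode] := choice_ex (fun x => compile_phase (Hf x) Hg).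
exists (machine_of_programs code), (fun z => goedel (reg_bound code) (upd (fun=> 0) 0 z)).
split; last exact: machine_realizes.
by rewrite /goedel big1 // => i _; rewrite /upd; case: ifP.
Qed.

(** * Automata reading rounds *)

Definition round (Y : Type) (y : nat -> Y) (j : nat) : Y * Y := (y j.*2, y j.*2.+1).

Arguments round : simpl never.

Lemma mem_In (T : eqType) (x : T) s : x \in s -> List.In x s.
Proof. by elim: s => //= z s IH; rewrite inE => /orP[/eqP->|/IH]; [left|right]. Qed.

Section RoundAutomaton.

Variables (Y K : finType) (delta : K -> bool -> Y * Y -> K -> cmove -> Prop) (q0 : K) (F : pred K).

Definition round_accepts (y : nat -> Y) : Prop :=
  exists (st : nat -> K) (cnt : nat -> nat) (mv : nat -> cmove),
    [/\ st 0 = q0, cnt 0 = 0,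
        forall j, delta (st j) (cnt j != 0) (round y j) (st j.+1) (mv j) /\
          cnt j.+1 = apply_cmove (cnt j) (mv j)
      & forall N, exists j, N <= j /\ F (st j)].

Definition cmove_of (o : option bool) : cmove :=
  if o is Some b then if b then CInc else CDec else CKeep.

Definition read_first (x : K * Y * bool) : ctrans 1 (K + K * Y) Y :=
  let: (q, a, b) := x in CTrans (inl q) (Some a) (fun=> b) (inr (q, a)) (fun=> CKeep).

Definition read_second (x : K * Y * Y * bool * K * option bool) : ctrans 1 (K + K * Y) Y :=
  let: (q, a, p, b, q', o) := x in
  CTrans (inr (q, a)) (Some p) (fun=> b) (inl q') (fun=> cmove_of o).

(** [delta] is a proposition, so excluded middle selects the transitions; membership in [BCL] asks
    only that the automaton exist. *)
Definition second_ok (x : K * Y * Y * bool * K * option bool) : bool :=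
  let: (q, a, p, b, q', o) := x in
  if excluded_middle_informative (delta q b (a, p) q' (cmove_of o)) then true else false.

Definition aut_of_rounds : counter_aut 1 Y := @CounterAut 1 Y (K + K * Y)%type
  (List.app (List.map read_first (enum {: K * Y * bool}))
    (List.map read_second (List.filter second_ok (enum {: K * Y * Y * bool * K * option bool}))))
  (inl q0) (fun s => if s is inl q then F q else false).

Lemma read_first_in q a b : List.In (read_first (q, a, b)) (ca_delta aut_of_rounds).
Proof.
by apply/List.in_or_app; left; apply: List.in_map; apply: mem_In; rewrite mem_enum.
Qed.

Lemma read_second_in q a p b q' mv : delta q b (a, p) q' mv ->
  List.In (CTrans (inr (q, a)) (Some p) (fun=> b) (inl q') (fun=> mv)) (ca_delta aut_of_rounds).
Proof.
move=> H; apply/List.in_or_app; right; apply/List.in_map_iff.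
exists (q, a, p, b, q', match mv with CDec => Some false | CKeep => None | CInc => Some true end).
split; first by case: (mv).
apply/List.filter_In; split; first by apply: mem_In; rewrite mem_enum.
by rewrite /=; case: excluded_middle_informative => //; case: (mv) H.
Qed.

Lemma in_delta t : List.In t (ca_delta aut_of_rounds) ->
  (exists q a b, t = read_first (q, a, b)) \/
  (exists q a p b q' mv, t = CTrans (inr (q, a)) (Some p) (fun=> b) (inl q') (fun=> mv) /\
     delta q b (a, p) q' mv).
Proof.
move=> H; have [|] := List.in_app_or _ _ _ H => /List.in_map_iff.
  by move=> [[[q a] b] [<- _]]; left; exists q, a, b.
move=> [[[[[[q a] p] b] q'] o] [<- H']]; have [_ ok] := proj1 (List.filter_In _ _ _) H'.
right; exists q, a, p, b, q', (cmove_of o); split=> //.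
by move: ok => /=; case: excluded_middle_informative.
Qed.

Lemma aut_of_roundsP y : ca_accepts aut_of_rounds y <-> round_accepts y.
Proof.
split=> [[st [cnt [tr [s0 c0 H [pos [p0 pS pl _]] HF]]]]|[st [cnt [mv [s0 c0 H HF]]]]]; last first.
  pose st' i : K + K * Y := if odd i then inr (st i./2, y i.-1) else inl (st i./2).
  have Ht i : exists t, [/\ List.In t (ca_delta aut_of_rounds), ct_src t = st' i,
      (forall m, ct_test t m = (cnt i./2 != 0)), st' i.+1 = ct_dst t
    & (forall m, cnt i.+1./2 = apply_cmove (cnt i./2) (ct_upd t m)) /\ ct_lab t = Some (y i)].
    have [j [->|->]] : exists j, i = j.*2 \/ i = j.*2.+1.
    - by exists i./2; move: (odd_double_half i); case: (odd i); [right|left].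
    - rewrite /st' /= odd_double doubleK uphalf_double.
      by eexists; split; first exact: (read_first_in (st j) (y j.*2) (cnt j != 0)).
    - rewrite /st' /= odd_double /= uphalf_double doubleK; have [H1 H2] := H j.
      by eexists; split; first exact: read_second_in H1.
  have [tr Htr] := choice_ex Ht.
  exists st', (fun i _ => cnt i./2), tr; split=> //=.
  - by rewrite /st' /= s0.
  - by move=> i; have [? ? ? ? []] := Htr i.
  - exists id; split=> // [i|i a|n]; last by exists n.
      by have [_ _ _ _ [_ ->]] := Htr i; rewrite addn1.
    by have [_ _ _ _ [_ ->]] := Htr i => -[].
  - move=> N; have [j [le Fj]] := HF N; exists j.*2.
    by rewrite /st' odd_double doubleK; split=> //; lia.
(* Every transition reads a letter, so position and time agree. *)
have posE i : pos i = i.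
  elim: i => // i IH; rewrite pS IH.
  have [/in_delta] := H i.
  by move=> [[q [a [b ->]]]|[q [a [p [b [q' [mv [-> _]]]]]]]] _ _ _ _; rewrite addn1.
have lab i a : ct_lab (tr i) = Some a -> y i = a by move=> /pl; rewrite posE.
have step i q : st i = inl q -> exists q' mv,
    [/\ delta q (cnt i ord0 != 0) (y i, y i.+1) q' mv, st i.+2 = inl q',
        cnt i.+2 ord0 = apply_cmove (cnt i ord0) mv & forall q, st i.+1 <> inl q].
  move=> Ei; have [/in_delta H1 H2 H3 H4 H5] := H i.
  case: H1 => [[q1 [a [b E]]]|[q1 [a [p [b [q' [mv [E _]]]]]]]]; rewrite E Ei // in H2 H3 H4 H5.
  have La := lab i a; rewrite E in La; move: H2 H4 H5 => /= [E1] H4 H5; subst q1.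
  have [/in_delta G1 G2 G3 G4 G5] := H i.+1.
  case: G1 => [[q1 [a1 [b1 E1]]]|[q1 [a1 [p [b1 [q' [mv [E1 D]]]]]]]];
    rewrite E1 H4 // in G2 G3 G4 G5.
  have Lp := lab i.+1 p; rewrite E1 in Lp; move: G2 G4 G5 => /= [? ?] G4 G5; subst.
  exists q', mv; split=> //; last by rewrite H4.
    by rewrite (La erefl) (Lp erefl) -(H5 ord0) -(G3 ord0).
  by rewrite G5 H5.
have Hinl j : exists q, st j.*2 = inl q.
  elim: j => [|j [q E]]; first by exists q0.
  by have [q' [mv [_ E' _ _]]] := step _ _ E; exists q'; rewrite doubleS.
have [sj Hsj] := choice_ex Hinl.
have Hmv j : exists mv, delta (sj j) (cnt j.*2 ord0 != 0) (round y j) (sj j.+1) mv /\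
    cnt j.+1.*2 ord0 = apply_cmove (cnt j.*2 ord0) mv.
  have [q' [mv [D E Ec _]]] := step _ _ (Hsj j); exists mv.
  by move: (Hsj j.+1) Ec; rewrite doubleS E => -[<-].
have [mv Hm] := choice_ex Hmv.
exists sj, (fun j => cnt j.*2 ord0), mv; split=> //.
  by move: (Hsj 0); rewrite s0 => -[].
move=> N; have [i [le]] := HF N.*2.
rewrite -(odd_double_half i); case: (odd i) => /=.
  by rewrite add1n; have [q' [mv' [_ _ _]]] := step _ _ (Hsj i./2); case: (st _) => // q /(_ q).
by rewrite add0n Hsj => Fs; exists i./2; split=> //; lia.
Qed.

End RoundAutomaton.

(** * The one-counter automaton *)

Inductive aut_state (Q T : Type) (B : nat) : Type :=
| Init | Scan | CountUp | Separated | CountDown | Error | Ready | Flagged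
| Pending of Q
| Multiplying of T & 'I_B
| Complementing of T
| Restoring of T
| Dividing of T & 'I_B.

Section AutStateFinite.

Variables (Q T : finType) (B : nat).

Definition aut_state_encode (s : aut_state Q T B) :
    'I_8 + (Q + ((T * 'I_B) + (T + (T + T * 'I_B)))) :=
  match s with
  | Init => inl (inord 0) | Scan => inl (inord 1) | CountUp => inl (inord 2)
  | Separated => inl (inord 3) | CountDown => inl (inord 4) | Error => inl (inord 5)
  | Ready => inl (inord 6) | Flagged => inl (inord 7)
  | Pending q => inr (inl q)
  | Multiplying t r => inr (inr (inl (t, r)))
  | Complementing t => inr (inr (inr (inl t)))
  | Restoring t => inr (inr (inr (inr (inl t))))
  | Dividing t r => inr (inr (inr (inr (inr (t, r)))))
  end.

Definition aut_state_decode (x : 'I_8 + (Q + ((T * 'I_B) + (T + (T + T * 'I_B))))) :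
    aut_state Q T B :=
  match x with
  | inl i => nth (Init Q T B) [:: Init Q T B; Scan Q T B; CountUp Q T B; Separated Q T B;
      CountDown Q T B; Error Q T B; Ready Q T B; Flagged Q T B] i
  | inr (inl q) => Pending T B q
  | inr (inr (inl (t, r))) => Multiplying Q t r
  | inr (inr (inr (inl t))) => Complementing Q B t
  | inr (inr (inr (inr (inl t)))) => Restoring Q B t
  | inr (inr (inr (inr (inr (t, r))))) => Dividing Q t r
  end.

Lemma aut_state_encodeK : cancel aut_state_encode aut_state_decode.
Proof. by case=> //=; rewrite inordK. Qed.

HB.instance Definition _ := Equality.copy (aut_state Q T B) (can_type aut_state_encodeK).
HB.instance Definition _ := Choice.copy (aut_state Q T B) (can_type aut_state_encodeK).
HB.instance Definition _ := Countable.copy (aut_state Q T B) (can_type aut_state_encodeK).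
HB.instance Definition _ := Finite.copy (aut_state Q T B) (can_type aut_state_encodeK).

End AutStateFinite.

Arguments Init {Q T B}. Arguments Scan {Q T B}. Arguments CountUp {Q T B}.
Arguments Separated {Q T B}. Arguments CountDown {Q T B}. Arguments Error {Q T B}.
Arguments Ready {Q T B}. Arguments Flagged {Q T B}. Arguments Pending {Q T B}.
Arguments Multiplying {Q T B}. Arguments Complementing {Q T B}. Arguments Restoring {Q T B}.
Arguments Dividing {Q T B}.

(* In a round, Player 2 writes [None] (a zero) or [Some b] (a separator). At a
   separator, [Some a] by Player 1 makes the round play the pair [(a, b)] of
   the simulated game, and [None] by Player 1 asks for another block. *)
Section Rounds.

Variable X : Type.
Implicit Types (y : nat -> option X) (r : option X * option X).

Definition is_real r : bool := isSome r.1 && isSome r.2.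

Fixpoint reals y (j : nat) : seq (X * X) :=
  if j is i.+1 then
    if round y i is (Some a, Some b) then rcons (reals y i) (a, b) else reals y i
  else [::].

Lemma realsS y j : reals y j.+1 =
  if round y j is (Some a, Some b) then rcons (reals y j) (a, b) else reals y j.
Proof. by []. Qed.

Fixpoint block_start (k : nat) : nat := if k is k'.+1 then block_start k' + k'.+2 else 0.

Definition block_end (k : nat) : nat := block_start k + k.+1.

Definition wf_blocks y : Prop := forall k,
  (forall l, l <= k -> (round y (block_start k + l)).2 = None) /\
  isSome (round y (block_end k)).2.

Lemma block_startS k : block_start k.+1 = (block_end k).+1.
Proof. by rewrite /block_end -addnS. Qed.

Lemma leq_block_start k : k <= block_start k.
Proof. by elim: k => // k IH; rewrite block_startS /block_end; lia. Qed.

Lemma block_ex j : exists k l, j = block_start k + l /\ l <= k.+1.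
Proof.
elim: j => [|j [k [l [-> le]]]]; first by exists 0, 0.
case: (ltngtP l k.+1) le => // [lt|->] _; first by exists k, l.+1; rewrite addnS.
by exists k.+1, 0; rewrite addn0 block_startS.
Qed.

End Rounds.

Arguments reals : simpl never.
Arguments block_start : simpl never.

Section Automaton.

Variables (X : finType) (M : machine (phase_event X)).

Local Notation Q := (m_state M).
Local Notation T := (m_trans M).

Definition speed_bound : nat := (\max_(t : T) (m_mul t + m_div t)).+1.

Local Notation K := (aut_state Q T speed_bound).

(* [Scan], ..., [Error] recognize the first ill-formed block by comparing its length
   with that of the previous block. In the other states the counter holds the
   number [c] of the machine. To fire [t], with [u = m_mul t] and [v = m_div t], the automaton
   reads a block of length [n] and is left with [n - u * c]; the next
   block, of length [n + 1], is read down to a remainder of [u * c] zeros, which are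
   counted with or without division by [v]. *)
Inductive aut_step : K -> bool -> option X * option X -> K -> cmove -> Prop :=
| as_init_error r : isSome r.2 -> aut_step Init false r Error CKeep
| as_init_down a : aut_step Init false (a, None) CountDown CKeep
| as_init_up a : aut_step Init false (a, None) CountUp CInc
| as_init_scan a : aut_step Init false (a, None) Scan CKeep
| as_init_ready a : aut_step Init false (a, None) Ready CInc
| as_scan b r : aut_step Scan b r Scan CKeep
| as_scan_up b r : isSome r.2 -> aut_step Scan b r CountUp CKeep
| as_up b a : aut_step CountUp b (a, None) CountUp CInc
| as_up_sep b r : isSome r.2 -> aut_step CountUp b r Separated CKeep
| as_sep_error b r : isSome r.2 -> aut_step Separated b r Error CKeep
| as_sep_down b a : aut_step Separated b (a, None) CountDown CKeep
| as_down a : aut_step CountDown true (a, None) CountDown CDec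
| as_down_short r : isSome r.2 -> aut_step CountDown true r Error CKeep
| as_down_long a : aut_step CountDown false (a, None) Error CKeep
| as_error b r : aut_step Error b r Error CKeep
| as_ready b r : ~~ is_real r -> aut_step Ready b r Ready CKeep
| as_read b a c e : aut_step Ready b (Some a, Some c) (Pending (m_start M ((a, c), e))) CKeep
| as_flagged b r : ~~ is_real r -> aut_step Flagged b r Ready CKeep
| as_pending b r q : ~~ is_real r -> aut_step (Pending q) b r (Pending q) CKeep
| as_exit b r q fl : ~~ is_real r -> m_exit q = Some fl ->
    aut_step (Pending q) b r (if fl then Flagged else Ready) CKeep
| as_start b c t (r0 : 'I_speed_bound) : m_ok t -> r0 = 0 :> nat ->
    aut_step (Pending (m_src t)) b (None, Some c) (Multiplying t r0) CKeep
| as_mul_keep a t (r r' : 'I_speed_bound) : r' = r.+1 :> nat -> r.+1 < m_mul t ->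
    aut_step (Multiplying t r) true (a, None) (Multiplying t r') CKeep
| as_mul_dec a t (r r' : 'I_speed_bound) : r' = 0 :> nat -> r.+1 = m_mul t ->
    aut_step (Multiplying t r) true (a, None) (Multiplying t r') CDec
| as_mul_compl a t r : aut_step (Multiplying t r) false (a, None) (Complementing t) CInc
| as_mul_sep c t r : aut_step (Multiplying t r) false (None, Some c) (Restoring t) CKeep
| as_compl b a t : aut_step (Complementing t) b (a, None) (Complementing t) CInc
| as_compl_sep b c t : aut_step (Complementing t) b (None, Some c) (Restoring t) CKeep
| as_restore a t : aut_step (Restoring t) true (a, None) (Restoring t) CDec
| as_restore_skip a t (r : 'I_speed_bound) : r = 0 :> nat ->
    aut_step (Restoring t) false (a, None) (Dividing t r) CKeep
| as_div_keep b a t (r r' : 'I_speed_bound) : r' = r.+1 :> nat -> r.+1 < m_div t ->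
    aut_step (Dividing t r) b (a, None) (Dividing t r') (if m_exact t then CKeep else CInc)
| as_div_inc b a t (r r' : 'I_speed_bound) : r' = 0 :> nat -> r.+1 = m_div t ->
    aut_step (Dividing t r) b (a, None) (Dividing t r') CInc
| as_div_sep b c t (r : 'I_speed_bound) : (r == 0 :> nat) = m_exact t ->
    aut_step (Dividing t r) b (None, Some c) (Pending (m_dst t)) CKeep.

Definition accepting (s : K) : bool :=
  match s with Error | Flagged => true | _ => false end.

Definition config_step (y : nat -> option X) (x : nat * K * nat) (m : bool)
    (x' : nat * K * nat) : Prop :=
  let: (j, s, n) := x in let: (j', s', n') := x' in
  [/\ j' = j.+1, m = accepting s
    & exists2 mv, aut_step s (n != 0) (round y j) s' mv & n' = apply_cmove n mv].

Lemma round_accepts_live y :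
  round_accepts aut_step Init accepting y <-> live (config_step y) (0, Init, 0).
Proof.
split=> [[st [cnt [mv [s0 c0 H HF]]]]|H].
  have := @run_live _ (config_step y) (fun j => (j, st j, cnt j)) (fun j => accepting (st j)).
  rewrite s0 c0; apply; split=> // j; have [H1 H2] := H j.
  by split=> //; exists (mv j).
have {H} [r [mk [r0 [Hs Hm]]]] := live_run H.
have rE i : (r i).1.1 = i.
  elim: i => [|i IH]; first by rewrite r0.
  have := Hs i; rewrite /config_step; case: (r i) IH => -[j s] n /= ->.
  by case: (r i.+1) => -[j' s'] n' [].
have Hmv i : exists mv, aut_step (r i).1.2 ((r i).2 != 0) (round y i) (r i.+1).1.2 mv /\
    (r i.+1).2 = apply_cmove (r i).2 mv.
  have := Hs i; rewrite /config_step; have := rE i; case: (r i) => -[j s] n /= ->.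
  by case: (r i.+1) => -[j' s'] n' [_ _ [mv H1 H2]]; exists mv.
have [mv Hmv'] := choice_ex Hmv.
exists (fun i => (r i).1.2), (fun i => (r i).2), mv; rewrite r0; split=> //.
move=> N; have [i [le mi]] := Hm N; exists i; split=> //.
have := Hs i; rewrite /config_step; case: (r i) => -[j s] n.
by case: (r i.+1) => -[j' s'] n' [_ <- _].
Qed.

End Automaton.

(** * Soundness of the automaton *)

Section Soundness.

Variables (X : finType) (M : machine (phase_event X)).
Variables (enc : nat -> nat) (f : phase_event X -> nat -> nat) (g : nat -> bool).
Hypothesis enc0 : enc 0 = 1.
Hypothesis HM : realizes M enc f g.
Variables (y : nat -> option X) (ab : nat -> X * X).
Hypothesis Hwf : wf_blocks y.
Hypothesis Hab : forall j a b, round y j = (Some a, Some b) -> ab (size (reals y j)) = (a, b).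

(** Describes the computation still to come rather than the part already done: from [(q, c)] the
    machine reaches the exit of the phase for some guess [e]. Determinism preserves this along every
    step. *)
Definition busy (j i z : nat) (q : m_state M) (c : nat) : Prop :=
  size (reals y j) = i.+1 /\ exists e qe,
    m_exit qe = Some (g z) /\ star (@mstep _ M) (q, c) (qe, enc (f (ab i, e) z)).

(** While the machine works, the phase state is the one at the beginning of the phase. [Error]
    cannot be reached on a well-formed play. *)
Definition simulated (x : nat * aut_state (m_state M) (m_trans M) (speed_bound M) * nat)
    (p : nat * nat) : Prop :=
  let: (j, s, n) := x in let: (i, z) := p in
  exists k l, [/\ j = block_start k + l, l <= k.+1 & match s with
    | Init => [/\ j = 0, n = 0, i = 0 & z = 0]
    | Scan => n = 0
    | CountUp => n = l
    | Separated => l = 0 /\ n = k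
    | CountDown => n + l = k.+1
    | Error => False
    | Ready => size (reals y j) = i /\ n = enc z
    | Flagged => [/\ size (reals y j) = i.+1, g z & exists e, n = enc (f (ab i, e) z)]
    | Pending q => busy j i z q n
    | Multiplying t r => m_ok t /\ exists c, [/\ busy j i z (m_src t) c,
        m_mul t * c + r = l + m_mul t * n & 0 < r -> 0 < n]
    | Complementing t => m_ok t /\ exists c, busy j i z (m_src t) c /\ m_mul t * c + n = l
    | Restoring t => m_ok t /\ exists c, busy j i z (m_src t) c /\ n + m_mul t * c + l = k
    | Dividing t r => m_ok t /\ exists c m, [/\ busy j i z (m_src t) c,
        l + m_mul t * c = k.+1 + m, r < m_div t
      & if m_exact t then m_div t * n + r = m else n = m /\ r = m %% m_div t :> nat]
    end].

(** Each phase carries the evidence that its pair has been played; a live chain of phases thus shows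
    that Player 1 does not wait forever. *)
Definition real_phase_step (c : nat * nat) (m : bool) (c' : nat * nat) : Prop :=
  phase_step f g ab c m c' /\ exists j, c.1 < size (reals y j).

Lemma reals_nonreal j : ~~ is_real (round y j) -> reals y j.+1 = reals y j.
Proof. by rewrite realsS; case: (round y j) => [[a|] [b|]]. Qed.

Lemma busy_next j i z q c : ~~ is_real (round y j) -> busy j i z q c -> busy j.+1 i z q c.
Proof. by move=> nr; rewrite /busy reals_nonreal. Qed.

Lemma zero_round k l : l <= k.+1 -> (round y (block_start k + l)).2 = None -> l <= k.
Proof.
rewrite leq_eqVlt ltnS => /orP[/eqP-> E|//].
by have [_] := Hwf k; rewrite /block_end E.
Qed.

Lemma sep_round k l : l <= k.+1 -> isSome (round y (block_start k + l)).2 -> l = k.+1.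
Proof.
rewrite leq_eqVlt ltnS => /orP[/eqP->//|le].
by have [H _] := Hwf k; rewrite H.
Qed.

Lemma mstep_exit q c qe ce b s : star (@mstep _ M) (q, c) (qe, ce) -> m_exit qe = Some b ->
  mstep (M := M) (q, c) s -> star (@mstep _ M) s (qe, ce).
Proof.
have [_ det stuck _] := HM.
move=> H Eb st; inversion H as [|? s1 ? st1 H1]; subst; first by case: (stuck _ _ _ _ Eb st).
by rewrite (det _ _ _ st st1).
Qed.

Lemma aut_step_simulated x p m x' : simulated x p -> config_step y x m x' ->
  exists p' m', [/\ path real_phase_step p m' p', m -> m' & simulated x' p'].
Proof.
move: x x' p => [[j s] n] [[j' s'] n'] [i z] [k [l [Ej le HR]]] [-> -> [mv st ->]].
have [pos det stuck spec] := HM.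
have zero : (round y j).2 = None -> l <= k /\ j.+1 = block_start k + l.+1.
  by move=> E; rewrite Ej addnS; split=> //; apply: zero_round => //; rewrite -Ej.
have sep : isSome (round y j).2 -> l = k.+1 /\ j.+1 = block_start k.+1 + 0.
  rewrite Ej => E; have -> := sep_round le E.
  by rewrite addn0 block_startS /block_end addnS.
have idle : simulated (j.+1, s', apply_cmove n mv) (i, z) -> accepting s = false ->
    exists p' m', [/\ path real_phase_step (i, z) m' p', accepting s -> m'
      & simulated (j.+1, s', apply_cmove n mv) p'].
  by move=> H ->; exists (i, z), false; split=> //; exact: path_nil.
have nreal_wait' c : round y j = (None, Some c) ->
    [/\ ~~ is_real (round y j), l = k.+1 & j.+1 = block_start k.+1 + 0].
  by move=> E; have [|-> ->] := sep; rewrite ?E.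
have zero' a : round y j = (a, None) ->
    [/\ ~~ is_real (round y j), l <= k & j.+1 = block_start k + l.+1].
  by move=> E; have [|le' ->] := zero; rewrite ?E // /is_real andbF.
clear zero.
move: st HR sep zero' nreal_wait' idle.
move Eb : (n != 0) => b; move Er : (round y j) => r st.
case: s b r s' mv / st Eb Er => /=.
- by move=> r Hr _ _ [? _ _ _] sep _ _ _; have [] := sep Hr; lia.
- move=> a Eb Er [j0 n0 i0 z0] _ zr _ idle; have [_ lk Ej'] := zr a erefl.
  by apply: idle => //; exists k, l.+1; split=> //; have := leq_block_start k; lia.
- move=> a Eb Er [j0 n0 i0 z0] _ zr _ idle; have [_ lk Ej'] := zr a erefl.
  by apply: idle => //; exists k, l.+1; split=> //; lia.
- move=> a Eb Er [j0 n0 i0 z0] _ zr _ idle; have [_ lk Ej'] := zr a erefl.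
  by apply: idle => //; exists k, l.+1; split=> //; lia.
- move=> a Eb Er [j0 n0 i0 z0] _ zr _ idle; have [nr lk Ej'] := zr a erefl.
  apply: idle => //; exists k, l.+1; split=> //.
    by rewrite reals_nonreal ?Er // j0 n0 i0 z0 enc0.
- move=> b r Eb Er n0 _ _ _ idle; have [k' [l' [Ej' le']]] := block_ex j.+1.
  by apply: idle => //; exists k', l'.
- move=> b r Hr Eb Er n0 sep _ _ idle; have [_ Ej'] := sep Hr.
  by apply: idle => //; exists k.+1, 0.
- move=> b a Eb Er nl _ zr _ idle; have [_ lk Ej'] := zr a erefl.
  by apply: idle => //; exists k, l.+1; split=> //; lia.
- move=> b r Hr Eb Er nl sep _ _ idle; have [lk Ej'] := sep Hr.
  by apply: idle => //; exists k.+1, 0; split=> //; lia.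
- by move=> b r Hr _ _ [? _] sep _ _ _; have [] := sep Hr; lia.
- move=> b a Eb Er [l0 nk] _ zr _ idle; have [_ lk Ej'] := zr a erefl.
  by apply: idle => //; exists k, l.+1; split=> //; lia.
- move=> a Eb Er nl _ zr _ idle; have [_ lk Ej'] := zr a erefl.
  by apply: idle => //; exists k, l.+1; split=> //; lia.
- by move=> r Hr Eb _ nl sep _ _ _; have [] := sep Hr; lia.
- by move=> a Eb _ nl _ zr _ _; have [] := zr a erefl; lia.
- by [].
- move=> b r nr Eb Er HR _ _ _ idle; have [k' [l' [Ej' le']]] := block_ex j.+1.
  by apply: idle => //; exists k', l'; split=> //; rewrite reals_nonreal ?Er.
- move=> b a c e Eb Er [Hi ->] _ _ _ idle; have [k' [l' [Ej' le']]] := block_ex j.+1.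
  apply: idle => //; exists k', l'; split=> //; split.
    by rewrite realsS Er size_rcons Hi.
  have [qe Hqe] := spec ((a, c), e) z; exists e, qe.
  by rewrite -Hi (Hab Er).
(* A step is marked by the state that it leaves, so the marked phase step is made on leaving
   [Flagged]. *)
- move=> b r nr Eb Er [Hi gz [e ->]] _ _ _ _; have [k' [l' [Ej' le']]] := block_ex j.+1.
  exists (i.+1, f (ab i, e) z), true; split=> //; last first.
    by exists k', l'; split=> //; rewrite reals_nonreal ?Er.
  apply: path1; split; first by split=> //; exists e.
  by exists j; rewrite Hi.
- move=> b r q nr Eb Er HR _ _ _ idle; have [k' [l' [Ej' le']]] := block_ex j.+1.
  by apply: idle => //; exists k', l'; split=> //; apply: busy_next; rewrite ?Er.
- move=> b r q fl nr Hq Eb Er [Hi [e [qe [Hqe H]]]] _ _ _ idle.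
  have [k' [l' [Ej' le']]] := block_ex j.+1.
  (* An exit has no successor, so the computation still to come is empty and the counter holds the
     final number. *)
  have [Eq En] : qe = q /\ n = enc (f (ab i, e) z).
    by have [] := star_stuck H (fun s => @stuck q n s fl Hq).
  move: idle; rewrite Eq Hq in Hqe; case: Hqe => ->; case: (boolP (g z)) => gz idle.
    apply: idle => //; exists k', l'; split=> //; split=> //; last by exists e.
    by rewrite reals_nonreal ?Er.
  exists (i.+1, f (ab i, e) z), false; split=> //; last first.
    by exists k', l'; split=> //; rewrite reals_nonreal ?Er.
  apply: path1; split; last by exists j; rewrite Hi.
  by split=> //=; [rewrite (negbTE gz)|exists e].
- move=> b c t r0 ok r00 Eb Er HR _ _ wt idle; have [nr lk Ej'] := wt c erefl.
  apply: idle => //; exists k.+1, 0; split=> //; split=> //; exists n; rewrite r00; split=> //.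
    by apply: busy_next; rewrite ?Er.
  by rewrite addn0.
- move=> a t r r' -> lt Eb Er [ok [c [HR Ec Hr]]] _ zr _ idle; have [nr lk Ej'] := zr a erefl.
  apply: idle => //; exists k, l.+1; split=> //; split=> //; exists c; split; [|lia|lia].
  by apply: busy_next; rewrite ?Er.
- move=> a t r r' -> Eu Eb Er [ok [c [HR Ec Hr]]] _ zr _ idle; have [nr lk Ej'] := zr a erefl.
  apply: idle => //; exists k, l.+1; split=> //; split=> //; exists c; split; [|nia|lia].
  by apply: busy_next; rewrite ?Er.
- move=> a t r Eb Er [ok [c [HR Ec Hr]]] _ zr _ idle; have [nr lk Ej'] := zr a erefl.
  apply: idle => //; exists k, l.+1; split=> //; split=> //; exists c; split; [|nia].
  by apply: busy_next; rewrite ?Er.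
- move=> c' t r Eb Er [ok [c [HR Ec Hr]]] _ _ wt idle; have [nr lk Ej'] := wt c' erefl.
  apply: idle => //; exists k.+1, 0; split=> //; split=> //; exists c; split; [|nia].
  by apply: busy_next; rewrite ?Er.
- move=> b a t Eb Er [ok [c [HR Ec]]] _ zr _ idle; have [nr lk Ej'] := zr a erefl.
  apply: idle => //; exists k, l.+1; split=> //; split=> //; exists c; split; [|lia].
  by apply: busy_next; rewrite ?Er.
- move=> b c' t Eb Er [ok [c [HR Ec]]] _ _ wt idle; have [nr lk Ej'] := wt c' erefl.
  apply: idle => //; exists k.+1, 0; split=> //; split=> //; exists c; split; [|lia].
  by apply: busy_next; rewrite ?Er.
- move=> a t Eb Er [ok [c [HR Ec]]] _ zr _ idle; have [nr lk Ej'] := zr a erefl.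
  apply: idle => //; exists k, l.+1; split=> //; split=> //; exists c; split; [|lia].
  by apply: busy_next; rewrite ?Er.
- move=> a t r r0 Eb Er [ok [c [HR Ec]]] _ zr _ idle; have [nr lk Ej'] := zr a erefl.
  have [_ v0] := pos t ok.
  apply: idle => //; exists k, l.+1; split=> //; split=> //; exists c, 0; split; [|lia|lia|].
    by apply: busy_next; rewrite ?Er.
  by rewrite r0 mod0n; case: (m_exact t); lia.
- move=> b a t r r' -> lt Eb Er [ok [c [m1 [HR Ec ltr Em]]]] _ zr _ idle.
  have [nr lk Ej'] := zr a erefl.
  apply: idle => //; exists k, l.+1; split=> //; split=> //; exists c, m1.+1; split; [|lia|lia|].
    by apply: busy_next; rewrite ?Er.
  case: (m_exact t) Em => /=; first lia.
  by move=> [-> Em]; split=> //; rewrite -[m1.+1]addn1 -modnDml -Em addn1 modn_small.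
- move=> b a t r r' -> Ev Eb Er [ok [c [m1 [HR Ec ltr Em]]]] _ zr _ idle.
  have [nr lk Ej'] := zr a erefl.
  apply: idle => //; exists k, l.+1; split=> //; split=> //; exists c, m1.+1; split; [|lia|lia|].
    by apply: busy_next; rewrite ?Er.
  case: (m_exact t) Em => /=; first nia.
  by move=> [-> Em]; split=> //; rewrite -[m1.+1]addn1 -modnDml -Em addn1 Ev modnn.
- move=> b c' t r Er0 Eb Er [ok [c [m1 [HR Ec ltr Em]]]] _ _ wt idle.
  have [nr lk Ej'] := wt c' erefl.
  apply: idle => //; exists k.+1, 0; split=> //.
  (* At the separator [l = k.+1], so the zeros counted are exactly the product. *)
  have Emc : m1 = m_mul t * c by lia.
  have [Hi [e [qe [Hqe H]]]] := HR; split; first by rewrite reals_nonreal ?Er.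
  exists e, qe; split=> //; apply: (mstep_exit H Hqe); exists t; split=> //.
  move: Em Er0; rewrite /fires /=; case: (m_exact t) => [Em /eqP r0|[-> Em] r0].
    by rewrite -Emc -Em r0 addn0.
  by split=> //; rewrite /dvdn -Emc -Em r0.
Qed.

Lemma live_aut_phases : live (config_step (M := M) y) (0, Init, 0) ->
  live real_phase_step (0, 0).
Proof.
apply: (@live_simulation _ _ _ _ simulated); first by move=> x p m x'; exact: aut_step_simulated.
by exists 0, 0.
Qed.

Lemma live_real_phases : live real_phase_step (0, 0) ->
  live (phase_step f g ab) (0, 0) /\ forall i, exists j, i < size (reals y j).
Proof.
move=> H; have [r [mk [r0 [Hs Hm]]]] := live_run H; split.
  by rewrite -r0; apply: run_live; split; [move=> i; have [] := Hs i|exact: Hm].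
move=> i; have rE k : (r k).1 = k.
  by elim: k => [|k IH]; [rewrite r0|have [[-> _ _] _] := Hs k; rewrite IH].
by have [_] := Hs i; rewrite rE.
Qed.

End Soundness.

(** * Completeness of the automaton *)

Section Completeness.

Variables (X : finType) (M : machine (phase_event X)) (y : nat -> option X).

Local Notation B := (speed_bound M).
Local Notation K := (aut_state (m_state M) (m_trans M) B).

Definition reach (x x' : nat * K * nat) : Prop := exists m, path (config_step (M := M) y) x m x'.

Lemma reach_refl x : reach x x.
Proof. by exists false; exact: path_nil. Qed.

Lemma reach_trans x1 x2 x3 : reach x1 x2 -> reach x2 x3 -> reach x1 x3.
Proof. by move=> [m p] [m' p']; exists (m || m'); exact: path_cat p p'. Qed.

Lemma config_step_intro j (s s' : K) n mv : aut_step s (n != 0) (round y j) s' mv ->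
  config_step (M := M) y (j, s, n) (accepting s) (j.+1, s', apply_cmove n mv).
Proof. by move=> H; split=> //; exists mv. Qed.

Lemma reach_step j (s s' : K) n mv x : aut_step s (n != 0) (round y j) s' mv ->
  reach (j.+1, s', apply_cmove n mv) x -> reach (j, s, n) x.
Proof.
move=> H [m p']; exists (accepting s || m); apply: path_cat p'; apply: path1.
exact: config_step_intro H.
Qed.

Lemma reach_step1 j (s s' : K) n mv : aut_step s (n != 0) (round y j) s' mv ->
  reach (j, s, n) (j.+1, s', apply_cmove n mv).
Proof. by move=> H; apply: reach_step H (reach_refl _). Qed.

Lemma zero_roundE j : (round y j).2 = None -> exists a, round y j = (a, None).
Proof. by case: (round y j) => a b /= ->; exists a. Qed.

(** * Acceptance of ill-formed plays *)

Section IllFormed.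

Lemma reach_scan j k : reach (j, Scan, 0) (j + k, Scan, 0).
Proof.
elim: k => [|k IH]; first by rewrite addn0; exact: reach_refl.
by rewrite addnS; apply: reach_trans IH _; apply: (reach_step1 (mv := CKeep)); exact: as_scan.
Qed.

Lemma reach_count_up j n k : (forall i, i < k -> (round y (j + i)).2 = None) ->
  reach (j, CountUp, n) (j + k, CountUp, n + k).
Proof.
elim: k => [|k IH] H; first by rewrite !addn0; exact: reach_refl.
rewrite !addnS; apply: reach_trans (IH _) _ => [i lt|]; first by apply: H; lia.
have [a E] := zero_roundE (H k (ltnSn k)).
by apply: (reach_step1 (mv := CInc)); rewrite E; exact: as_up.
Qed.

Lemma reach_count_down j n k : k <= n -> (forall i, i < k -> (round y (j + i)).2 = None) ->
  reach (j, CountDown, n) (j + k, CountDown, n - k).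
Proof.
elim: k => [|k IH] le H; first by rewrite addn0 subn0; exact: reach_refl.
rewrite addnS subnS; apply: reach_trans (IH _ _) _ => [|i lt|]; [lia|by apply: H; lia|].
have [a E] := zero_roundE (H k (ltnSn k)).
apply: (reach_step1 (mv := CDec)); rewrite E.
have -> : n - k != 0 by lia.
exact: as_down.
Qed.

(** [Error] is accepting and loops on every round. *)
Lemma live_error j n : reach (0, Init, 0) (j, Error, n) ->
  live (config_step (M := M) y) (0, Init, 0).
Proof.
move=> [m p]; have H i : path (config_step (M := M) y) (j + i, Error, n) true (j + i.+1, Error, n).
  by rewrite addnS; apply: path1; apply: (config_step_intro (mv := CKeep)); exact: as_error.
exists (fun i => if i is i'.+1 then (j + i, Error, n) else (0, Init, 0)); split=> // -[|i] //.
rewrite -(orbT m); apply: path_cat p _; have := H 0; rewrite addn0; exact.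
Qed.

(** Take the least faulty block and the least faulty position in it. The last equation covers both
    faults: a separator that comes too early, or a zero at [l = k.+1], where the separator is
    due. *)
Lemma first_error : ~ wf_blocks y -> exists k l,
  [/\ forall k', k' < k -> (forall i, i <= k' -> (round y (block_start k' + i)).2 = None) /\
          isSome (round y (block_end k')).2,
      l <= k.+1, forall i, i < l -> (round y (block_start k + i)).2 = None
    & isSome (round y (block_start k + l)).2 = (l <= k)].
Proof.
move=> nwf; pose sep k i := isSome (round y (block_start k + i)).2.
have sepF k i : sep k i = false -> (round y (block_start k + i)).2 = None.
  by rewrite /sep; case: (round _ _).2.
pose ok k := [forall i : 'I_k.+2, sep k i == (k < i)].
have okP k : reflect (forall i, i <= k.+1 -> sep k i = (k < i)) (ok k).
  apply: (iffP forallP) => [H i le|H i]; first by have /eqP := H (Ordinal (le : i < k.+2)).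
  by apply/eqP/H; rewrite -ltnS.
have okE k : ok k -> (forall i, i <= k -> (round y (block_start k + i)).2 = None) /\
    isSome (round y (block_end k)).2.
  move=> /okP H; split=> [i le|]; last by have := H k.+1 (leqnn _); rewrite ltnSn.
  by apply: sepF; rewrite H ?(leqW le) // ltnNge le.
have ex : exists k, ~~ ok k.
  apply: Classical_Prop.NNPP => no; apply: nwf => k; apply: okE.
  by apply/negPn/negP => nok; apply: no; exists k.
case: (ex_minnP ex) => k nok min.
have exi : exists i, (i <= k.+1) && (sep k i != (k < i)).
  by move: nok; rewrite negb_forall => /existsP[i Hi]; exists i; rewrite Hi andbT -ltnS.
case: (ex_minnP exi) => l /andP[le ne] minl; exists k, l; split=> //.
- move=> k' lt; apply: okE; apply/negPn/negP => /min; lia.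
- move=> i lt; apply: sepF.
  have : ~~ ((i <= k.+1) && (sep k i != (k < i))) by apply/negP => /minl; lia.
  by rewrite (leq_trans (ltnW lt) le) /= negbK => /eqP ->; lia.
- by move: ne; rewrite -/(sep k l) ltnNge; case: (sep k l); case: (l <= k).
Qed.

Lemma ill_formed_live : ~ wf_blocks y -> live (config_step (M := M) y) (0, Init, 0).
Proof.
move=> /first_error[k [l [ok le zeros sepE]]].
(* Block 0 has no predecessor: its length 1 is checked from [Init] with the counter at 0. *)
case: k ok le zeros sepE => [|k] ok le zeros sepE.
  case: l le zeros sepE => [_ _|[_ zeros|//]] sepE.
    apply: (@live_error 1 0); apply: (reach_step1 (mv := CKeep)).
    by apply: as_init_error; exact: sepE.
  have [a Ea] := zero_roundE (zeros 0 isT).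
  have [b Eb] : exists b, round y 1 = (b, None).
    by apply: zero_roundE; move: sepE; rewrite addn1; case: (round y 1).2.
  apply: (@live_error 2 0); apply: (reach_step (mv := CKeep) (s' := CountDown)).
    by rewrite Ea; exact: as_init_down.
  by apply: (reach_step1 (mv := CKeep)); rewrite Eb; exact: as_down_long.
have [Hz Hs] := ok k (ltnSn k).
have [a Ea] : exists a, round y 0 = (a, None).
  by have [H _] := ok 0 isT; apply: zero_roundE; exact: (H 0 isT).
(* The predecessor of the faulty block is counted. If it is block 0, the counting starts in [Init],
   otherwise after the separator at which [Scan] is left. *)
have count : reach (0, Init, 0) (block_end k, CountUp, k.+1).
  case: k {le zeros sepE Hs} Hz ok => [|k] Hz ok.
    by apply: (reach_step1 (mv := CInc)); rewrite Ea; exact: as_init_up.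
  have [_ Hs] := ok k (ltnW (ltnSn _)).
  apply: (reach_step (mv := CKeep) (s' := Scan)); first by rewrite Ea; exact: as_init_scan.
  have := reach_scan 1 (block_end k).-1; have -> : 1 + (block_end k).-1 = block_end k.
    by rewrite add1n prednK // /block_end addnS.
  move=> p; apply: reach_trans p _; apply: (reach_step (mv := CKeep) (s' := CountUp)).
    exact: as_scan_up.
  rewrite -block_startS -[X in reach _ (_, _, X)]add0n; apply: reach_count_up => i lt.
  exact: Hz.
have {count} start : reach (0, Init, 0) (block_start k.+1, Separated, k.+1).
  apply: reach_trans count _; rewrite block_startS; apply: (reach_step1 (mv := CKeep)).
  exact: as_up_sep.
case: l le zeros sepE => [|l] le zeros sepE.
  apply: (@live_error (block_start k.+1).+1 k.+1); apply: reach_trans start _.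
  by apply: (reach_step1 (mv := CKeep)); apply: as_sep_error; rewrite addn0 in sepE; rewrite sepE.
have [b Eb] := zero_roundE (zeros 0 isT).
(* The first zero of the faulty block is not subtracted, since a block is longer by one than its
   predecessor. *)
have down : reach (0, Init, 0) (block_start k.+1 + l.+1, CountDown, k.+1 - l).
  apply: reach_trans start _; rewrite addn0 in Eb.
  apply: (reach_step (mv := CKeep) (s' := CountDown)); first by rewrite Eb; exact: as_sep_down.
  rewrite -addSnnS; apply: reach_count_down => // i lt.
  by rewrite addSnnS; apply: zeros.
apply: (@live_error (block_start k.+1 + l.+1).+1 (k.+1 - l)).
apply: reach_trans down _; apply: (reach_step1 (mv := CKeep)).
have -> : (k.+1 - l != 0) = (l.+1 <= k.+1) by lia.
rewrite -sepE; case Es : (isSome _); first by apply: as_down_short; rewrite Es.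
have [c ->] : exists c, round y (block_start k.+1 + l.+1) = (c, None).
  by apply: zero_roundE; move: Es; case: (round _ _).2.
exact: as_down_long.
Qed.

End IllFormed.

(** * Running the machine on well-formed plays *)

Section WellFormed.

Hypothesis Hwf : wf_blocks y.

Let w k := ~~ is_real (round y (block_end k)).

Lemma zeroE k l : l <= k -> exists a, round y (block_start k + l) = (a, None).
Proof. by move=> le; apply: zero_roundE; have [H _] := Hwf k; exact: H. Qed.

Lemma zero_nonreal k l : l <= k -> ~~ is_real (round y (block_start k + l)).
Proof. by move=> /zeroE[a ->]; rewrite /is_real andbF. Qed.

Lemma waitE k : w k -> exists b, round y (block_end k) = (None, Some b).
Proof.
rewrite /w /is_real; have [_] := Hwf k.
by case: (round _ _) => -[a|] [b|] //=; exists b.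
Qed.

Definition resting (s : K) : bool := match s with Ready | Pending _ => true | _ => false end.

Lemma reach_rest s n j k : resting s -> (forall i, j <= i < j + k -> ~~ is_real (round y i)) ->
  reach (j, s, n) (j + k, s, n).
Proof.
move=> rs; elim: k => [|k IH] H; first by rewrite addn0; exact: reach_refl.
rewrite addnS; apply: reach_trans (IH _) _ => [i lt|]; first by apply: H; lia.
apply: (reach_step1 (mv := CKeep)).
have nr : ~~ is_real (round y (j + k)) by apply: H; lia.
by case: s rs {IH} => //= [_|q _]; [exact: as_ready|exact: as_pending].
Qed.

Lemma reach_rest_block s n k : resting s -> reach (block_start k, s, n) (block_end k, s, n).
Proof.
move=> rs; apply: reach_rest => // i lt; rewrite -(subnKC (proj1 (andP lt))).
by apply: zero_nonreal; lia.
Qed.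

Lemma reach_wait s n k : resting s -> w k -> reach (block_start k, s, n) (block_start k.+1, s, n).
Proof.
move=> rs wk; apply: reach_trans (reach_rest_block _ _ rs) _.
rewrite block_startS -addn1; apply: reach_rest => // i lt.
by have -> : i = block_end k by lia.
Qed.

Lemma reach_waits s n k d : resting s -> (forall k', k <= k' < k + d -> w k') ->
  reach (block_start k, s, n) (block_start (k + d), s, n).
Proof.
move=> rs; elim: d => [|d IH] H; first by rewrite addn0; exact: reach_refl.
rewrite addnS; apply: reach_trans (IH _) _ => [i lt|]; first by apply: H; lia.
by apply: reach_wait => //; apply: H; lia.
Qed.

Section Fire.

Variables (t : m_trans M) (c c' : nat).
Hypotheses (ok : m_ok t) (u0 : 0 < m_mul t) (v0 : 0 < m_div t) (Hf : fires t c c').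

Lemma speed_bounds : m_mul t < B /\ m_div t < B.
Proof.
have : m_mul t + m_div t <= \max_(t : m_trans M) (m_mul t + m_div t).
  exact: (leq_bigmax (F := fun t : m_trans M => m_mul t + m_div t)).
by rewrite /speed_bound; lia.
Qed.

Let rest (i : nat) : 'I_B := inord i.

Lemma restE i : i <= m_mul t \/ i <= m_div t -> rest i = i :> nat.
Proof.
have [ltu ltv] := speed_bounds => le; rewrite inordK //.
by case: le => le; exact: leq_ltn_trans le _.
Qed.

Lemma reach_multiplying k l : l <= k.+1 -> exists s n,
  reach (block_start k, Multiplying t (rest 0), c) (block_start k + l, s, n) /\
  ((exists r, [/\ s = Multiplying t (rest r), r < m_mul t, m_mul t * c + r = l + m_mul t * n
      & 0 < r -> 0 < n]) \/ (s = Complementing t /\ m_mul t * c + n = l)).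
Proof.
elim: l => [_|l IH lt].
  exists (Multiplying t (rest 0)), c; rewrite addn0; split; first exact: reach_refl.
  by left; exists 0; split=> //; lia.
have [s [n [p H]]] := IH (ltnW lt); have [a Ea] := @zeroE k l lt.
have next s' mv : aut_step s (n != 0) (round y (block_start k + l)) s' mv ->
    reach (block_start k, Multiplying t (rest 0), c) (block_start k + l.+1, s', apply_cmove n mv).
  by move=> H'; apply: reach_trans p _; rewrite addnS; exact: reach_step1.
rewrite Ea in next; case: H next => [[r [-> ltr E Hr]]|[-> E]] next; last first.
  exists (Complementing t), n.+1; split; last by right; split=> //; lia.
  by apply: (next _ CInc); exact: as_compl.
have rE := @restE r (or_introl (ltnW ltr)).
case: n E Hr next {p} => [|n] E Hr next.
  exists (Complementing t), 1; split; last by right; split=> //; lia.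
  by apply: (next _ CInc); exact: as_mul_compl.
case: (ltngtP r.+1 (m_mul t)) ltr => // [lt' _|E' _].
  exists (Multiplying t (rest r.+1)), n.+1; split; last by left; exists r.+1; split=> //; lia.
  by apply: (next _ CKeep); apply: as_mul_keep; rewrite rE // restE //; left; exact: ltnW.
exists (Multiplying t (rest 0)), n; split; last by left; exists 0; split=> //; nia.
by apply: (next _ CDec); apply: as_mul_dec; rewrite ?rE // restE //; left.
Qed.

Lemma reach_restoring k : m_mul t * c <= k.+1 -> w k ->
  reach (block_start k, Multiplying t (rest 0), c) (block_start k.+1, Restoring t, k.+1 - m_mul t * c).
Proof.
move=> le wk; have [s [n [p H]]] := reach_multiplying (leqnn k.+1).
apply: reach_trans p _; rewrite block_startS; have [b Eb] := waitE wk.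
case: H => [[r [-> ltr E Hr]]|[-> E]].
  have n0 : n = 0 by nia.
  have -> : k.+1 - m_mul t * c = n by lia.
  by apply: (reach_step1 (mv := CKeep)); rewrite Eb n0; exact: as_mul_sep.
have -> : k.+1 - m_mul t * c = n by lia.
by apply: (reach_step1 (mv := CKeep)); rewrite Eb; exact: as_compl_sep.
Qed.

(** The counter [d] is the surplus of the previous block. One zero is skipped after it, because this
    block is longer by one, and [m] zeros are counted next. An inexact transition counts every zero
    and keeps the residue in the state. *)
Lemma reach_dividing k d m : d + m <= k ->
  exists r n, [/\ reach (block_start k, Restoring t, d)
                    (block_start k + (d + m).+1, Dividing t (rest r), n),
    r < m_div t & if m_exact t then m_div t * n + r = m else n = m /\ r = m %% m_div t].
Proof.
elim: m => [|m IH] le; last first.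
  have [|r [n [p ltr H]]] := IH; first lia.
  have [|a Ea] := @zeroE k (d + m).+1; first lia.
  have next s' mv : aut_step (Dividing t (rest r)) (n != 0) (a, None) s' mv ->
      reach (block_start k, Restoring t, d) (block_start k + (d + m.+1).+1, s', apply_cmove n mv).
    move=> H'; apply: reach_trans p _.
    have -> : block_start k + (d + m.+1).+1 = (block_start k + (d + m).+1).+1 by lia.
    by apply: reach_step1; rewrite Ea.
  have rE := @restE r (or_intror (ltnW ltr)).
  case: (ltngtP r.+1 (m_div t)) ltr => // [lt' _|E' _].
    exists r.+1, (if m_exact t then n else n.+1); split=> //.
      have := next (Dividing t (rest r.+1)) (if m_exact t then CKeep else CInc).
      have -> : apply_cmove n (if m_exact t then CKeep else CInc) = if m_exact t then n else n.+1.
        by case: (m_exact t).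
      by apply; apply: as_div_keep; rewrite rE // restE //; right; exact: ltnW.
    case: (m_exact t) H => [|[-> Er]]; first lia.
    by split=> //; rewrite -[m.+1]addn1 -modnDml -Er addn1 modn_small.
  exists 0, n.+1; split=> //.
    by apply: (next _ CInc); apply: as_div_inc; rewrite ?rE // restE //; right.
  case: (m_exact t) H => [|[-> Er]]; first nia.
  by split=> //; rewrite -[m.+1]addn1 -modnDml -Er addn1 E' modnn.
exists 0, 0; split=> //; last by rewrite muln0 mod0n; case: (m_exact t).
rewrite addn0 in le *.
have restore i : i <= d -> reach (block_start k, Restoring t, d) (block_start k + i, Restoring t, d - i).
  elim: i => [|i IH] lei; first by rewrite addn0 subn0; exact: reach_refl.
  apply: reach_trans (IH (ltnW lei)) _; rewrite addnS subnS.
  apply: (reach_step1 (mv := CDec)).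
  have [|a ->] := @zeroE k i; first lia.
  have -> : d - i != 0 by lia.
  exact: as_restore.
apply: reach_trans (restore d (leqnn d)) _; rewrite subnn addnS.
apply: (reach_step1 (mv := CKeep)); have [a ->] := zeroE le.
by apply: as_restore_skip; rewrite restE //; left.
Qed.

(** Block [k] is only rested through; block [k.+1], with its [k.+2] zeros, must hold the product,
    and block [k.+2] divides or tests. Each of the three separators has to be a wait. *)
Lemma reach_fire k : m_mul t * c <= k.+2 -> w k -> w k.+1 -> w k.+2 ->
  reach (block_start k, Pending (m_src t), c) (block_start (k + 3), Pending (m_dst t), c').
Proof.
move=> le w0 w1 w2; rewrite addn3.
apply: reach_trans (reach_rest_block (s := Pending (m_src t)) c k isT) _.
have [b Eb] := waitE w0.
apply: (reach_step (mv := CKeep) (s' := Multiplying t (rest 0))).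
  by rewrite Eb; apply: as_start; rewrite ?restE //; left.
rewrite -block_startS; apply: reach_trans (reach_restoring le w1) _.
have [|r [n [p ltr H]]] := @reach_dividing k.+2 (k.+2 - m_mul t * c) (m_mul t * c).
  by rewrite subnK.
apply: reach_trans p _; rewrite subnK // -/(block_end k.+2) block_startS.
have [b2 Eb2] := waitE w2.
have rE := @restE r (or_intror (ltnW ltr)).
have [-> rz] : c' = n /\ (r == 0) = m_exact t.
  move: Hf H; rewrite /fires; case: (m_exact t) => [E1 E2|[-> nd] [-> ->]].
    rewrite E1 in E2; have En : c' = n.
      by rewrite -(mulKn c' v0) -E2 mulnC divnMDl // (divn_small ltr) addn0.
    by split=> //; apply/eqP; rewrite En in E2; lia.
  by split=> //; apply/negbTE.
by apply: (reach_step1 (mv := CKeep)); rewrite Eb2; apply: as_div_sep; rewrite rE.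
Qed.

End Fire.

End WellFormed.

End Completeness.

(** * Waiting times *)

Lemma live_path (S : Type) (step : S -> bool -> S -> Prop) s m s' :
  path step s m s' -> live step s' -> live step s.
Proof.
move=> p [u [u0 Hu]]; exists (fun i => if i is _.+1 then u i else s); split=> // -[|i] //.
by rewrite -(orbT m); apply: path_cat p _; rewrite -u0.
Qed.

Lemma leq_block_starts k k' : k <= k' -> block_start k <= block_start k'.
Proof.
by move=> /subnKC <-; elim: (k' - k) => [|d IH]; rewrite ?addn0 // addnS block_startS /block_end; lia.
Qed.

Section RoundsBetweenReals.

Variables (X : finType) (y : nat -> option X).

Lemma reals_const j d : (forall i, j <= i < j + d -> ~~ is_real (round y i)) ->
  reals y (j + d) = reals y j.
Proof.
elim: d => [|d IH] H; first by rewrite addn0.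
rewrite addnS reals_nonreal ?IH // => [i Hi|]; apply: H; lia.
Qed.

Lemma next_real j : (exists j', size (reals y j) < size (reals y j')) ->
  exists j1, [/\ j <= j1, is_real (round y j1) & forall i, j <= i < j1 -> ~~ is_real (round y i)].
Proof.
move=> [j' lt].
have ex : exists j1, (j <= j1) && is_real (round y j1).
  apply: Classical_Prop.NNPP => no; have H i : j <= i -> ~~ is_real (round y i).
    by move=> le; apply/negP => r; apply: no; exists i; rewrite le.
  case: (leqP j j') => [/subnKC E|/ltnW /subnKC E].
    by move: lt; rewrite -E reals_const ?ltnn // => i /andP[/H].
  have mono d : size (reals y j') <= size (reals y (j' + d)).
    elim: d => [|d IH]; first by rewrite addn0.
    rewrite addnS; apply: leq_trans IH _; rewrite realsS.
    by case: (round _ _) => -[a|] [b|]; rewrite ?size_rcons.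
  by have := mono (j - j'); rewrite E; lia.
case: (ex_minnP ex) => j1 /andP[le r] min; exists j1; split=> // i /andP[le1 lt1].
by apply/negP => ri; move: (min i); rewrite le1 ri => /(_ isT); lia.
Qed.

Hypothesis Hwf : wf_blocks y.

Lemma real_block_end j : is_real (round y j) -> exists k, j = block_end k.
Proof.
have [k [l [-> le]]] := block_ex j; move: le; rewrite leq_eqVlt ltnS.
by case/orP=> [/eqP-> _|/(zero_nonreal Hwf) /negP //]; exists k.
Qed.

Lemma waits_nonreal k d : (forall k', k <= k' < k + d -> ~~ is_real (round y (block_end k'))) ->
  forall i, block_start k <= i <= block_end (k + d) -> i <> block_end (k + d) ->
  ~~ is_real (round y i).
Proof.
move=> H i Hi ne; apply/negP => ri; have [k' E] := real_block_end ri; subst i.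
have le : k <= k'.
  rewrite leqNgt; apply/negP => lt; have := leq_block_starts lt; rewrite block_startS; lia.
have lt : k' < k + d.
  case: (ltngtP k' (k + d)) => // [gt|E]; last by rewrite E in ne.
  have := leq_block_starts gt; rewrite block_startS {2}/block_end in Hi *; lia.
by have := H k'; rewrite le lt ri => /(_ isT).
Qed.

End RoundsBetweenReals.

Section WaitingTime.

Variables (X : finType) (M : machine (phase_event X)).
Variables (enc : nat -> nat) (f : phase_event X -> nat -> nat) (g : nat -> bool).
Hypothesis HM : realizes M enc f g.

(** Uniform in the play and in the starting block, so that the wait can be fixed from the pairs
    alone. *)
Definition enough (s s' : m_state M * nat) (W : nat) : Prop :=
  forall y, wf_blocks y -> forall k,
    (forall k', k <= k' < k + W -> ~~ is_real (round y (block_end k'))) ->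
    reach (M := M) y (block_start k, Pending s.1, s.2) (block_start (k + W), Pending s'.1, s'.2).

Lemma enough_leq s s' W W' : W <= W' -> enough s s' W -> enough s s' W'.
Proof.
move=> /subnKC <- H y wf k Hw; apply: reach_trans (H y wf k _) _ => [k' Hk|].
  by apply: Hw; lia.
by rewrite addnA; apply: reach_waits => // k' Hk; apply: Hw; lia.
Qed.

Lemma enough_star s s' : star (@mstep _ M) s s' -> exists W, enough s s' W.
Proof.
have [pos _ _ _] := HM.
elim=> {s s'} [s|[q c] [q' c'] s'' [t [/= ok <- <- Hf]] _ [W IH]].
  by exists 0 => y wf k _; rewrite addn0; exact: reach_refl.
have [u0 v0] := pos t ok.
(* After [m_mul t * c] blocks of rest the blocks are long enough for the product; firing takes three
   more. *)
exists (m_mul t * c + 3 + W) => y wf k Hw.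
apply: reach_trans (reach_waits (s := Pending (m_src t)) (d := m_mul t * c) wf c isT _) _ => [k' Hk|].
  by apply: Hw; lia.
apply: reach_trans (reach_fire wf ok u0 v0 Hf _ _ _ _) _; [lia| | | |].
- by apply: Hw; lia.
- by apply: Hw; lia.
- by apply: Hw; lia.
by rewrite !addnA; apply: IH => // k' Hk; apply: Hw; lia.
Qed.

(** All numbers that some sequence of guesses can produce. The guess used by an accepting run is
    unknown when the wait has to be chosen, but the list is finite. *)
Definition phase_values (h : seq (X * X)) : seq nat :=
  foldl (fun l ab => [seq f (ab, e) z | z <- l, e <- enum {: bool * bool}]) [:: 0] h.

Definition waiting_time (W : nat) (h : seq (X * X)) : Prop :=
  forall h' ab e z, h = rcons h' ab -> z \in phase_values h' ->
  exists q, m_exit q = Some (g z) /\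
    enough (m_start M (ab, e), enc z) (q, enc (f (ab, e) z)) W.

Lemma uniform_bound (T : eqType) (l : seq T) (P : T -> nat -> Prop) :
  (forall t n n', n <= n' -> P t n -> P t n') -> (forall t, exists n, P t n) ->
  exists n, forall t, t \in l -> P t n.
Proof.
move=> mono ex; elim: l => [|t l [n IH]]; first by exists 0.
have [n' Ht] := ex t; exists (maxn n n') => u; rewrite inE => /orP[/eqP->|/IH].
  by apply: mono Ht; exact: leq_maxr.
by apply: mono; exact: leq_maxl.
Qed.

Lemma waiting_time_exists : exists W, forall h, waiting_time (W h) h.
Proof.
apply: (@choice_ex _ _ (fun h W => waiting_time W h)) => h.
case: (lastP h) => [|h' ab]; first by exists 0 => h' ab e z; case: h'.
have [_ _ _ spec] := HM.
pose P (ze : nat * (bool * bool)) W := exists q, m_exit q = Some (g ze.1) /\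
  enough (m_start M (ab, ze.2), enc ze.1) (q, enc (f (ab, ze.2) ze.1)) W.
have [||W HW] := @uniform_bound _ [seq (z, e) | z <- phase_values h', e <- enum {: bool * bool}] P.
- by move=> ze n n' le [q [Eq H]]; exists q; split=> //; exact: enough_leq H.
- move=> [z e]; have [q [Eq /enough_star[W H]]] := spec (ab, e) z.
  by exists W, q.
exists W => h1 ab1 e z /rcons_inj[<- <-] Hz; apply: (HW (z, e)).
by apply: allpairs_f => //; rewrite mem_enum.
Qed.

Section Accepted.

Variables (W : seq (X * X) -> nat) (y : nat -> option X) (ab : nat -> X * X).
Hypothesis enc0 : enc 0 = 1.
Hypothesis HW : forall h, waiting_time (W h) h.
Hypothesis Hwf : wf_blocks y.
Hypothesis Hab : forall j a b, round y j = (Some a, Some b) -> ab (size (reals y j)) = (a, b).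
Hypothesis Hinf : forall i, exists j, i < size (reals y j).
Hypothesis Hgap : forall k, is_real (round y (block_end k)) ->
  forall k', k < k' <= k + W (reals y (block_end k).+1) -> ~~ is_real (round y (block_end k')).

Lemma phases_live_aut : live (phase_step f g ab) (0, 0) ->
  live (config_step (M := M) y) (0, Init, 0).
Proof.
(* Only configurations that await the next pair are related; one phase is answered by the whole
   stretch up to the next such configuration. *)
pose R (p : nat * nat) (x : nat * aut_state (m_state M) (m_trans M) (speed_bound M) * nat) :=
  exists j, [/\ x = (j, Ready, enc p.2), size (reals y j) = p.1 & p.2 \in phase_values (reals y j)].
have start : reach (M := M) y (0, Init, 0) (1, Ready, 1).
  apply: (reach_step1 (mv := CInc)); have [a ->] := zeroE Hwf (leqnn 0).
  exact: as_init_ready.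
have [m0 p0] := start => H; apply: live_path p0 _.
apply: (live_simulation (R := R)) H; last first.
  exists 1; rewrite enc0.
  have -> : reals y 1 = [::] by apply: (reals_nonreal (zero_nonreal Hwf (leqnn 0))).
  by split=> //; rewrite mem_seq1.
move=> {m0 start} [i z] x m [i' z'] [j [-> /= Hi Hz]] [/= -> -> [e ->]].
have [|j1 [le1 real1 nr1]] := @next_real _ y j; first by rewrite Hi.
have [k Ek] := real_block_end Hwf real1; subst j1.
have Er : reals y (block_end k) = reals y j.
  by rewrite -(subnKC le1); apply: reals_const => i0 Hi0; apply: nr1; lia.
have [a [b Eab]] : exists a b, round y (block_end k) = (Some a, Some b).
  by move: real1; rewrite /is_real; case: (round _ _) => -[a|] [b|] //; exists a, b.
have Ei : ab i = (a, b) by rewrite -Hi -Er (Hab Eab).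
set h := reals y (block_end k).+1.
have Eh : h = rcons (reals y j) (a, b) by rewrite /h realsS Eab Er.
have [q [Eq Hq]] := @HW h _ _ e _ Eh Hz.
have gap k' : k.+1 <= k' < k.+1 + W h -> ~~ is_real (round y (block_end k')).
  by move=> Hk; apply: (Hgap real1); rewrite -/h; lia.
set k2 := k.+1 + W h in gap *.
have Hnr := waits_nonreal Hwf gap; rewrite -/k2 in Hnr.
have rd d : d <= k2.+1 -> reals y (block_start k2 + d) = h.
  move=> le; rewrite /h -block_startS.
  have le2 : block_start k.+1 <= block_start k2 by apply: leq_block_starts; rewrite leq_addr.
  rewrite -(subnKC (leq_trans le2 (leq_addr d _))); apply: reals_const => i0 Hi0.
  by apply: Hnr; rewrite /block_end; lia.
have [m1 p1] : reach (M := M) y (j, Ready, enc z) (block_start k2, Pending q, enc (f (ab i, e) z)).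
  apply: (reach_trans (x2 := (block_end k, Ready, enc z))).
    by rewrite -(subnKC le1); apply: reach_rest => // i0 Hi0; apply: nr1; lia.
  apply: (reach_step (mv := CKeep) (s' := Pending (m_start M ((a, b), e)))).
    by rewrite Eab; exact: as_read.
  by rewrite Ei -block_startS; exact: (Hq y Hwf k.+1).
have zin : f (ab i, e) z \in phase_values h.
  rewrite Eh /phase_values foldl_rcons -/(phase_values _) Ei.
  by apply: allpairs_f => //; rewrite mem_enum.
(* Returning through [Flagged] takes two rounds; since [k2] is positive, block [k2] begins with two
   zeros. *)
have nr0 : ~~ is_real (round y (block_start k2)) by rewrite -[block_start k2]addn0; exact: zero_nonreal.
have nr1' : ~~ is_real (round y (block_start k2).+1) by rewrite -addn1; exact: zero_nonreal.
have exit : aut_step (M := M) (Pending q) (enc (f (ab i, e) z) != 0) (round y (block_start k2))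
    (if g z then Flagged else Ready) CKeep by exact: as_exit.
have p2 := path_cat p1 (path1 (config_step_intro exit)).
case: (boolP (g z)) => gz; rewrite ?gz ?(negbTE gz) in exit p2.
  have p3 := path_cat p2 (path1 (config_step_intro (as_flagged M (enc (f (ab i, e) z) != 0) nr1'))).
  exists ((block_start k2).+2, Ready, enc (f (ab i, e) z)), true; split=> //.
    by move: p3; rewrite orbT.
  exists (block_start k2).+2; rewrite -[in reals _ _]addn2 rd //.
  by split=> //; rewrite Eh size_rcons Hi.
exists ((block_start k2).+1, Ready, enc (f (ab i, e) z)), (m1 || false); split=> //.
exists (block_start k2).+1; rewrite -[in reals _ _]addn1 rd //.
by split=> //; rewrite Eh size_rcons Hi.
Qed.

End Accepted.

End WaitingTime.

(** * Coding an effective analytic set *)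

(** If only finitely many pairs are played, the remaining letters are free, so every play decodes to
    some sequence. *)
Definition decodes (X : Type) (y : nat -> option X) (sigma : nat -> X) : Prop :=
  forall j a b, round y j = (Some a, Some b) ->
    letter_pairs sigma (size (reals y j)) = (a, b).

Definition patient (X : Type) (W : seq (X * X) -> nat) (y : nat -> option X) : Prop :=
  forall k, is_real (round y (block_end k)) ->
    forall k', k < k' <= k + W (reals y (block_end k).+1) -> ~~ is_real (round y (block_end k')).

(** All that the transfer of strategies needs to know about [B]. Patience occurs in the last clause
    only: haste can make the automaton miss a good play, never accept a bad one. *)
Theorem block_coding (X : finType) (A : (nat -> X) -> Prop) : Sigma11 A ->
  exists (B : (nat -> option X) -> Prop) (W : seq (X * X) -> nat),
    [/\ BCL 1 B,
        forall y, ~ wf_blocks y -> B y,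
        forall y sigma, wf_blocks y -> decodes y sigma -> B y ->
          (forall i, exists j, i < size (reals y j)) /\ A sigma
      & forall y sigma, wf_blocks y -> decodes y sigma -> patient W y ->
          (forall i, exists j, i < size (reals y j)) -> A sigma -> B y].
Proof.
move=> /Sigma11_normal_form[f [g [Hf Hg HA]]].
have [M [enc [enc0 HM]]] := machine_exists Hf Hg.
have [W HW] := waiting_time_exists HM.
pose F := @accepting X M.
have BP y : ca_accepts (aut_of_rounds (@aut_step X M) Init F) y <->
    live (config_step (M := M) y) (0, Init, 0).
  by rewrite aut_of_roundsP; exact: round_accepts_live.
exists (fun y => ca_accepts (aut_of_rounds (@aut_step X M) Init F) y), W; split.
- by exists (aut_of_rounds (@aut_step X M) Init F).
- by move=> y nwf; apply/BP; exact: ill_formed_live.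
- move=> y sigma wf dec /BP/(live_aut_phases enc0 HM wf dec)/live_real_phases[H inf].
  by split=> //; apply/HA.
- move=> y sigma wf dec pat inf /HA H; apply/BP.
  exact: (phases_live_aut enc0 HW wf dec inf pat H).
Qed.

Lemma size_reals_leq (X : Type) (y : nat -> option X) j j' : j <= j' ->
  size (reals y j) <= size (reals y j').
Proof.
move=> /subnKC <-; elim: (j' - j) => [|d IH]; first by rewrite addn0.
rewrite addnS realsS; apply: leq_trans IH _.
by case: (round _ _) => -[a|] [b|]; rewrite ?size_rcons.
Qed.

Lemma real_index_inj (X : Type) (y : nat -> option X) j j' :
  is_real (round y j) -> is_real (round y j') ->
  size (reals y j) = size (reals y j') -> j = j'.
Proof.
have H i i' : i < i' -> is_real (round y i) -> size (reals y i) < size (reals y i').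
  move=> lt r; apply: leq_trans (size_reals_leq y lt); rewrite realsS.
  by move: r; rewrite /is_real; case: (round _ _) => -[a|] [b|] //; rewrite size_rcons.
by move=> r r' E; case: (ltngtP j j') => // lt; [have := H _ _ lt r|have := H _ _ lt r']; rewrite E ltnn.
Qed.

Lemma decodes_ex (X : Type) (x0 : X) (y : nat -> option X) : exists sigma, decodes y sigma.
Proof.
have H i : exists p : X * X, forall j a b,
    round y j = (Some a, Some b) -> size (reals y j) = i -> p = (a, b).
  case: (Classical_Prop.classic (exists j, is_real (round y j) /\ size (reals y j) = i)).
    move=> [j [r E]].
    have [a [b Eab]] : exists a b, round y j = (Some a, Some b).
      by move: r; rewrite /is_real; case: (round _ _) => -[a|] [b|] //; exists a, b.
    exists (a, b) => j' a' b' E' Ei.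
    have r' : is_real (round y j') by rewrite /is_real E'.
    have Ej : j = j' by apply: real_index_inj r r' _; rewrite E Ei.
    by rewrite -Ej Eab in E'; case: E' => -> ->.
  move=> no; exists (x0, x0) => j a b E Ei; case: no; exists j.
  by rewrite /is_real E.
have [p Hp] := choice_ex H.
exists (fun n => if odd n then (p n./2).2 else (p n./2).1) => j a b E.
rewrite /letter_pairs /= odd_double /= uphalf_double doubleK.
by rewrite (Hp _ j a b E erefl).
Qed.

(** * Plays of the block game generated from the letters of one player *)

Section Plays.

Variables (X : Type) (gen : seq (option X * option X) -> X -> option X * option X).

Definition real_of (r : option X * option X) : option (X * X) :=
  if r is (Some a, Some b) then Some (a, b) else None.

(** [c] lists the letters, in the simulated game, of the opponent of the strategy sought; letter
    number i is on offer in every round until pair number i is played. *)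
Fixpoint rounds (c : nat -> X) (j : nat) : seq (option X * option X) :=
  if j is i.+1 then
    rcons (rounds c i) (gen (rounds c i) (c (size (pmap real_of (rounds c i)))))
  else [::].

Definition play (c : nat -> X) (n : nat) : option X :=
  let h := rounds c n./2 in
  let r := gen h (c (size (pmap real_of h))) in
  if odd n then r.2 else r.1.

Definition flat (h : seq (option X * option X)) : seq (option X) :=
  flatten [seq [:: r.1; r.2] | r <- h].

Lemma reals_play c j : reals (play c) j = pmap real_of (rounds c j).
Proof.
elim: j => // j IH; rewrite realsS IH /round /play /= odd_double /= uphalf_double doubleK.
rewrite -cats1 pmap_cat /=; case: (gen _ _) => -[a|] [b|] /=; rewrite ?cats0 ?cats1 //.
Qed.

Lemma round_play c j : round (play c) j = gen (rounds c j) (c (size (reals (play c) j))).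
Proof.
rewrite reals_play /round /play /= odd_double /= uphalf_double doubleK.
by case: (gen _ _).
Qed.

Lemma prefix_play c j : prefix (play c) j.*2 = flat (rounds c j).
Proof.
elim: j => // j IH; rewrite doubleS !prefixS IH /flat /= map_rcons flatten_rcons -cats1.
by rewrite /play /= odd_double /= uphalf_double doubleK -cats1 -catA.
Qed.

Lemma prefix_play_odd c j :
  prefix (play c) j.*2.+1 = rcons (flat (rounds c j)) (round (play c) j).1.
Proof. by rewrite prefixS prefix_play. Qed.

Lemma size_rounds c j : size (rounds c j) = j.
Proof. by elim: j => //= j IH; rewrite size_rcons IH. Qed.

End Plays.

Definition odd_letters (X : Type) (x : nat -> X) (k : nat) : X := x k.*2.+1.
Definition even_letters (X : Type) (x : nat -> X) (k : nat) : X := x k.*2.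

Lemma letter_pairs_inj (X : Type) (x x' : nat -> X) :
  (forall i, letter_pairs x i = letter_pairs x' i) -> x = x'.
Proof.
move=> H; apply: functional_extensionality => n; rewrite -(odd_double_half n).
by case: (odd n); have [] := H n./2; rewrite ?add0n ?add1n.
Qed.

Lemma real_round_ex (X : Type) (y : nat -> option X) i : (exists j, i < size (reals y j)) ->
  exists j a b, size (reals y j) = i /\ round y j = (Some a, Some b).
Proof.
move=> ex; case: (ex_minnP ex) => -[//|j] lt min; exists j.
have le : size (reals y j) <= i by rewrite leqNgt; apply/negP => /min; rewrite ltnn.
move: lt; rewrite realsS; case: (round y j) => -[a|] [b|]; try lia.
by rewrite size_rcons => lt; exists a, b; split=> //; lia.
Qed.

(** * Transfer of strategies *)

Definition outcome (X : Type) (x0 : X) (y : nat -> option X) : nat -> X :=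
  sval (constructive_indefinite_description _ (decodes_ex x0 y)).

Lemma outcomeP (X : Type) (x0 : X) y : decodes y (outcome x0 y).
Proof. exact: (proj2_sig (constructive_indefinite_description _ (decodes_ex x0 y))). Qed.

Definition block_end_round (j : nat) : bool := [exists k : 'I_j.+1, j == block_end k].

Lemma block_end_roundE j : block_end_round j <-> exists k, j = block_end k.
Proof.
split=> [/existsP[k /eqP->]|[k E]]; first by exists k.
have lt : k < j.+1 by rewrite E /block_end; lia.
by apply/existsP; exists (Ordinal lt); apply/eqP.
Qed.

Lemma wf_blocksP (X : Type) (y : nat -> option X) :
  (forall j, isSome (round y j).2 = block_end_round j) -> wf_blocks y.
Proof.
move=> H k; split=> [l le|]; last by rewrite H; apply/block_end_roundE; exists k.
have : isSome (round y (block_start k + l)).2 = false.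
  rewrite H; apply/negbTE/negP => /block_end_roundE[k' E].
  case: (ltngtP k k') => [lt|lt|Ek].
  - by have := leq_block_starts lt; rewrite block_startS; rewrite /block_end in E *; lia.
  - by have := leq_block_starts lt; rewrite block_startS; rewrite /block_end in E *; lia.
  - by rewrite Ek /block_end in E; lia.
by case: (round _ _).2.
Qed.

(** * From winning strategies of Player 1 in the block game *)

Section FirstPlayer.

Variables (X : Type) (x0 : X) (S : strategy (option X)).

(* At a waiting round the answer is the fixed letter [x0], so that the play
   depends on [c] only through the real rounds. *)
Definition block_writer (h : seq (option X * option X)) (c : X) : option X * option X :=
  let q := S (flat h) in
  (q, if block_end_round (size h) then Some (if q is Some _ then c else x0) else None).

Lemma block_writer_round c j : round (play block_writer c) j =
  block_writer (rounds block_writer c j) (c (size (reals (play block_writer c) j))).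
Proof. exact: round_play. Qed.

Lemma block_writer_wf c : wf_blocks (play block_writer c).
Proof.
apply: wf_blocksP => j; rewrite block_writer_round /block_writer /= size_rounds.
by case: (block_end_round j).
Qed.

Lemma block_writer_consistent c : consistent1 S (play block_writer c).
Proof.
move=> n; rewrite prefix_play.
by have /(f_equal fst) := block_writer_round c n.
Qed.

(** Up to the round of pair number n only earlier letters of Player 2 are used, so what Player 1
    writes there is a legitimate move of a strategy. *)
Lemma block_writer_causal c c' n : (forall i, i < n -> c i = c' i) ->
  forall j, size (reals (play block_writer c) j) <= n ->
  rounds block_writer c j = rounds block_writer c' j.
Proof.
move=> Hc; elim=> // j IH le /=.
have le' : size (reals (play block_writer c) j) <= n.
  by apply: leq_trans le; exact: size_reals_leq.
rewrite -(IH le') -!reals_play; congr rcons.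
move: le'; rewrite leq_eqVlt => /orP[/eqP En|/Hc -> //].
(* With n pairs already present a real round would exceed the bound, and in any other round the
   letter of [c] is not written. *)
move: le; rewrite realsS block_writer_round /block_writer.
case: (S _) => [a|] //; case: (block_end_round _) => //.
by rewrite size_rcons En ltnn.
Qed.

(** Padding written correctly makes every play against [S] well-formed, so soundness gives
    infinitely many pairs and an outcome in [A]. The new strategy reads its letter off such a
    play. *)
Lemma first_player_transfer (A B : _ -> Prop) :
  winning1 B S ->
  (forall y sigma, wf_blocks y -> decodes y sigma -> B y ->
     (forall i, exists j, i < size (reals y j)) /\ A sigma) ->
  exists s, winning1 A s.
Proof.
move=> HS HB; pose Y c := play block_writer c.
have win c : (forall i, exists j, i < size (reals (Y c) j)) /\ A (outcome x0 (Y c)).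
  apply: HB; [exact: block_writer_wf|exact: outcomeP|].
  by apply: HS; exact: block_writer_consistent.
have pairs c i : exists j, [/\ size (reals (Y c) j) = i,
    S (flat (rounds block_writer c j)) = Some (outcome x0 (Y c) i.*2), block_end_round j
    & outcome x0 (Y c) i.*2.+1 = c i].
  have [j [a [b [Ei Er]]]] := real_round_ex ((win c).1 i); exists j.
  have := @outcomeP _ x0 (Y c) j a b Er; rewrite Ei => -[-> ->].
  move: Er; rewrite block_writer_round Ei /block_writer size_rounds.
  by case: (S _) => [a'|] [Ea]; case: (block_end_round j) => // -[->]; rewrite ?Ea.
have causal c c' i : (forall k, k < i -> c k = c' k) ->
    outcome x0 (Y c) i.*2 = outcome x0 (Y c') i.*2.
  move=> Hc; have [j [Ei Es Eb _]] := pairs c i.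
  have E := block_writer_causal Hc (eq_leq Ei).
  have Er : round (Y c') j = (Some (outcome x0 (Y c) i.*2), Some (c' i)).
    rewrite block_writer_round /block_writer size_rounds -E Es Eb !reals_play.
    by rewrite -E -reals_play Ei.
  have := @outcomeP _ x0 (Y c') j _ _ Er.
  by rewrite reals_play -E -reals_play Ei => -[].
(* At a turn of Player 1, [size h] is the position of the wanted letter. The letters of Player 2 are
   those at odd positions; [x0] replaces the ones not yet played, which is harmless by [causal]. *)
exists (fun h => outcome x0 (Y (fun k => nth x0 h k.*2.+1)) (size h)) => x Hx.
suff -> : x = outcome x0 (Y (odd_letters x)) by have [] := win (odd_letters x).
apply: letter_pairs_inj => i; congr (_, _).
  rewrite Hx size_mkseq; apply: causal => k lt.
  by rewrite nth_mkseq //; lia.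
by have [j [_ _ _ ->]] := pairs (odd_letters x) i.
Qed.

End FirstPlayer.

(** * From winning strategies of Player 2 in the block game *)

Section SecondPlayer.

Variables (X : Type) (x0 : X) (S : strategy (option X)) (W : seq (X * X) -> nat).

Definition count_waits (n : nat) (r : option X * option X) : nat :=
  match r with (Some _, Some _) => 0 | (None, Some _) => n.+1 | (_, None) => n end.

(* The waiting time leaves the automaton enough blocks to process the pair of
   letters just played. *)
Definition waiter (h : seq (option X * option X)) (c : X) : option X * option X :=
  let q := if W (pmap (@real_of X) h) <= foldl count_waits 0 h then Some c else None in
  (q, S (rcons (flat h) q)).

Definition waits (c : nat -> X) (j : nat) : nat := foldl count_waits 0 (rounds waiter c j).

Lemma waiter_round c j : round (play waiter c) j =
  waiter (rounds waiter c j) (c (size (reals (play waiter c) j))).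
Proof. exact: round_play. Qed.

Lemma waitsS c j : waits c j.+1 = count_waits (waits c j) (round (play waiter c) j).
Proof. by rewrite waiter_round reals_play /waits; exact: foldl_rcons. Qed.

Lemma waiter_first c j : (round (play waiter c) j).1 =
  if W (reals (play waiter c) j) <= waits c j
  then Some (c (size (reals (play waiter c) j))) else None.
Proof. by rewrite waiter_round /waiter /= reals_play. Qed.

Lemma waiter_consistent c : consistent2 S (play waiter c).
Proof.
move=> n; rewrite prefix_play_odd waiter_round /waiter /=.
by have /(f_equal snd) := waiter_round c n.
Qed.

(** In contrast to [block_writer_causal], letter n itself is included: Player 2 answers it within
    the same round. *)
Lemma waiter_causal c c' n : (forall i, i <= n -> c i = c' i) ->
  forall j, size (reals (play waiter c) j) <= n ->
  rounds waiter c j = rounds waiter c' j /\ round (play waiter c) j = round (play waiter c') j.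
Proof.
move=> Hc j le.
have E : rounds waiter c j = rounds waiter c' j.
  elim: j le => // j IH le /=.
  have le' : size (reals (play waiter c) j) <= n.
    by apply: leq_trans le; exact: size_reals_leq.
  by rewrite -(IH le') -reals_play Hc.
split=> //; rewrite !waiter_round !reals_play -E.
by rewrite -reals_play Hc.
Qed.

Section WellFormedPlay.

Variable c : nat -> X.
Let y := play waiter c.
Hypothesis Hwf : wf_blocks y.

Lemma waits_in_block k l : l <= k.+1 ->
  waits c (block_start k + l) = waits c (block_start k) /\
  reals y (block_start k + l) = reals y (block_start k).
Proof.
elim: l => [|l IH] le; first by rewrite addn0.
have [H _] := Hwf k; have E0 := H l le; have [E1 E2] := IH (ltnW le).
rewrite addnS waitsS realsS -/y.
by case: (round y _) E0 => -[a|] b /= ->.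
Qed.

Lemma waits_after_block k : ~~ is_real (round y (block_end k)) ->
  waits c (block_start k.+1) = (waits c (block_start k)).+1 /\
  reals y (block_start k.+1) = reals y (block_start k).
Proof.
move=> nr; have [E1 E2] := waits_in_block (leqnn k.+1).
have [_] := Hwf k; rewrite block_startS waitsS realsS -/y; move: nr; rewrite -E1 -E2.
by rewrite /is_real; case: (round y _) => -[a|] [b|].
Qed.

Lemma patient_play : patient W y.
Proof.
move=> k rk; set h := reals y _.
have w0 : waits c (block_start k.+1) = 0.
  by rewrite block_startS waitsS -/y; move: rk; rewrite /is_real; case: (round y _) => -[a|] [b|].
have nonreal d : d < W h -> waits c (block_start (k.+1 + d)) = d ->
    reals y (block_start (k.+1 + d)) = h -> ~~ is_real (round y (block_end (k.+1 + d))).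
  move=> lt Ew Er; rewrite /is_real waiter_first -/y.
  have [E1 E2] := waits_in_block (leqnn (k.+1 + d).+1).
  by rewrite /block_end E1 E2 Ew Er leqNgt lt.
have inv d : d <= W h -> waits c (block_start (k.+1 + d)) = d /\
    reals y (block_start (k.+1 + d)) = h.
  elim: d => [|d IH] lt; first by rewrite addn0 w0 /h block_startS.
  have [Ew Er] := IH (ltnW lt); have nr := nonreal d lt Ew Er.
  by have [E1 E2] := waits_after_block nr; rewrite addnS E1 E2 Ew Er.
move=> k' /andP[lt le]; rewrite -(subnKC lt).
have ltW : k' - k.+1 < W h by lia.
by have [Ew Er] := inv _ (ltnW ltW); exact: nonreal.
Qed.

(** If pairs stopped, the waiting time would be frozen while the number of waits grows with every
    block; at some separator Player 1 would stop waiting, which makes the round real. *)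
Lemma infinitely_many_reals i : exists j, i < size (reals y j).
Proof.
suff H j : exists j', size (reals y j) < size (reals y j').
  elim: i => [|i [j lt]]; first by have [j' lt] := H 0; exists j'; lia.
  by have [j' lt'] := H j; exists j'; lia.
apply: Classical_Prop.NNPP => no.
have nr i' : j <= i' -> ~~ is_real (round y i').
  move=> le; apply/negP => r; apply: no; exists i'.+1.
  apply: (@leq_ltn_trans (size (reals y i'))); first exact: size_reals_leq.
  rewrite realsS; move: r; rewrite /is_real.
  by case: (round y i') => -[a|] [b|] //; rewrite size_rcons.
have le k : j <= k -> j <= block_end k.
  by move=> le; apply: leq_trans le _; rewrite /block_end; lia.
have inv d : waits c (block_start (j + d)) = waits c (block_start j) + d /\
    reals y (block_start (j + d)) = reals y (block_start j).
  elim: d => [|d [E1 E2]]; first by rewrite !addn0.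
  have [|E3 E4] := @waits_after_block (j + d); first by apply/nr/le/leq_addr.
  by rewrite addnS E3 E4 E1 E2 addnS.
set d := W (reals y (block_start j)); have [E1 E2] := inv d.
have [E3 E4] := waits_in_block (leqnn (j + d).+1).
have /negP[] := nr _ (le _ (leq_addr d j)).
have [_] := Hwf (j + d); rewrite /is_real waiter_first -/y /block_end E3 E4 E1 E2.
by rewrite leq_addl.
Qed.

End WellFormedPlay.

(** An ill-formed play would belong to [B], so the winning strategy [S] is forced to write the
    padding correctly. The play of [waiter] is then patient with infinitely many pairs, and
    completeness excludes an outcome in [A]. *)
Lemma second_player_transfer (A B : _ -> Prop) :
  winning2 B S -> (forall y, ~ wf_blocks y -> B y) ->
  (forall y sigma, wf_blocks y -> decodes y sigma -> patient W y ->
     (forall i, exists j, i < size (reals y j)) -> A sigma -> B y) ->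
  exists t, winning2 A t.
Proof.
move=> HS nwf HB; pose Y c := play waiter c.
have lose c : ~ B (Y c) by apply: HS; exact: waiter_consistent.
have wf c : wf_blocks (Y c).
  by apply: Classical_Prop.NNPP => n; apply: (lose c); exact: nwf.
have win c : ~ A (outcome x0 (Y c)).
  move=> HA; apply: (lose c); apply: HB HA => //; first exact: outcomeP.
    exact: patient_play.
  exact: infinitely_many_reals.
have pairs c i : exists j, size (reals (Y c) j) = i /\
    round (Y c) j = (Some (c i), Some (outcome x0 (Y c) i.*2.+1)) /\ outcome x0 (Y c) i.*2 = c i.
  have [j [a [b [Ei Er]]]] := real_round_ex (infinitely_many_reals (wf c) i); exists j.
  have := @outcomeP _ x0 (Y c) j a b Er; rewrite Ei => -[-> ->]; split=> //.
  have : (round (Y c) j).1 = Some a by rewrite Er.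
  by rewrite waiter_first; case: ifP => // _ [Ea]; rewrite Er -Ea Ei.
have causal c c' i : (forall k, k <= i -> c k = c' k) ->
    outcome x0 (Y c) i.*2.+1 = outcome x0 (Y c') i.*2.+1.
  move=> Hc; have [j [Ei [Er _]]] := pairs c i.
  have [E1 E2] := waiter_causal Hc (eq_leq Ei).
  have := @outcomeP _ x0 (Y c') j _ _ (etrans (esym E2) Er).
  by rewrite reals_play -E1 -reals_play Ei => -[].
(* Here [h] has odd length, and its even positions, the letters of Player 1, include the one to be
   answered. *)
exists (fun h => outcome x0 (Y (fun k => nth x0 h k.*2)) (size h)) => x Hx.
suff -> : x = outcome x0 (Y (even_letters x)) by [].
apply: letter_pairs_inj => i; congr (_, _).
  by have [j [_ [_ ->]]] := pairs (even_letters x) i.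
rewrite Hx size_mkseq; apply: causal => k le.
by rewrite nth_mkseq //; lia.
Qed.

End SecondPlayer.

Theorem Det_BCL1_Sigma11 : Det (BCL 1) -> Det Sigma11.
Proof.
move=> HD X A /card_gt0P[x0 _] /block_coding[B [W [HB nwf sound complete]]].
have nonempty : 0 < #|{: option X}| by apply/card_gt0P; exists None.
have [[S HS]|[S HS]] := HD _ B nonempty HB.
  by left; exact: first_player_transfer x0 _ _ _ HS sound.
by right; exact: second_player_transfer x0 _ _ _ _ HS nwf complete.
Qed.

Theorem theorem3p3 :
  (Det Sigma11 <-> Det CFL) /\ (Det CFL <-> Det (BCL 1)).
Proof.
have H1 : Det Sigma11 -> Det CFL by move=> H X A X0 /CFL_Sigma11; exact: H.
have H2 : Det CFL -> Det (BCL 1) by move=> H X A X0 /BCL1_CFL; exact: H.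
by split; split=> // H; [apply: Det_BCL1_Sigma11; exact: H2|apply/H1/Det_BCL1_Sigma11].
Qed.
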